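(* Let $M$ be $\mathbb{C}^*$, $\mathbf{D}^*$ or $\mathbf{D}_r$ ($0<r<1$), and let $f:M\to\mathbb{C}P^2$ be a rotationally equivariant minimal Lagrangian immersion. Then $f$ extends to a rotationally equivariant minimal Lagrangian immersion $\hat f:\mathbb{C}^*\to\mathbb{C}P^2$, and $\hat f$ is obtained by projection from a $2\pi$-periodic translationally equivariant minimal Lagrangian immersion defined on $\mathbb{C}$: there is a translationally equivariant minimal Lagrangian immersion $\tilde f:\mathbb{C}\to\mathbb{C}P^2$ with $\tilde f(w+2\pi)=\tilde f(w)$ and $\hat f(e^{iw})=\tilde f(w)$ for all $w\in\mathbb{C}$.
   Context: $\mathbb{C}P^2$ carries the Fubini–Study metric; immersions of a Riemann surface $M$ are conformal for the given complex structure. $\mathbb{C}^*=\mathbb{C}\setminus\{0\}$, $\mathbf{D}^*=\{0<|z|<1\}$, $\mathbf{D}_r=\{r<|z|<1/r\}$. An immersion $f:M\to\mathbb{C}P^2$ is equivariant relative to a one-parameter group $(\gamma_t,R(t))$ of pairs in $\mathrm{Aut}(M)\times\mathrm{Iso}(\mathbb{C}P^2)$ if $f(\gamma_t\cdot p)=R(t)f(p)$ for all $p\in M$, $t\in\mathbb{R}$. It is rotationally equivariant if $\gamma_t$ is the group of all rotations $z\mapsto e^{it}z$, and translationally equivariant if $\gamma_t$ is the group of all real translations $z\mapsto z+t$. *)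

(* Defs.v *)
From HB Require Import structures.
From mathcomp Require Import all_boot all_order all_algebra complex.
From mathcomp Require Import all_classical all_reals all_analysis.

Set Implicit Arguments.
Unset Strict Implicit.
Unset Printing Implicit Defensive.

Import Order.TTheory GRing.Theory Num.Theory numFieldNormedType.Exports.

Local Open Scope classical_set_scope.
Local Open Scope ring_scope.
Local Open Scope complex_scope.

(* Num.Re and Num.Im are valued in R[i]; the real-valued ones are meant. *)
Local Notation Re := complex.Re.
Local Notation Im := complex.Im.

(* Real differential calculus.  The complex normed space V (V = C or C^3
   below) is regarded as a real vector space: only real increments t occur, so
   [rderive v h z] is the real directional derivative, not the complex one. *)

Definition rderivable (R : realType) (V : normedModType R[i])
    (v : V) (h : V -> R[i]) (z : V) : Prop :=
  derivable (fun t : R => Re (h (z + t%:C *: v))) 0 1 /\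
  derivable (fun t : R => Im (h (z + t%:C *: v))) 0 1.

Definition rderive (R : realType) (V : normedModType R[i])
    (v : V) (h : V -> R[i]) (z : V) : R[i] :=
  derive1 (fun t : R => Re (h (z + t%:C *: v))) 0 +i*
  derive1 (fun t : R => Im (h (z + t%:C *: v))) 0.

Fixpoint Ck_on (R : realType) (V : normedModType R[i]) (k : nat)
    (U : set V) (h : V -> R[i]) : Prop :=
  (forall z, U z -> {for z, continuous (h : V -> R[i]^o)}) /\
  (if k is k'.+1 then
     forall v : V, (forall z, U z -> rderivable v h z) /\
                   Ck_on k' U (rderive v h)
   else True).

Definition smooth_on (R : realType) (V : normedModType R[i])
    (U : set V) (F : V -> 'rV[R[i]]_3) : Prop :=
  forall (k : nat) (j : 'I_3), Ck_on k U (fun z => F z 0 j).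

Definition rderiv3 (R : realType) (V : normedModType R[i])
    (v : V) (F : V -> 'rV[R[i]]_3) (z : V) : 'rV[R[i]]_3 :=
  \row_j rderive v (fun z => F z 0 j) z.

(* The complex projective plane: lines through the origin of C^3. *)

Definition CP2 (R : realType) : Type :=
  {L : {vspace 'rV[R[i]]_3} | \dim L == 1%N}.

Lemma dim_line_e0 (R : realType) :
  \dim (<[(delta_mx 0 0 : 'rV[R[i]]_3)%R]>%VS) == 1%N.
Proof.
rewrite dim_vline.
suff -> : (delta_mx 0 0 : 'rV[R[i]]_3) != 0 by [].
by apply/eqP => /rowP/(_ 0)/eqP; rewrite !mxE !eqxx /= oner_eq0.
Qed.

(* Homogeneous coordinates; the value at v = 0 is a dummy. *)
Definition line (R : realType) (v : 'rV[R[i]]_3) : CP2 R :=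
  insubd (exist (fun L : {vspace 'rV[R[i]]_3} => \dim L == 1%N) _
                (dim_line_e0 R)) <[v]>%VS.

Lemma val_line (R : realType) (v : 'rV[R[i]]_3) :
  v != 0 -> val (line v) = <[v]>%VS.
Proof. by move=> v0; rewrite /line val_insubd dim_vline v0. Qed.

(* The projection C^3 \ {0} -> CP^2 is a holomorphic principal bundle, so a map
   into CP^2 is smooth (resp. continuous) iff it has smooth (resp. continuous)
   local lifts to C^3 \ {0}. *)

Definition local_lift (R : realType) (V : normedModType R[i])
    (f : V -> CP2 R) (p : V) (U : set V) (F : V -> 'rV[R[i]]_3) : Prop :=
  [/\ open U, U p, smooth_on U F &
      forall z, U z -> F z != 0 /\ f z = line (F z)].

Definition smooth_map_on (R : realType) (V : normedModType R[i])
    (D : set V) (f : V -> CP2 R) : Prop :=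
  forall p, D p -> exists U F, local_lift f p U F.

Definition continuous_curve (R : realType) (c : R -> CP2 R) : Prop :=
  forall t0 : R, exists F : R -> 'rV[R[i]]_3,
    {for t0, continuous (F : R -> 'rV[R[i]^o]_3)} /\
    \forall t \near t0, F t != 0 /\ c t = line (F t).

(* The Fubini-Study structure.  A tangent vector of CP^2 at [v] is represented
   by X in C^3 through the differential at v of C^3 \ {0} -> CP^2; its kernel
   is the complex line of v, and [horiz v X] is the representative orthogonal
   to v. *)

Definition hdot (R : realType) (a b : 'rV[R[i]]_3) : R[i] :=
  \sum_j a 0 j * (b 0 j)^*%C.

Definition horiz (R : realType) (v X : 'rV[R[i]]_3) : 'rV[R[i]]_3 :=
  X - (hdot X v / hdot v v) *: v.

Definition fs_metric (R : realType) (v X Y : 'rV[R[i]]_3) : R :=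
  Re (hdot (horiz v X) (horiz v Y) / hdot v v).

(* Kaehler form omega(X, Y) = g(J X, Y). *)
Definition fs_form (R : realType) (v X Y : 'rV[R[i]]_3) : R :=
  fs_metric v ('i%C *: X) Y.

Definition preserves_fs (R : realType) (phi : CP2 R -> CP2 R) : Prop :=
  forall v : 'rV[R[i]]_3, v != 0 ->
    exists U Phi, local_lift (fun u => phi (line u)) v U Phi /\
      forall X Y, fs_metric (Phi v) (rderiv3 X Phi v) (rderiv3 Y Phi v) =
                  fs_metric v X Y.

(* Iso(CP^2): diffeomorphisms phi with phi^* g = g. *)
Definition isometry (R : realType) (phi : CP2 R -> CP2 R) : Prop :=
  exists psi : CP2 R -> CP2 R,
    [/\ cancel phi psi, cancel psi phi,
        smooth_map_on [set v | v != 0] (fun u => psi (line u)) &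
        preserves_fs phi].

(* Surfaces.  Below F is a local lift of a map f from an open subset of C to
   CP^2, so that df(v) at z is represented by [rderiv3 v F z] at the point
   [F z] of CP^2, for a real tangent vector v in C. *)

Definition dlift (R : realType) (F : R[i]^o -> 'rV[R[i]]_3)
    (v : R[i]^o) (z : R[i]^o) : 'rV[R[i]]_3 :=
  horiz (F z) (rderiv3 v F z).

(* First fundamental form f^* g. *)
Definition pullback_metric (R : realType) (F : R[i]^o -> 'rV[R[i]]_3)
    (z v w : R[i]^o) : R :=
  fs_metric (F z) (rderiv3 v F z) (rderiv3 w F z).

(* The covariant derivative nabla_v (df(w)) for the Levi-Civita connection of
   the Fubini-Study metric.  With L the tautological line bundle,
   T CP^2 = Hom(L, L^perp) isometrically, df(w) being the homomorphism
   F |-> dlift F w.  The metric being Kaehler, its Levi-Civita connection is the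
   one induced from the orthogonal projections of the flat connection of C^3
   to L and L^perp, and
     (nabla_v df(w)) F = pr_(L^perp) (d_v (df(w) F)) - df(w) (pr_L (d_v F)). *)
Definition cov_deriv (R : realType) (F : R[i]^o -> 'rV[R[i]]_3)
    (v w : R[i]^o) (z : R[i]^o) : 'rV[R[i]]_3 :=
  horiz (F z) (rderiv3 v (dlift F w) z)
  - (hdot (rderiv3 v F z) (F z) / hdot (F z) (F z)) *: dlift F w z.

(* Component of X orthogonal to the tangent plane spanned by df(1), df(i). *)
Definition normal_part (R : realType) (F : R[i]^o -> 'rV[R[i]]_3)
    (z : R[i]^o) (X : 'rV[R[i]]_3) : 'rV[R[i]]_3 :=
  let g11 := pullback_metric F z 1 1 in
  let g12 := pullback_metric F z 1 'i%C in
  let g22 := pullback_metric F z 'i%C 'i%C in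
  let x1 := fs_metric (F z) X (dlift F 1 z) in
  let x2 := fs_metric (F z) X (dlift F 'i%C z) in
  let d := g11 * g22 - g12 ^+ 2 in
  X - ((g22 * x1 - g12 * x2) / d)%:C *: dlift F 1 z
    - ((g11 * x2 - g12 * x1) / d)%:C *: dlift F 'i%C z.

Definition second_form (R : realType) (F : R[i]^o -> 'rV[R[i]]_3)
    (v w : R[i]^o) (z : R[i]^o) : 'rV[R[i]]_3 :=
  normal_part F z (cov_deriv F v w z).

(* Half the trace of the second fundamental form with respect to f^* g. *)
Definition mean_curvature (R : realType) (F : R[i]^o -> 'rV[R[i]]_3)
    (z : R[i]^o) : 'rV[R[i]]_3 :=
  let g11 := pullback_metric F z 1 1 in
  let g12 := pullback_metric F z 1 'i%C in
  let g22 := pullback_metric F z 'i%C 'i%C in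
  ((2 * (g11 * g22 - g12 ^+ 2))^-1)%:C *:
    (g22%:C *: second_form F 1 1 z
     - (2 * g12)%:C *: second_form F 1 'i%C z
     + g11%:C *: second_form F 'i%C 'i%C z).

Definition immersion_at (R : realType) (F : R[i]^o -> 'rV[R[i]]_3)
    (z : R[i]^o) : Prop :=
  forall v : R[i]^o, dlift F v z = 0 -> v = 0.

Definition conformal_at (R : realType) (F : R[i]^o -> 'rV[R[i]]_3)
    (z : R[i]^o) : Prop :=
  exists2 lam : R, 0 < lam &
    forall v w : R[i], pullback_metric F z v w = lam * Re (v * w^*%C).

Definition lagrangian_at (R : realType) (F : R[i]^o -> 'rV[R[i]]_3)
    (z : R[i]^o) : Prop :=
  forall v w : R[i]^o, fs_form (F z) (rderiv3 v F z) (rderiv3 w F z) = 0.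

Definition minimal_at (R : realType) (F : R[i]^o -> 'rV[R[i]]_3)
    (z : R[i]^o) : Prop :=
  mean_curvature F z = 0.

(* Conformal minimal Lagrangian immersions D -> CP^2 of an open set D of C; the
   values of f outside D are irrelevant. *)
Definition minimal_lagrangian_immersion (R : realType)
    (D : set R[i]^o) (f : R[i]^o -> CP2 R) : Prop :=
  forall p, D p -> exists U F, local_lift f p U F /\
    forall z, U z ->
      [/\ immersion_at F z, conformal_at F z, lagrangian_at F z &
          minimal_at F z].

(* Equivariance. *)

Definition one_parameter_isometries (R : realType)
    (Rt : R -> CP2 R -> CP2 R) : Prop :=
  [/\ forall t, isometry (Rt t),
      forall p, Rt 0 p = p,
      forall s t p, Rt (s + t) p = Rt s (Rt t p) &
      forall p, continuous_curve (fun t => Rt t p)].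

Definition equivariant_on (R : realType) (gamma : R -> R[i]^o -> R[i]^o)
    (D : set R[i]^o) (f : R[i]^o -> CP2 R) : Prop :=
  exists Rt : R -> CP2 R -> CP2 R, one_parameter_isometries Rt /\
    forall p, D p -> forall t, f (gamma t p) = Rt t (f p).

Definition cexp (R : realType) (z : R[i]^o) : R[i]^o :=
  (expR (Re z))%:C * (cos (Im z) +i* sin (Im z)).

Definition rotation (R : realType) (t : R) (z : R[i]^o) : R[i]^o :=
  cexp ('i%C * t%:C) * z.

Definition translation (R : realType) (t : R) (z : R[i]^o) : R[i]^o :=
  z + t%:C.

Definition rotationally_equivariant (R : realType)
    (D : set R[i]^o) (f : R[i]^o -> CP2 R) : Prop :=
  equivariant_on (@rotation R) D f.

Definition translationally_equivariant (R : realType)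
    (D : set R[i]^o) (f : R[i]^o -> CP2 R) : Prop :=
  equivariant_on (@translation R) D f.

Definition punctured_plane (R : realType) : set R[i]^o := [set z | z != 0].

Definition punctured_disk (R : realType) : set R[i]^o :=
  [set z : R[i] | 0 < `|z| < 1].

Definition annulus (R : realType) (r : R) : set R[i]^o :=
  [set z : R[i] | r%:C < `|z| < (r^-1)%:C].

Arguments punctured_plane R : clear implicits.
Arguments punctured_disk R : clear implicits.

(* Main.v *)
(* Embed CP^2 isometrically in the Hermitian matrices by sending a line to its
   orthogonal projector P.  In the coordinate w = x + i y with z = exp (i w), f becomes a
   conformal map P on a horizontal strip with P(w + t) the image of P(w) under an isometry.
   Isometries preserve scalar products of projectors, hence linear relations between
   them, so on the span W of the surface the translations act by a one-parameter
   group of linear isometries Phi_x with skew generator L and P(x, y) = Q(y) Phi_x.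

   A conformal immersion is minimal Lagrangian iff Lap P = |P_x|^2 (1 - 3 P), up to
   tangential terms, which the symmetry kills.  Thus the profile solves
   Q'' = |Q L|^2 (1 - 3 Q) - Q L L, which becomes a quadratic system once r = |Q L|^2 is
   an unknown.  Its solutions are analytic, and they are global since
   |Q| = 1 and |Q'| = |Q L| persist.  All the conditions on Q Phi_x (rank one
   projector, conformality, values in W) are analytic in y, so they persist on the
   whole plane; the conformal factor never vanishes, by uniqueness for the system.
   Periodicity in x lets the map descend through exp (i w). *)

Require Import Defs.
From HB Require Import structures.
From mathcomp Require Import all_boot all_order all_algebra complex ring lra.
From mathcomp Require Import all_classical all_reals all_analysis.

Set Implicit Arguments.
Unset Strict Implicit.
Unset Printing Implicit Defensive.

Import Order.TTheory GRing.Theory Num.Theory numFieldNormedType.Exports.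

Local Open Scope classical_set_scope.
Local Open Scope ring_scope.
Local Open Scope complex_scope.

Local Notation Re := complex.Re.
Local Notation Im := complex.Im.

(** * Complex-valued derivatives and C^k functions *)

(** An isometry is given only as a smooth bijection preserving the metric, so no unitary matrix
    behind it is at hand. A distance comparison replaces it: along a geodesic the scalar product of
    projectors is cos^2 of the distance, and a map that preserves speeds cannot decrease it faster
    than the geodesic does. Since R(-t) undoes R(t), scalar products are preserved. Linearity is
    thereby obtained only on the span W of the surface. This is why the flow is built from a
    pseudo-inverse of finitely many spanning points, and why equivariance of the extension, under
    the same group R(t), rests on the extended surface staying in W. Quadratic fields are chosen
    because their Taylor coefficients obey a convolution recursion with an explicit geometric
    majorant: the radius of convergence depends only on the size of the initial state. The
    conservation laws that bound the state are never differentiated; they are inherited from the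
    original strip as identities between analytic functions. A state with |Q L| = 0 is a rest point,
    which is the uniqueness argument for the conformal factor. *)

Definition is_cderive (R : realType) (phi : R -> R[i]) (t : R) (l : R[i]) : Prop :=
  is_derive t 1 (fun s => Re (phi s)) (Re l) /\
  is_derive t 1 (fun s => Im (phi s)) (Im l).

Section CDerive.
Variable R : realType.
Implicit Types (phi psi : R -> R[i]) (t : R) (l m : R[i]).

Lemma Re_Im_eta (z : R[i]) : z = Re z +i* Im z. Proof. by case: z. Qed.
Lemma re_add (x y : R[i]) : Re (x + y) = Re x + Re y. Proof. by case: x; case: y. Qed.
Lemma im_add (x y : R[i]) : Im (x + y) = Im x + Im y. Proof. by case: x; case: y. Qed.
Lemma re_opp (x : R[i]) : Re (- x) = - Re x. Proof. by case: x. Qed.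
Lemma im_opp (x : R[i]) : Im (- x) = - Im x. Proof. by case: x. Qed.
Lemma re_mul (x y : R[i]) : Re (x * y) = Re x * Re y - Im x * Im y.
Proof. by case: x; case: y. Qed.
Lemma im_mul (x y : R[i]) : Im (x * y) = Re x * Im y + Im x * Re y.
Proof. by case: x; case: y. Qed.
Lemma re_conj (x : R[i]) : Re (x^*)%C = Re x. Proof. by case: x. Qed.
Lemma im_conj (x : R[i]) : Im (x^*)%C = - Im x. Proof. by case: x. Qed.
Lemma re_inv (x : R[i]) : Re (x^-1) = Re x / (Re x ^+ 2 + Im x ^+ 2).
Proof. by case: x. Qed.
Lemma im_inv (x : R[i]) : Im (x^-1) = - Im x / (Re x ^+ 2 + Im x ^+ 2).
Proof. by case: x => a b /=; rewrite mulNr. Qed.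
Definition re_imE := (re_add, im_add, re_opp, im_opp, re_mul, im_mul, re_conj, im_conj).

Lemma complexP (x y : R[i]) : Re x = Re y -> Im x = Im y -> x = y.
Proof. by case: x => a b; case: y => c d /= -> ->. Qed.

Lemma sqr_norm_neq0 (z : R[i]) : z != 0 -> Re z ^+ 2 + Im z ^+ 2 != 0.
Proof.
case: z => a b; rewrite eq_complex /= negb_and => ab.
by rewrite paddr_eq0 ?sqr_ge0// !sqrf_eq0 negb_and.
Qed.

Lemma is_cderive_eq phi t l m : is_cderive phi t l -> l = m -> is_cderive phi t m.
Proof. by move=> ? <-. Qed.

Lemma is_cderive_unique phi t l m :
  is_cderive phi t l -> is_cderive phi t m -> l = m.
Proof.
move=> [a b] [c d]; apply: complexP.
- by rewrite -(@derive_val _ _ _ _ _ _ _ a) -(@derive_val _ _ _ _ _ _ _ c).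
- by rewrite -(@derive_val _ _ _ _ _ _ _ b) -(@derive_val _ _ _ _ _ _ _ d).
Qed.

Lemma is_cderive_near phi psi t l :
  (\forall s \near t, phi s = psi s) -> is_cderive phi t l -> is_cderive psi t l.
Proof.
move=> e [a b]; split.
- apply: near_eq_is_derive a.
  by apply: filterS e => s ->.
- apply: near_eq_is_derive b.
  by apply: filterS e => s ->.
Qed.

Lemma is_cderive_ext phi psi t l :
  phi =1 psi -> is_cderive phi t l -> is_cderive psi t l.
Proof. by move=> e; apply: is_cderive_near; near=> s; exact: e. Unshelve. all: end_near. Qed.

Lemma is_cderive_cst (c : R[i]) t : is_cderive (fun=> c) t 0.
Proof. by split; exact: is_derive_cst. Qed.

Lemma is_cderiveD phi psi t l m : is_cderive phi t l -> is_cderive psi t m ->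
  is_cderive (fun s => phi s + psi s) t (l + m).
Proof.
move=> [a b] [c d]; split; rewrite ?re_add ?im_add.
- have -> : (fun s => Re (phi s + psi s)) =
    (fun s => Re (phi s)) \+ (fun s => Re (psi s)).
    by apply/funext => s; rewrite /= re_add.
  exact: is_deriveD.
- have -> : (fun s => Im (phi s + psi s)) =
    (fun s => Im (phi s)) \+ (fun s => Im (psi s)).
    by apply/funext => s; rewrite /= im_add.
  exact: is_deriveD.
Qed.

Lemma is_deriveM' (f g : R -> R) t (a b : R) : is_derive t 1 f a -> is_derive t 1 g b ->
  is_derive t 1 (fun s => f s * g s) (a * g t + f t * b).
Proof.
move=> ha hb; apply: (@is_derive_eq _ _ _ _ _ _ _ _ (@is_deriveM _ _ _ _ _ _ _ _ ha hb)).
by rewrite addrC /GRing.scale /= (mulrC (g t)).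
Qed.

Lemma is_cderiveM phi psi t l m : is_cderive phi t l -> is_cderive psi t m ->
  is_cderive (fun s => phi s * psi s) t (l * psi t + phi t * m).
Proof.
move=> [a b] [c d]; split; rewrite !re_imE.
- have -> : (fun s => Re (phi s * psi s)) =
    (fun s => Re (phi s) * Re (psi s)) \- (fun s => Im (phi s) * Im (psi s)).
    by apply/funext => s; rewrite /= re_mul.
  apply: (@is_derive_eq _ _ _ _ _ _ _ _
    (@is_deriveB _ _ _ _ _ _ _ _ _ (is_deriveM' a c) (is_deriveM' b d))).
  by ring.
- have -> : (fun s => Im (phi s * psi s)) =
    (fun s => Re (phi s) * Im (psi s)) \+ (fun s => Im (phi s) * Re (psi s)).
    by apply/funext => s; rewrite /= im_mul.
  apply: (@is_derive_eq _ _ _ _ _ _ _ _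
    (@is_deriveD _ _ _ _ _ _ _ _ _ (is_deriveM' a d) (is_deriveM' b c))).
  by ring.
Qed.

Lemma is_cderiveZ (c : R[i]) phi t l : is_cderive phi t l ->
  is_cderive (fun s => c * phi s) t (c * l).
Proof.
move=> h; apply: is_cderive_eq (is_cderiveM (is_cderive_cst c t) h) _.
by rewrite mul0r add0r.
Qed.

Lemma is_cderive_conj phi t l : is_cderive phi t l ->
  is_cderive (fun s => (phi s)^*)%C t (l^*)%C.
Proof.
move=> [a b]; split; rewrite !re_imE.
- by have -> : (fun s => Re (phi s)^*%C) = fun s => Re (phi s)
    by apply/funext => s; rewrite re_conj.
- have -> : (fun s => Im (phi s)^*%C) = - (fun s => Im (phi s))
    by apply/funext => s; rewrite im_conj.
  exact: is_deriveN.
Qed.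

Lemma is_cderive_real (f : R -> R) t (a : R) :
  is_derive t 1 f a -> is_cderive (fun s => (f s)%:C) t a%:C.
Proof. by move=> h; split => //=; exact: is_derive_cst. Qed.

(** Written as conjugate over squared modulus, the inverse needs only the derivative of a real
    inverse. *)
Lemma is_cderiveV phi t l : phi t != 0 -> is_cderive phi t l ->
  is_cderive (fun s => (phi s)^-1) t (- l / phi t ^+ 2).
Proof.
move=> p0 hp; have [a b] := hp.
pose n s := Re (phi s) ^+ 2 + Im (phi s) ^+ 2.
have n0 : n t != 0 by exact: sqr_norm_neq0.
have hn : is_derive t 1 n (2 * Re (phi t) * Re l + 2 * Im (phi t) * Im l).
  apply: (@is_derive_eq _ _ _ _ _ _ _ _
    (@is_deriveD _ _ _ _ _ _ _ _ _ (is_deriveM' a a) (is_deriveM' b b))).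
  by ring.
have hV : is_derive t 1 (fun s => (n s)^-1)
   (- (2 * Re (phi t) * Re l + 2 * Im (phi t) * Im l) / n t ^+ 2).
  apply: DeriveDef; first by apply: derivableV => //; exact: ex_derive.
  by rewrite deriveV//= derive_val /GRing.scale /= mulrC mulNr mulrN.
have := is_cderiveM (is_cderive_conj hp) (is_cderive_real hV).
have E s : (phi s)^*%C * ((n s)^-1)%:C = (phi s)^-1.
  by apply: complexP; rewrite !re_imE /= ?re_inv ?im_inv mulr0 ?subr0 ?add0r.
move/(is_cderive_ext E) => h; apply: is_cderive_eq h _.
have nE : (n t)%:C = phi t * (phi t)^*%C.
  by apply: complexP; rewrite !re_imE /= /n; ring.
have nC0 : (n t)%:C != 0 by rewrite fmorph_eq0.
have lE : (2 * Re (phi t) * Re l + 2 * Im (phi t) * Im l)%:C =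
   l * (phi t)^*%C + l^*%C * phi t.
  by apply: complexP; rewrite !re_imE /=; ring.
have c0 : (phi t)^*%C != 0 by move: nC0; rewrite nE mulf_eq0 negb_or => /andP[].
have -> (x y : R) : (- x / y ^+ 2)%:C = - x%:C / y%:C ^+ 2.
  by rewrite rmorphM fmorphV rmorphXn rmorphN.
have -> : ((n t)^-1)%:C = (n t)%:C^-1 by rewrite fmorphV.
rewrite lE nE.
by field; rewrite p0.
Qed.

Lemma is_cderive_sum (n : nat) (phi : 'I_n -> R -> R[i]) t (l : 'I_n -> R[i]) :
  (forall i, is_cderive (phi i) t (l i)) ->
  is_cderive (fun s => \sum_(i < n) phi i s) t (\sum_(i < n) l i).
Proof.
elim: n phi l => [|n IH] phi l h.
  rewrite big_ord0; apply: is_cderive_ext (is_cderive_cst 0 t) => s.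
  by rewrite big_ord0.
rewrite big_ord_recl; apply: is_cderive_ext; last first.
  apply: is_cderiveD (h ord0) _; apply: (IH (fun i => phi (lift ord0 i))) => i.
  exact: h.
by move=> s; rewrite big_ord_recl.
Qed.

Lemma is_derive_comp1 (f g : R -> R) t (a b : R) :
  is_derive t 1 g b -> is_derive (g t) 1 f a ->
  is_derive t 1 (fun s => f (g s)) (a * b).
Proof.
move=> hg hf.
have [df dg] : derivable f (g t) 1 /\ derivable g t 1 by split; exact: ex_derive.
apply: DeriveDef.
  apply/derivable1_diffP; apply: differentiable_comp; exact/derivable1_diffP.
rewrite -derive1E derive1_comp// !derive1E.
by rewrite (@derive_val _ _ _ _ _ _ _ hg) (@derive_val _ _ _ _ _ _ _ hf).
Qed.

Lemma is_derive_continuous (f : R -> R) t (a : R) :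
  is_derive t 1 f a -> {for t, continuous f}.
Proof.
move=> h; apply: differentiable_continuous; apply/derivable1_diffP.
exact: ex_derive.
Qed.

End CDerive.

Section Ck.
Variables (R : realType) (V : normedModType R[i]).
Implicit Types (U : set V) (f g h : V -> R[i]) (v z : V).

Lemma rderiveP v h z l :
  is_cderive (fun t => h (z + t%:C *: v)) 0 l <->
  rderivable v h z /\ rderive v h z = l.
Proof.
split=> [[a b]|[[a b] <-]].
- split; first by split; exact: ex_derive.
  rewrite /rderive !derive1E (@derive_val _ _ _ _ _ _ _ a).
  by rewrite (@derive_val _ _ _ _ _ _ _ b) -Re_Im_eta.
- by split; rewrite /= derive1E; exact: derivableP.
Qed.

Lemma near_line U z v : open U -> U z -> \forall t \near (0 : R), U (z + t%:C *: v).
Proof.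
move=> oU Uz; have /nbhs_ballP[e /= e0 he] : nbhs z U by exact: open_nbhs_nbhs.
(* Radii and norms in a normed module over [R[i]] are complex numbers; being nonnegative, they come
   from reals. *)
have [d d0 dE] : exists2 d : R, 0 < d & e = d%:C.
  move: e0; rewrite ltcE /= => /andP[/eqP ei ep].
  by exists (Re e) => //; apply: complexP.
have [m m0 mE] : exists2 m : R, 0 <= m & `|v| = m%:C.
  have := normr_ge0 v; rewrite lecE /= => /andP[/eqP ei ep].
  by exists (Re `|v|) => //; apply: complexP.
have b0 : 0 < d / (m + 1) by rewrite divr_gt0// ltr_wpDl.
near=> t; have ht : `|t| < d / (m + 1) by near: t; exact: (@nbhs0_lt R R^o).
apply: he; rewrite -ball_normE /= opprD addrA subrr sub0r normrN normrZ.
rewrite mE dE normc_def /= expr0n addr0 sqrtr_sqr -rmorphM ltcR.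
apply: (@le_lt_trans _ _ (`|t| * (m + 1))).
  by rewrite ler_wpM2l// lerDl.
by rewrite -ltr_pdivlMr// ltr_wpDl.
Unshelve. all: end_near. Qed.

Lemma rderive_local U v f g z l : open U -> U z ->
  (forall y, U y -> f y = g y) ->
  is_cderive (fun t => f (z + t%:C *: v)) 0 l ->
  is_cderive (fun t => g (z + t%:C *: v)) 0 l.
Proof.
move=> oU Uz e; apply: is_cderive_near.
by apply: filterS (near_line v oU Uz) => t; exact: e.
Qed.

Lemma Ck_on_continuous k U h z : Ck_on k U h -> U z ->
  {for z, continuous (h : V -> R[i]^o)}.
Proof. by case: k => [|k] [c _]; exact: c. Qed.

Lemma Ck_on_rderivable k U h v z : Ck_on k.+1 U h -> U z ->
  is_cderive (fun t => h (z + t%:C *: v)) 0 (rderive v h z).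
Proof. by move=> [_ d] Uz; apply/rderiveP; split => //; case: (d v) => + _; apply. Qed.

Lemma Ck_on_rderive k U h v : Ck_on k.+1 U h -> Ck_on k U (rderive v h).
Proof. by move=> [_ d]; case: (d v). Qed.

Lemma Ck_on_ext k U f g : open U -> (forall z, U z -> f z = g z) ->
  Ck_on k U f -> Ck_on k U g.
Proof.
move=> oU; elim: k f g => [|k IH] f g e [c d].
all: have cg : forall z, U z -> {for z, continuous (g : V -> R[i]^o)}.
- 1,3: move=> z Uz; rewrite /prop_for /continuous_at -e//.
  1,2: apply: cvg_trans (c z Uz); apply: near_eq_cvg.
  1,2: by near=> y; apply: e; near: y; exact: open_nbhs_nbhs.
- by [].
split=> // v; have [d1 d2] := d v.
have D z : U z -> is_cderive (fun t => g (z + t%:C *: v)) 0 (rderive v f z).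
  by move=> Uz; apply: rderive_local e _ => //; apply/rderiveP; split => //; exact: d1.
split=> [z /D/rderiveP[]//|].
by apply: IH d2 => z /D/rderiveP[].
Unshelve. all: end_near. Qed.

Lemma Ck_onS k U h : Ck_on k.+1 U h -> Ck_on k U h.
Proof.
elim: k h => [|k IH] h [c d]; first by split.
by split=> // v; have [d1 d2] := d v; split => //; exact: IH.
Qed.

(* Reduces closure properties to the continuous case and to a formula for the directional derivative. *)
Lemma Ck_onS_intro k U h (dh : V -> V -> R[i]) : open U ->
  (forall z, U z -> {for z, continuous (h : V -> R[i]^o)}) ->
  (forall v z, U z -> is_cderive (fun t => h (z + t%:C *: v)) 0 (dh v z)) ->
  (forall v, Ck_on k U (dh v)) -> Ck_on k.+1 U h.
Proof.
move=> oU c d H; split=> // v; split=> [z /(d v)/rderiveP[]//|].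
by apply: Ck_on_ext (H v) => // z /(d v)/rderiveP[].
Qed.

Lemma Ck_on_cst k U (c : R[i]) : open U -> Ck_on k U (fun=> c).
Proof.
move=> oU; have cc (d : R[i]) z : U z -> {for z, continuous ((fun=> d) : V -> R[i]^o)}.
  by move=> _; exact: cst_continuous.
elim: k c => [|k IH] c; first by split => // z; exact: cc.
apply: (Ck_onS_intro (dh := fun _ _ => 0)) => //; first exact: cc.
by move=> v z _; exact: is_cderive_cst.
Qed.

Lemma Ck_onD k U f g : open U -> Ck_on k U f -> Ck_on k U g ->
  Ck_on k U (fun z => f z + g z).
Proof.
move=> oU; elim: k f g => [|k IH] f g cf cg.
all: have c : forall z, U z -> {for z, continuous ((fun z => f z + g z) : V -> R[i]^o)}.
- 1,3: move=> z Uz.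
  1,2: apply: (@cvgD _ R[i]^o _ (nbhs z) _ _ _ _ _
    (Ck_on_continuous cf Uz) (Ck_on_continuous cg Uz)).
- by split.
apply: (Ck_onS_intro (dh := fun v z => rderive v f z + rderive v g z)) => //.
- move=> v z Uz; exact: is_cderiveD (Ck_on_rderivable v cf Uz) (Ck_on_rderivable v cg Uz).
- by move=> v; apply: IH; exact: Ck_on_rderive.
Qed.

Lemma Ck_onM k U f g : open U -> Ck_on k U f -> Ck_on k U g ->
  Ck_on k U (fun z => f z * g z).
Proof.
move=> oU; elim: k f g => [|k IH] f g cf cg.
all: have c : forall z, U z -> {for z, continuous ((fun z => f z * g z) : V -> R[i]^o)}.
- 1,3: move=> z Uz.
  1,2: apply: (@cvgM R[i] _ (nbhs z) _ _ _ _ _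
    (Ck_on_continuous cf Uz) (Ck_on_continuous cg Uz)).
- by split.
apply: (Ck_onS_intro (dh := fun v z => rderive v f z * g z + f z * rderive v g z)) => //.
- move=> v z Uz.
  apply: is_cderive_eq (is_cderiveM (Ck_on_rderivable v cf Uz) (Ck_on_rderivable v cg Uz)) _.
  by rewrite scale0r addr0.
- move=> v; apply: Ck_onD => //; apply: IH => //; try exact: Ck_on_rderive; exact: Ck_onS.
Qed.

Lemma Ck_on_conj k U f : open U -> Ck_on k U f -> Ck_on k U (fun z => (f z)^*%C).
Proof.
move=> oU; elim: k f => [|k IH] f cf.
all: have c : forall z, U z -> {for z, continuous ((fun z => (f z)^*%C) : V -> R[i]^o)}.
- 1,3: move=> z Uz; apply/cvgrPdist_lt => e e0.
  1,2: have /cvgrPdist_lt/(_ e e0) := Ck_on_continuous cf Uz.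
  1,2: by apply: filterS => t; rewrite -rmorphB /= normcJ.
- by split.
apply: (Ck_onS_intro (dh := fun v z => (rderive v f z)^*%C)) => //.
- by move=> v z Uz; exact: is_cderive_conj (Ck_on_rderivable v cf Uz).
- by move=> v; apply: IH; exact: Ck_on_rderive.
Qed.

Lemma Ck_onV k U f : open U -> (forall z, U z -> f z != 0) ->
  Ck_on k U f -> Ck_on k U (fun z => (f z)^-1).
Proof.
move=> oU; elim: k f => [|k IH] f f0 cf.
all: have c : forall z, U z -> {for z, continuous ((fun z => (f z)^-1) : V -> R[i]^o)}.
- 1,3: move=> z Uz.
  1,2: apply: (@cvgV R[i] _ (nbhs z) _ _ _ (f0 z Uz) (Ck_on_continuous cf Uz)).
- by split.
apply: (Ck_onS_intro (dh := fun v z => - 1 * rderive v f z * ((f z)^-1 * (f z)^-1))) => //.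
- move=> v z Uz; apply: is_cderive_eq.
    by apply: is_cderiveV (Ck_on_rderivable v cf Uz); rewrite scale0r addr0; exact: f0.
  by rewrite /= scale0r addr0 mulN1r -expr2 exprVn.
- move=> v; apply: Ck_onM => //; apply: Ck_onM => //.
  + exact: Ck_on_cst.
  + exact: Ck_on_rderive.
  + by apply: IH => //; exact: Ck_onS.
  + by apply: IH => //; exact: Ck_onS.
Qed.

Lemma Ck_on_sum k U n (f : 'I_n -> V -> R[i]) : open U ->
  (forall i, Ck_on k U (f i)) -> Ck_on k U (fun z => \sum_(i < n) f i z).
Proof.
move=> oU; elim: n f => [|n IH] f cf.
  by apply: Ck_on_ext (Ck_on_cst k 0 oU) => // z _; rewrite big_ord0.
apply: Ck_on_ext (Ck_onD oU (cf ord0) (IH (fun i => f (lift ord0 i)) _)) => //.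
by move=> z _; rewrite big_ord_recl.
Qed.

End Ck.

(** * The chain rule from directional derivatives *)

Section Chain.
Variable R : realType.

Lemma gt0_complex (e : R[i]) : 0 < e -> exists2 d : R, 0 < d & e = d%:C.
Proof.
rewrite ltcE /= => /andP[/eqP ei ep].
by exists (Re e) => //; apply: complexP.
Qed.

Lemma normc_ltP (z : R[i]) (d : R) : `|z| < d%:C -> `|Re z| < d /\ `|Im z| < d.
Proof.
case: z => a b; rewrite normc_def /= ltcR => h.
split; apply: le_lt_trans h; rewrite -sqrtr_sqr ler_wsqrtr// ?lerDl ?lerDr ?sqr_ge0//.
Qed.

Lemma normc_ltI (z : R[i]) (d : R) :
  `|Re z| < d / 2 -> `|Im z| < d / 2 -> `|z| < d%:C.
Proof.
case: z => a b /= ha hb; rewrite normc_def /= ltcR.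
apply: (@le_lt_trans _ _ (`|a| + `|b|)); last by lra.
rewrite -(@ger0_norm _ (`|a| + `|b|)) ?addr_ge0// -sqrtr_sqr ler_wsqrtr//.
rewrite -(real_normK (num_real a)) -(real_normK (num_real b)) sqrrD.
rewrite -addrA [_ *+ 2 + _]addrC addrA lerDl.
by rewrite mulrn_wge0// mulr_ge0.
Qed.

Lemma continuous_complexP (h : R[i]^o -> R[i]^o) (z : R[i]^o) :
  {for z, continuous h} <->
  forall e : R, 0 < e -> exists2 d : R, 0 < d & forall w : R[i],
    `|Re w - Re z| < d -> `|Im w - Im z| < d ->
    `|Re (h w) - Re (h z)| < e /\ `|Im (h w) - Im (h z)| < e.
Proof.
split=> [/cvgrPdist_lt H e e0|H].
  have e0' : 0 < e%:C by rewrite ltcR.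
  have /nbhs_ballP[d /= /gt0_complex[d' d'0 ->] hd] := H _ e0'.
  exists (d' / 2) => [|w h1 h2]; first by rewrite divr_gt0.
  have /hd : ball z d'%:C w.
    rewrite -ball_normE /= distrC; apply: normc_ltI; by rewrite !re_imE.
  by rewrite /= distrC => /normc_ltP; rewrite !re_imE.
apply/(@cvgrPdist_lt R[i] R[i]^o _ (nbhs z) (nbhs_filter (z : R[i]^o))) => e /gt0_complex[e' e'0 ->].
have [|d d0 hd] := H (e' / 2); first by rewrite divr_gt0.
apply/nbhs_ballP; exists d%:C; first by rewrite /= ltcR.
move=> w; rewrite -ball_normE /= distrC => /normc_ltP; rewrite !re_imE => -[h1 h2].
rewrite distrC; have [? ?] := hd w h1 h2; apply: normc_ltI; by rewrite !re_imE.
Qed.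

Lemma open_complex_box (U : set R[i]^o) (z : R[i]) : open U -> U z ->
  exists2 d : R, 0 < d & forall w : R[i],
    `|Re w - Re z| < d -> `|Im w - Im z| < d -> U w.
Proof.
move=> oU Uz; have /nbhs_ballP[e /= /gt0_complex[d d0 ->] he] : nbhs (z : R[i]^o) U.
  exact: open_nbhs_nbhs.
exists (d / 2) => [|w h1 h2]; first by rewrite divr_gt0.
apply: he; rewrite -ball_normE /= distrC; apply: normc_ltI; by rewrite !re_imE.
Qed.

Lemma is_deriveI (f : R -> R) (t l : R) :
  (h^-1 * (f (h + t) - f t)) @[h --> 0^'] --> l -> is_derive t 1 f l.
Proof.
move=> H.
have E : (fun h : R => h^-1 *: (f (h *: 1 + t) - f t)) =
         (fun h => h^-1 * (f (h + t) - f t)).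
  by apply/funext => h; rewrite /GRing.scale /= mulr1.
apply: DeriveDef.
  by rewrite /derivable E; apply: cvgP H.
by rewrite /derive E; exact: cvg_lim.
Qed.

Lemma is_deriveE (f : R -> R) (t l : R) :
  is_derive t 1 f l -> (h^-1 * (f (h + t) - f t)) @[h --> 0^'] --> l.
Proof.
move=> H.
have E : (fun h : R => h^-1 *: (f (h *: 1 + t) - f t)) =
         (fun h => h^-1 * (f (h + t) - f t)).
  by apply/funext => h; rewrite /GRing.scale /= mulr1.
have d : derivable f t 1 by exact: ex_derive.
have <- : 'D_1 f t = l by exact: derive_val.
by move: d; rewrite /derivable /derive E.
Qed.

(** Since [g] vanishes at [t], the difference quotient of the product is [k] times that of [g];
    continuity of [k] is then enough. It serves for difference quotients [k], in the manner of
    Caratheodory. *)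
Lemma is_derive_cont_mul (k g : R -> R) (t a : R) :
  {for t, continuous k} -> g t = 0 -> is_derive t 1 g a ->
  is_derive t 1 (fun s => k s * g s) (k t * a).
Proof.
move=> kt g0 /is_deriveE; rewrite g0 => hg; apply: is_deriveI.
have E : (fun h : R => h^-1 * (k (h + t) * g (h + t) - k t * g t)) =
         (fun h => k (h + t) * (h^-1 * (g (h + t) - 0))).
  by apply/funext => h; rewrite g0; ring.
rewrite E; apply: cvgM => //.
apply: (@cvg_comp _ _ _ (fun h => h + t) k _ (nbhs t)) => //.
apply: cvg_within_filter.
have : (fun h : R => h + t) @ nbhs 0 --> 0 + t.
  by apply: cvgD => //; exact: cvg_cst.
by rewrite add0r.
Qed.

Lemma MVT_le (f df : R -> R) (a b : R) :
  (forall x, Num.min a b <= x <= Num.max a b -> is_derive x 1 f (df x)) ->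
  exists2 c, Num.min a b <= c <= Num.max a b & f b - f a = df c * (b - a).
Proof.
have H (p q : R) : p <= q -> (forall x, p <= x <= q -> is_derive x 1 f (df x)) ->
    exists2 c, p <= c <= q & f q - f p = df c * (q - p).
  move=> pq hd; have [||c] := @MVT_segment _ f df p q pq.
  - by move=> x; rewrite in_itv /= => /andP[/ltW ? /ltW ?]; apply: hd; apply/andP.
  - apply: derivable_within_continuous => x; rewrite in_itv /= => hx.
    by have := hd x hx => ?; exact: ex_derive.
  - by rewrite in_itv /=; exists c.
case: (leP a b) => ab hd; first exact: H.
have [c hc E] := H b a (ltW ab) hd; exists c => //.
by rewrite -opprB E -mulrN opprB.
Qed.

Lemma dist_between (a b x : R) : Num.min a b <= x <= Num.max a b ->
  `|x - a| <= `|b - a|.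
Proof.
case: (leP a b) => ab /andP[x1 x2].
  by rewrite !ger0_norm ?subr_ge0//; lra.
by rewrite !ler0_norm ?subr_le0// ?(ltW ab)//; lra.
Qed.

(** The increment is split into a step in x at height [b s] and a step in y at abscissa [a t]. The
    mean value theorem handles the first, so only the x-derivative has to be continuous; the
    y-derivative is used at a single point. *)
Lemma is_derive_chain2 (u ux : R -> R -> R) (a b : R -> R) (t a' b' uy r : R) :
  0 < r ->
  (forall x y, `|x - a t| < r -> `|y - b t| < r ->
    is_derive x 1 (u^~ y) (ux x y)) ->
  (forall e : R, 0 < e -> exists2 d : R, 0 < d & forall x y,
    `|x - a t| < d -> `|y - b t| < d -> `|ux x y - ux (a t) (b t)| < e) ->
  is_derive (b t) 1 (u (a t)) uy ->
  is_derive t 1 a a' -> is_derive t 1 b b' ->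
  is_derive t 1 (fun s => u (a s) (b s)) (ux (a t) (b t) * a' + uy * b').
Proof.
move=> r0 hux cux huy ha hb.
(* The difference quotient of [u] in its first argument, completed by its limit where the
   denominator vanishes. *)
pose k s := if a s == a t then ux (a t) (b t)
            else (u (a s) (b s) - u (a t) (b s)) / (a s - a t).
have E : (fun s => u (a s) (b s)) =
   (fun s => k s * (a s - a t)) \+ (fun s => u (a t) (b s)).
  apply/funext => s /=; rewrite /k; case: eqP => [->|/eqP ast].
    by rewrite subrr mulr0 add0r.
  by rewrite divfK ?subr_eq0// subrK.
have hk : is_derive t 1 (fun s => k s * (a s - a t)) (ux (a t) (b t) * a').
  have -> : ux (a t) (b t) = k t by rewrite /k eqxx.
  apply: is_derive_cont_mul; rewrite ?subrr//; last first.
    rewrite -[X in is_derive _ _ _ X]subr0.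
    by apply: (@is_deriveB _ _ _ a (cst (a t))) => //; exact: is_derive_cst.
  apply/cvgrPdist_lt => e e0; rewrite /k eqxx.
  have [d d0 hd] := cux e e0.
  have m0 : 0 < Num.min d r by rewrite lt_min d0.
  have /cvgrPdist_lt/(_ _ m0) na := is_derive_continuous ha.
  have /cvgrPdist_lt/(_ _ m0) nb := is_derive_continuous hb.
  near=> s; case: eqP => [_|/eqP ast]; first by rewrite subrr normr0.
  have has : `|a s - a t| < Num.min d r by rewrite distrC; near: s.
  have hbs : `|b s - b t| < Num.min d r by rewrite distrC; near: s.
  move: has hbs; rewrite !lt_min => /andP[as1 as2] /andP[bs1 bs2].
  have [x /dist_between x1|c hc ->] := @MVT_le (u^~ (b s)) (ux^~ (b s)) (a t) (a s).
    by apply: hux => //; exact: le_lt_trans as2.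
  rewrite mulfK ?subr_eq0// distrC; apply: hd => //.
  exact: le_lt_trans (dist_between hc) as1.
rewrite E; apply: is_deriveD => //.
Unshelve. all: end_near. Qed.

Lemma is_derive_trans (f : R -> R) (x l : R) :
  is_derive (0 : R) 1 (fun t => f (x + t)) l <-> is_derive x 1 f l.
Proof.
split=> [H|H].
  have H2 : is_derive (x - x) 1 (fun t => f (x + t)) l by rewrite subrr.
  have h1 : is_derive x 1 (fun s : R => s - x) 1.
    by rewrite -[X in is_derive _ _ _ X]subr0; apply: is_deriveB.
  have := is_derive_comp1 (f := fun t => f (x + t)) (g := fun s => s - x) h1 H2.
  by rewrite mulr1; under eq_fun do rewrite addrC subrK.
have H2 : is_derive (x + 0) 1 f l by rewrite addr0.
have h1 : is_derive (0 : R) 1 (fun s : R => x + s) 1.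
  by rewrite -[X in is_derive _ _ _ X]add0r; apply: is_deriveD.
by have := is_derive_comp1 (f := f) (g := fun s => x + s) h1 H2; rewrite mulr1.
Qed.

Lemma is_cderive_trans (f : R -> R[i]) (x : R) (l : R[i]) :
  is_cderive (fun t => f (x + t)) 0 l <-> is_cderive f x l.
Proof.
rewrite /is_cderive.
by rewrite (is_derive_trans (fun t => Re (f t))) (is_derive_trans (fun t => Im (f t))).
Qed.

Definition pdx (h : R[i]^o -> R[i]) : R[i]^o -> R[i] := rderive (1 : R[i]^o) h.
Definition pdy (h : R[i]^o -> R[i]) : R[i]^o -> R[i] := rderive ('i%C : R[i]^o) h.

(** [Ck_on] speaks of one fixed direction at a time. Continuity of the derivative in the direction 1
    upgrades this to differentiation along any curve, hence to linearity in the direction and to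
    composition. *)
Lemma C1_chain (U : set R[i]^o) (h : R[i]^o -> R[i]) (c : R -> R[i]) (t : R) (c' : R[i]) :
  open U -> Ck_on 1 U h -> U (c t) -> is_cderive c t c' ->
  is_cderive (fun s => h (c s)) t
    ((Re c')%:C * pdx h (c t) + (Im c')%:C * pdy h (c t)).
Proof.
move=> oU Ch Uc [ha hb].
have [r r0 hr] := open_complex_box oU Uc.
have Dx (x y : R) : U (x +i* y) ->
    is_cderive (fun s => h (s +i* y)) x (pdx h (x +i* y)).
  move=> Uxy; apply/is_cderive_trans.
  apply: is_cderive_ext (Ck_on_rderivable (1 : R[i]^o) Ch Uxy) => s; congr (h _).
  by apply: complexP; rewrite !re_imE /= ?mulr1 ?mulr0 ?mul0r ?subr0 ?addr0.
have Dy (x y : R) : U (x +i* y) ->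
    is_cderive (fun s => h (x +i* s)) y (pdy h (x +i* y)).
  move=> Uxy; apply/is_cderive_trans.
  apply: is_cderive_ext (Ck_on_rderivable ('i%C : R[i]^o) Ch Uxy) => s; congr (h _).
  by apply: complexP; rewrite !re_imE /= ?mulr1 ?mulr0 ?mul0r ?subr0 ?addr0.
have Ec : c t = Re (c t) +i* Im (c t) by exact: Re_Im_eta.
have cont : forall e : R, 0 < e -> exists2 d : R, 0 < d & forall x y : R,
    `|x - Re (c t)| < d -> `|y - Im (c t)| < d ->
    `|Re (pdx h (x +i* y)) - Re (pdx h (c t))| < e /\
    `|Im (pdx h (x +i* y)) - Im (pdx h (c t))| < e.
  move=> e e0.
  have /continuous_complexP/(_ e e0)[d d0 hd] :=
    Ck_on_continuous (Ck_on_rderive (1 : R[i]^o) Ch) Uc.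
  by exists d => // x y hx hy; apply: hd.
have Ubox x y : `|x - Re (c t)| < r -> `|y - Im (c t)| < r -> U (x +i* y).
  by move=> ? ?; exact: hr.
have Uc' : U (Re (c t) +i* Im (c t)) by rewrite -Ec.
have Rr (a : R) (z : R[i]) : Re (a%:C * z) = a * Re z by rewrite re_mul /= mul0r subr0.
have Ir (a : R) (z : R[i]) : Im (a%:C * z) = a * Im z by rewrite im_mul /= mul0r addr0.
have EX : pdx h (c t) = pdx h (Re (c t) +i* Im (c t)) by rewrite -Ec.
have EY : pdy h (c t) = pdy h (Re (c t) +i* Im (c t)) by rewrite -Ec.
split; rewrite ?(re_add, im_add) !(Rr, Ir).
- have -> : (fun s => Re (h (c s))) =
      (fun s => (fun x y => Re (h (x +i* y))) (Re (c s)) (Im (c s))).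
    by apply/funext => s; rewrite -Re_Im_eta.
  rewrite !(mulrC (Re c')) !(mulrC (Im c')) EX EY.
  apply: (is_derive_chain2 (r := r) (u := fun x y => Re (h (x +i* y)))
    (ux := fun x y => Re (pdx h (x +i* y))) (a := fun s => Re (c s))
    (b := fun s => Im (c s))) => //.
  + by move=> x y hx hy; have [] := Dx _ _ (Ubox _ _ hx hy).
  + move=> e e0; have [d d0 hd] := cont e e0; exists d => // x y hx hy.
    by rewrite -Ec; case: (hd x y hx hy).
  + by have [] := Dy _ _ Uc'.
- have -> : (fun s => Im (h (c s))) =
      (fun s => (fun x y => Im (h (x +i* y))) (Re (c s)) (Im (c s))).
    by apply/funext => s; rewrite -Re_Im_eta.
  rewrite !(mulrC (Re c')) !(mulrC (Im c')) EX EY.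
  apply: (is_derive_chain2 (r := r) (u := fun x y => Im (h (x +i* y)))
    (ux := fun x y => Im (pdx h (x +i* y))) (a := fun s => Re (c s))
    (b := fun s => Im (c s))) => //.
  + by move=> x y hx hy; have [] := Dx _ _ (Ubox _ _ hx hy).
  + move=> e e0; have [d d0 hd] := cont e e0; exists d => // x y hx hy.
    by rewrite -Ec; case: (hd x y hx hy).
  + by have [] := Dy _ _ Uc'.
Qed.

End Chain.

(** * Real analytic functions *)

Section PowerSeries.
Variable R : realType.
Implicit Types (a c u v : nat -> R) (h g : R -> R) (M K q y : R).

Definition geo_bounded a M K := forall n, `|a n| <= M * K ^+ n.

(** A linear factor is absorbed by a slightly larger ratio: with [p = q / q'], each of the [n + 1]
    terms of 1 + p + ... + p^n is at least p^n, and their sum is at most 1 / (1 - p). *)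
Lemma nSgeo_bound q q' : 0 <= q -> q < q' ->
  exists2 C, 0 < C & forall n, n.+1%:R * q ^+ n <= C * q' ^+ n.
Proof.
move=> q0 qq'; have q'0 : 0 < q' by exact: le_lt_trans qq'.
pose p := q / q'; have p0 : 0 <= p by rewrite divr_ge0// ltW.
have p1 : p < 1 by rewrite ltr_pdivrMr// mul1r.
exists (1 - p)^-1 => [|n]; first by rewrite invr_gt0 subr_gt0.
rewrite -ler_pdivrMr ?exprn_gt0// -mulrA -expr_div_n -/p.
rewrite -[_^-1]mul1r ler_pdivlMr ?subr_gt0//.
have sumE : \sum_(i < n.+1) p ^+ i * (1 - p) = 1 - p ^+ n.+1.
  rewrite -mulr_suml mulrC -[in RHS](expr1n _ n.+1) subrXX; congr (_ * _).
  by apply: eq_bigr => i _; rewrite expr1n mul1r.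
apply: (@le_trans _ _ (1 - p ^+ n.+1)); last first.
  by rewrite gerBl exprn_ge0.
rewrite -sumE -mulr_suml ler_wpM2r ?subr_ge0 ?(ltW p1)//.
rewrite mulr_natl -[X in _ *+ X](card_ord n.+1) -sumr_const; apply: ler_sum => i _.
by rewrite ler_wiXn2l// ?(ltW p1)// -ltnS.
Qed.

Lemma cvg_geo_bounded a M K t : geo_bounded a M K -> 0 <= K -> `|t| * K < 1 ->
  cvgn (pseries a t).
Proof.
move=> aMK K0 tK; apply: normed_cvg.
have M0 : 0 <= M.
  by have := aMK 0; rewrite expr0 mulr1; exact: le_trans.
apply: (@series_le_cvg _ _ (geometric M (`|t| * K))).
- by move=> n /=.
- by move=> n; rewrite /= mulr_ge0// exprn_ge0// mulr_ge0.
- move=> n /=; rewrite normrM exprMn normrX [leRHS]mulrCA [leLHS]mulrC ler_wpM2l//.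
- by apply: is_cvg_geometric_series; rewrite ger0_norm// mulr_ge0.
Qed.

Lemma geo_bounded_diffs a M K K' : geo_bounded a M K -> 0 <= K -> K < K' ->
  exists M', geo_bounded (pseries_diffs a) M' K'.
Proof.
move=> aMK K0 KK'; have [C C0 HC] := nSgeo_bound K0 KK'.
have M0 : 0 <= M.
  by have := aMK 0; rewrite expr0 mulr1; exact: le_trans.
exists (M * K * C) => n; rewrite /pseries_diffs normrM ger0_norm//.
apply: (@le_trans _ _ (n.+1%:R * (M * K ^+ n.+1))).
  by rewrite ler_wpM2l// aMK.
rewrite exprS [leLHS](_ : _ = M * K * (n.+1%:R * K ^+ n)); last by ring.
by rewrite -[leRHS]mulrA ler_wpM2l// mulr_ge0.
Qed.

(** Termwise differentiation asks for convergence of the series and of its first two formal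
    derivatives at a point [T] beyond [t]. Each formal derivative costs a larger ratio, hence the
    chain [K < K1 < K2 < T^-1]. *)
Lemma is_derive_pseries a M K (t : R) : geo_bounded a M K -> 0 < K -> `|t| * K < 1 ->
  is_derive t 1 (fun s => limn (pseries a s)) (limn (pseries (pseries_diffs a) t)).
Proof.
move=> aMK K0 tK.
pose T := (`|t| + K^-1) / 2.
have Ki : 0 < K^-1 by rewrite invr_gt0.
have tKi : `|t| < K^-1 by rewrite -[K^-1]mul1r ltr_pdivlMr.
have T0 : 0 < T by rewrite divr_gt0// ltr_wpDl.
have tT : `|t| < T by rewrite /T; lra.
have TKi : T < K^-1 by rewrite /T; lra.
have KT : K < T^-1 by rewrite -[K]invrK ltf_pV2.
have [K2 KK2 K2T] : exists2 K2, K < K2 & K2 < T^-1.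
  by exists ((K + T^-1) / 2); lra.
have [K1 KK1 K12] : exists2 K1, K < K1 & K1 < K2.
  by exists ((K + K2) / 2); lra.
have [M1 a1] := geo_bounded_diffs aMK (ltW K0) KK1.
have K10 : 0 < K1 by exact: lt_trans KK1.
have [M2 a2] := geo_bounded_diffs a1 (ltW K10) K12.
have K20 : 0 < K2 by exact: lt_trans K12.
have TN (k : R) : k < T^-1 -> `|T| * k < 1.
  by move=> kT; rewrite gtr0_norm// mulrC -ltr_pdivlMr// mul1r.
apply: (@pseries_snd_diffs _ _ T).
- exact: cvg_geo_bounded aMK (ltW K0) (TN _ KT).
- by apply: cvg_geo_bounded a1 (ltW K10) (TN _ _); exact: lt_trans K2T.
- exact: cvg_geo_bounded a2 (ltW K20) (TN _ K2T).
- by rewrite (gtr0_norm T0).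
Qed.

Definition cauchy_prod u v n := \sum_(k < n.+1) u k * v (n - k)%N.

Lemma sum_conv u v n : \sum_(m < n) cauchy_prod u v m =
  \sum_(i < n) \sum_(j < n | (i + j < n)%N) u i * v j.
Proof.
transitivity (\sum_(m < n) \sum_(i < n) \sum_(j < n | (i + j == m)%N) u i * v j).
  apply: eq_bigr => m _; rewrite /cauchy_prod.
  rewrite (big_ord_widen n (fun k => u k * v (m - k)%N)) ?ltn_ord//.
  rewrite big_mkcond /=; apply: eq_bigr => i _; case: ifPn => [im|].
    have jn : (m - i < n)%N by exact: leq_ltn_trans (leq_subr _ _) (ltn_ord m).
    rewrite (big_pred1 (Ordinal jn))// => j /=.
    rewrite -val_eqE /=; apply/eqP/eqP => [<-|->]; first by rewrite addKn.
    by rewrite subnKC.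
  rewrite -leqNgt => mi; rewrite big_pred0// => j; apply/eqP => ijm.
  by move: mi; rewrite -ijm -addSn leqNgt ltnS leq_addr.
rewrite exchange_big /=; apply: eq_bigr => i _.
under eq_bigr do rewrite big_mkcond.
rewrite exchange_big /= [RHS]big_mkcond; apply: eq_bigr => j _.
rewrite -big_mkcond /=; case: ifPn => ij.
  by rewrite (big_pred1 (Ordinal ij))// => m; rewrite /= -val_eqE eq_sym.
by rewrite big_pred0// => m; apply/eqP => ijm; move: ij; rewrite ijm ltn_ord.
Qed.

(** The product of the partial sums differs from the partial sum of the Cauchy product by the terms
    with i + j >= n. There are at most n^2 of them, each at most M^2 q^n, so two uses of
    [nSgeo_bound] make the difference geometric. *)
Lemma cvg_conv u v (A B : R) M q : 0 <= q -> q < 1 ->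
  geo_bounded u M q -> geo_bounded v M q ->
  series u @ \oo --> A -> series v @ \oo --> B ->
  series (cauchy_prod u v) @ \oo --> A * B.
Proof.
move=> q0 q1 hu hv uA vB.
have M0 : 0 <= M.
  by have := hu 0; rewrite expr0 mulr1; exact: le_trans.
have [q2 qq2 q21] : exists2 p, q < p & p < 1 by exists ((q + 1) / 2); lra.
have [p1 qp1 p12] : exists2 p, q < p & p < q2 by exists ((q + q2) / 2); lra.
have [C C0 HC] := nSgeo_bound q0 qp1.
have p10 : 0 <= p1 by exact: le_trans (ltW qp1).
have [D D0 HD] := nSgeo_bound p10 p12.
have q20 : 0 <= q2 by exact: le_trans (ltW p12).
have bnd n : `|(series u n * series v n) - series (cauchy_prod u v) n| <= M ^+ 2 * C * D * q2 ^+ n.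
  rewrite !seriesEord /= sum_conv mulr_suml -sumrB.
  apply: (@le_trans _ _ (\sum_(i < n) \sum_(j < n) M ^+ 2 * q ^+ n)).
    apply: le_trans (ler_norm_sum _ _ _) _; apply: ler_sum => i _.
    rewrite mulr_sumr [X in _ - X]big_mkcond /= -sumrB.
    apply: le_trans (ler_norm_sum _ _ _) _; apply: ler_sum => j _.
    case: ifPn => [ij|].
      by rewrite subrr normr0 mulr_ge0// exprn_ge0.
    rewrite -leqNgt subr0 => ij; rewrite normrM.
    apply: (@le_trans _ _ (M * q ^+ i * (M * q ^+ j))).
      by apply: ler_pM; rewrite ?normr_ge0// ?hu ?hv.
    rewrite mulrACA -expr2 -exprD ler_wpM2l ?exprn_ge0//.
    by rewrite ler_wiXn2l// ltW.
  rewrite !sumr_const !card_ord -mulrnA.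
  apply: (@le_trans _ _ (M ^+ 2 * (n.+1%:R * (n.+1%:R * q ^+ n)))).
    rewrite -mulrnAr ler_wpM2l ?exprn_ge0// -mulr_natl natrM mulrA.
    by rewrite ler_wpM2r ?exprn_ge0// -!natrM ler_nat leq_mul.
  rewrite (_ : _ * q2 ^+ n = M ^+ 2 * (C * (D * q2 ^+ n))); last by ring.
  apply: ler_wpM2l; first exact: exprn_ge0.
  apply: (@le_trans _ _ (n.+1%:R * (C * p1 ^+ n))); first by rewrite ler_wpM2l.
  by rewrite mulrCA ler_wpM2l// ltW.
have uvAB : (series u \* series v) n @[n --> \oo] --> A * B by exact: cvgM.
rewrite -[A * B]subr0.
have -> : series (cauchy_prod u v) = (fun n => (series u \* series v) n -
    ((series u n * series v n) - series (cauchy_prod u v) n)).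
  by apply/funext => n /=; ring.
apply: cvgB => //; apply/norm_cvg0P.
have g0 : geometric (M ^+ 2 * C * D) q2 n @[n --> \oo] --> 0.
  by apply: cvg_geometric; rewrite ger0_norm.
apply: (@squeeze_cvgr _ _ _ _ (fun=> 0) (geometric (M ^+ 2 * C * D) q2)) => //.
  by apply: nearW => n; rewrite normr_ge0 bnd.
exact: cvg_cst.
Qed.

(** The geometric bound plays the role of a radius of convergence: the expansion is demanded on the
    ball of radius [K^-1], where the bound already forces absolute convergence. *)
Definition analytic_at h y0 := exists a M K, [/\ 0 < K, geo_bounded a M K &
  forall y, `|y - y0| * K < 1 -> pseries a (y - y0) @ \oo --> h y].

Lemma geo_bounded_le a M K M' K' : geo_bounded a M K -> M <= M' -> 0 <= K <= K' ->
  geo_bounded a M' K'.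
Proof.
move=> aMK MM' /andP[K0 KK'] n; apply: le_trans (aMK n) _.
have M0 : 0 <= M.
  by have := aMK 0; rewrite expr0 mulr1; exact: le_trans.
apply: ler_pM => //; first exact: exprn_ge0.
by rewrite lerXn2r// nnegrE// (le_trans K0).
Qed.

Lemma analytic_at_ext h g y0 r : 0 < r -> (forall y, `|y - y0| < r -> h y = g y) ->
  analytic_at h y0 -> analytic_at g y0.
Proof.
move=> r0 e [a [M [K [K0 aMK H]]]].
exists a, M, (Num.max K r^-1); split; first by rewrite lt_max K0.
  by apply: geo_bounded_le aMK _ _; rewrite // le_max lexx (ltW K0).
move=> y hy; have ri : 0 < r^-1 by rewrite invr_gt0.
rewrite -e; first apply: H.
  by apply: le_lt_trans hy; rewrite ler_wpM2l// le_max lexx.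
have : `|y - y0| * r^-1 < 1.
  by apply: le_lt_trans hy; rewrite ler_wpM2l// le_max lexx orbT.
by rewrite ltr_pdivrMr// mul1r.
Qed.

Lemma analytic_at_cst (c : R) y0 : analytic_at (fun=> c) y0.
Proof.
exists (fun n => if n is 0 then c else 0), `|c|, 1; split => //.
  by case=> [|n]; rewrite expr1n mulr1// normr0.
move=> y _; apply/cvgrPdist_le => e e0; near=> n.
have n0 : (0 < n)%N by near: n; exists 1.
rewrite -(prednK n0) /pseries seriesEord /= big_ord_recl /= expr0 mulr1 big1.
  by rewrite addr0 subrr normr0 ltW.
by move=> i _; rewrite mul0r.
Unshelve. all: end_near. Qed.

Lemma analytic_atD h g y0 : analytic_at h y0 -> analytic_at g y0 ->
  analytic_at (fun y => h y + g y) y0.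
Proof.
move=> [a [M [K [K0 aMK H]]]] [c [M' [K' [K'0 cMK G]]]].
pose L := Num.max K K'.
have [KL K'L] : K <= L /\ K' <= L by rewrite !le_max !lexx orbT.
have aL : geo_bounded a M L by apply: geo_bounded_le aMK _ _; rewrite // ltW.
have cL : geo_bounded c M' L by apply: geo_bounded_le cMK _ _; rewrite // ltW.
exists (fun n => a n + c n), (M + M'), L; split; first exact: lt_le_trans KL.
  move=> n; apply: le_trans (ler_normD _ _) _; rewrite mulrDl.
  exact: lerD (aL n) (cL n).
move=> y hy.
have -> : pseries (fun n => a n + c n) (y - y0) =
    (fun n => pseries a (y - y0) n + pseries c (y - y0) n).
  apply/funext => n; rewrite /pseries !seriesEord /= -big_split /=.
  by apply: eq_bigr => i _; rewrite mulrDl.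
apply: cvgD; [apply: H|apply: G]; apply: le_lt_trans hy; exact: ler_wpM2l.
Qed.

Lemma conv_expr a c t n : cauchy_prod a c n * t ^+ n =
  cauchy_prod (fun k => a k * t ^+ k) (fun k => c k * t ^+ k) n.
Proof.
rewrite /cauchy_prod mulr_suml; apply: eq_bigr => i _.
by rewrite mulrACA -exprD subnKC// -ltnS.
Qed.

Lemma geo_bounded_conv a c M M' K K' : 0 <= K -> K < K' ->
  geo_bounded a M K -> geo_bounded c M' K ->
  exists M'', geo_bounded (cauchy_prod a c) M'' K'.
Proof.
move=> K0 KK' aMK cMK; have [C C0 HC] := nSgeo_bound K0 KK'.
have M0 : 0 <= M.
  by have := aMK 0; rewrite expr0 mulr1; exact: le_trans.
have M'0 : 0 <= M'.
  by have := cMK 0; rewrite expr0 mulr1; exact: le_trans.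
exists (M * M' * C) => n; rewrite /cauchy_prod.
apply: (@le_trans _ _ (\sum_(k < n.+1) M * M' * K ^+ n)).
  apply: le_trans (ler_norm_sum _ _ _) _; apply: ler_sum => i _; rewrite normrM.
  apply: (@le_trans _ _ (M * K ^+ i * (M' * K ^+ (n - i)))).
    by apply: ler_pM.
  by rewrite mulrACA -exprD subnKC// -ltnS.
rewrite sumr_const card_ord -mulrnAr -mulr_natl -!mulrA.
by rewrite !ler_wpM2l.
Qed.

Lemma geo_bounded_expr a M K t : geo_bounded a M K ->
  geo_bounded (fun n => a n * t ^+ n) M (`|t| * K).
Proof.
move=> aMK n; rewrite normrM normrX exprMn [leRHS]mulrCA [leLHS]mulrC ler_wpM2l//.
Qed.

Lemma cvg_pseries_conv a c M K t (A B : R) : 0 <= K -> `|t| * K < 1 ->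
  geo_bounded a M K -> geo_bounded c M K ->
  pseries a t @ \oo --> A -> pseries c t @ \oo --> B ->
  pseries (cauchy_prod a c) t @ \oo --> A * B.
Proof.
move=> K0 tK aMK cMK aA cB.
have -> : pseries (cauchy_prod a c) t =
    series (cauchy_prod (fun k => a k * t ^+ k) (fun k => c k * t ^+ k)).
  by rewrite /pseries; congr series; apply/funext => n; exact: conv_expr.
by apply: cvg_conv tK _ _ aA cB; rewrite ?mulr_ge0//; exact: geo_bounded_expr.
Qed.

Lemma analytic_atM h g y0 : analytic_at h y0 -> analytic_at g y0 ->
  analytic_at (fun y => h y * g y) y0.
Proof.
move=> [a [M [K [K0 aMK H]]]] [c [M' [K' [K'0 cMK G]]]].
pose L := Num.max K K'; pose N := Num.max M M'.
have [KL K'L] : K <= L /\ K' <= L by rewrite !le_max !lexx orbT.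
have [MN M'N] : M <= N /\ M' <= N by rewrite !le_max !lexx orbT.
have L0 : 0 < L by exact: lt_le_trans KL.
have aL : geo_bounded a N L by apply: geo_bounded_le aMK _ _; rewrite // ltW.
have cL : geo_bounded c N L by apply: geo_bounded_le cMK _ _; rewrite // ltW.
(* Any ratio larger than [L] would do; the excess absorbs the n + 1 terms of each Cauchy
   coefficient. *)
have L2 : L < 2 * L by lra.
have [P cP] := geo_bounded_conv (ltW L0) L2 aL cL.
exists (cauchy_prod a c), P, (2 * L); split => //; first by rewrite mulr_gt0.
move=> y hy; have hL : `|y - y0| * L < 1.
  by apply: le_lt_trans hy; rewrite ler_wpM2l// ltW.
apply: (cvg_pseries_conv (ltW L0) hL aL cL); [apply: H|apply: G];
  by apply: le_lt_trans hL; exact: ler_wpM2l.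
Qed.

Lemma analytic_at_sum n (h : 'I_n -> R -> R) y0 :
  (forall i, analytic_at (h i) y0) -> analytic_at (fun y => \sum_(i < n) h i y) y0.
Proof.
elim: n h => [|n IH] h H.
  apply: (analytic_at_ext (r := 1) _ _ (analytic_at_cst 0 y0)) => // y _.
  by rewrite big_ord0.
have := analytic_atD (H ord0) (IH (fun i => h (lift ord0 i)) (fun i => H _)).
by apply: (analytic_at_ext (r := 1)) => // y _; rewrite big_ord_recl.
Qed.

Lemma analytic_atB h g y0 : analytic_at h y0 -> analytic_at g y0 ->
  analytic_at (fun y => h y - g y) y0.
Proof.
move=> hh hg; have := analytic_atD hh (analytic_atM (analytic_at_cst (-1) y0) hg).
by apply: (analytic_at_ext (r := 1)) => // y _; rewrite mulN1r.
Qed.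

(** If [a m] is the first coefficient not yet known to vanish, then at a zero [t] of the sum
    [a m * t ^+ m] equals minus the tail, which is of order |t|^(m+1). Zeros arbitrarily close to 0
    force [a m = 0]. *)
Lemma pseries0_coef a M K : 0 < K -> geo_bounded a M K ->
  (forall e : R, 0 < e -> exists2 t : R, 0 < `|t| < e &
     pseries a t @ \oo --> (0 : R)) -> forall n, a n = 0.
Proof.
move=> K0 aMK H; suff S m : forall n, (n < m)%N -> a n = 0 by move=> n; exact: (S n.+1).
elim: m => [//|m IH] n; rewrite ltnS leq_eqVlt => /orP[/eqP ->|]; last exact: IH.
apply/eqP; rewrite -normr_le0; apply/ler_addgt0Pr => e e0; rewrite add0r.
have M0 : 0 <= M by have := aMK 0; rewrite expr0 mulr1; exact: le_trans.
(* The tail is at most |t|^(m+1) M K^(m+1) times a geometric sum of ratio below 1/2, which is at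
   most 2; the final 1 makes [D] positive. *)
pose D := M * K ^+ m.+1 * 2 + 1.
have D0 : 0 < D by rewrite ltr_wpDl// !mulr_ge0// exprn_ge0// ltW.
have [|t /andP[t0 tlt] ct] := H (Num.min (2 * K)^-1 (e / D)).
  by rewrite lt_min invr_gt0 mulr_gt0//= divr_gt0.
move: tlt; rewrite lt_min => /andP[tK te].
have tK2 : `|t| * K < 2^-1.
  by move: tK; rewrite invfM -ltr_pdivlMr// mulrC.
have tn0 : t != 0 by rewrite -normr_gt0.
have tail k : `|a m * t ^+ m - pseries a t (k + m.+1)%N| <= `|t| ^+ m.+1 * D.
  rewrite /pseries seriesEord /= addnC big_split_ord /= big_ord_recr /=.
  rewrite [X in X + _ + _]big1 ?add0r; last by move=> i _; rewrite IH ?mul0r.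
  rewrite opprD addrA subrr sub0r normrN.
  apply: le_trans (ler_norm_sum _ _ _) _.
  apply: (@le_trans _ _ (\sum_(i < k) `|t| ^+ m.+1 * (M * K ^+ m.+1) * (`|t| * K) ^+ i)).
    apply: ler_sum => i _; have := geo_bounded_expr t aMK (m.+1 + i)%N.
    move/le_trans; apply; rewrite exprD [_ ^+ m.+1]exprMn le_eqVlt; apply/orP; left.
    by apply/eqP; ring.
  rewrite -mulr_sumr -mulrA ler_wpM2l ?exprn_ge0//.
  have S : \sum_(i < k) (`|t| * K) ^+ i <= 2.
    have tk0 : 0 <= `|t| * K by rewrite mulr_ge0// ltW.
    have E : (\sum_(i < k) (`|t| * K) ^+ i) * (1 - `|t| * K) = 1 - (`|t| * K) ^+ k.
      rewrite mulrC -[in RHS](expr1n _ k) subrXX; congr (_ * _).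
      by apply: eq_bigr => i _; rewrite expr1n mul1r.
    have S0 : 0 <= \sum_(i < k) (`|t| * K) ^+ i by apply: sumr_ge0 => i _; rewrite exprn_ge0.
    have : (\sum_(i < k) (`|t| * K) ^+ i) * 2^-1 <= 1.
      apply: (@le_trans _ _ (1 - (`|t| * K) ^+ k)); last by rewrite gerBl exprn_ge0.
      by rewrite -E ler_wpM2l//; lra.
    by lra.
  apply: (@le_trans _ _ (M * K ^+ m.+1 * 2)); last by rewrite /D lerDl.
  by rewrite ler_wpM2l// mulr_ge0// exprn_ge0// ltW.
have le1 : `|a m * t ^+ m| <= `|t| ^+ m.+1 * D.
  have c2 : `|a m * t ^+ m - pseries a t (k + m.+1)%N| @[k --> \oo] --> `|a m * t ^+ m|.
    have -> : `|a m * t ^+ m| = `|a m * t ^+ m - 0| by rewrite subr0.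
    apply: (@cvg_norm R R^o); apply: cvgB; first exact: cvg_cst.
    by rewrite cvg_shiftn.
  rewrite -(cvg_lim _ c2)//; apply: limr_le; first by apply: cvgP c2.
  exact: nearW.
move: le1; rewrite normrM normrX exprSr -mulrA mulrC.
rewrite ler_pM2l ?exprn_gt0 ?normr_gt0// => /le_trans; apply.
by rewrite -ler_pdivlMr// ltW.
Qed.

Lemma analytic_at_zero h y0 : analytic_at h y0 ->
  (forall e : R, 0 < e -> exists2 y : R, 0 < `|y - y0| < e & h y = 0) ->
  \forall y \near y0, h y = 0.
Proof.
move=> [a [M [K [K0 aMK H]]]] acc.
have Ki : 0 < K^-1 by rewrite invr_gt0.
have a0 : forall n, a n = 0.
  apply: (pseries0_coef K0 aMK) => e e0.
  have [|y hy y0E] := acc (Num.min e K^-1); first by rewrite lt_min e0.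
  move: hy; rewrite lt_min => /and3P[y1 y2 y3].
  exists (y - y0); first by rewrite y1.
  by rewrite -y0E; apply: H; rewrite -ltr_pdivlMr// mul1r.
exists K^-1 => // y /=; rewrite distrC => hy.
have : pseries a (y - y0) @ \oo --> h y by apply: H; rewrite -ltr_pdivlMr// mul1r.
have -> : pseries a (y - y0) = fun=> 0.
  by apply/funext => n; rewrite /pseries seriesEord /= big1// => i _; rewrite a0 mul0r.
move=> c; rewrite -(cvg_lim (@norm_hausdorff R R^o) c).
by rewrite (@lim_cst R^o _ _ _ _ _); last exact: norm_hausdorff.
Qed.

(** The points near which [h] vanishes form an open set. It is closed in [I]: a limit of such points
    is a non-isolated zero, and [analytic_at_zero] applies there. Connectedness of the interval
    concludes. *)
Lemma analytic_identity (I : set R) h y0 : is_interval I ->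
  (forall y, I y -> analytic_at h y) -> I y0 -> (\forall y \near y0, h y = 0) ->
  forall y, I y -> h y = 0.
Proof.
move=> itvI anI Iy0 h0.
pose Z : set R := [set y | \forall z \near (y : R), h z = 0].
suff IZ : I `&` Z = I.
  by move=> y Iy; move: (Iy); rewrite -IZ => -[_ /nbhs_singleton].
have /connected_intervalP := itvI; apply.
- by exists y0.
- exists Z => //; rewrite (_ : Z = [set y | h y = 0]°) //; exact: open_interior.
- exists (closure Z); first exact: closed_closure.
  apply/seteqP; split=> y [Iy Zy]; split=> //; first exact: subset_closure.
  apply: analytic_at_zero; first exact: anI.
  move=> e e0.
  have [w [Zw /= yw]] := Zy _ (nbhsx_ballx y e e0).
  have [d /= d0 hd] := Zw.
  have ed0 : 0 < Num.min (e - `|y - w|) d.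
    by rewrite lt_min d0 subr_gt0 andbT.
  set m := Num.min _ _ in ed0.
  have [md me] : m <= d /\ m <= e - `|y - w| by rewrite !ge_min !lexx orbT.
  (* The accumulating zeros must differ from [y], while the approximating point [w] may equal it; a
     small shift [s] inside the neighbourhood of zeros of [w] repairs this. *)
  have key s : `|s| < m -> 0 < `|w + s - y| -> 
      exists2 y1 : R, 0 < `|y1 - y| < e & h y1 = 0.
    move=> sm ne; exists (w + s); last first.
      by apply: hd; rewrite /= opprD addrA subrr sub0r normrN (lt_le_trans sm).
    rewrite ne /=; apply: (@le_lt_trans _ _ (`|y - w| + `|s|)); last by lra.
    by rewrite [`|y - w|]distrC -addrA [s - y]addrC addrA ler_normD.
  have [|wy] := eqVneq w y.
    move=> E; apply: (key (m / 2)); first by rewrite ger0_norm; lra.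
    by rewrite E addrC addKr normr_gt0; lra.
  by apply: (key 0); rewrite ?normr0// addr0 normr_gt0 subr_eq0.
Qed.

End PowerSeries.

(** * Quadratic differential equations *)

Section QuadraticODE.
Variables (R : realType) (N : nat) (b : 'I_N -> 'I_N -> 'I_N -> R).
Implicit Types (x z : R -> 'I_N -> R) (D I : set R).

Definition qform (v w : 'I_N -> R) (i : 'I_N) : R :=
  \sum_(j < N) \sum_(k < N) b i j k * (v j * w k).

Definition qsol x D := forall y, D y -> forall i,
  is_derive y 1 (fun s => x s i) (qform (x y) (x y) i).

Definition qbound : R := 1 + \sum_(i < N) \sum_(j < N) \sum_(k < N) `|b i j k|.

Lemma qbound_gt0 : 0 < qbound.
Proof. by rewrite ltr_wpDr// !sumr_ge0// => i _; rewrite sumr_ge0// => j _; rewrite sumr_ge0. Qed.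

Lemma qbound_row i : \sum_(j < N) \sum_(k < N) `|b i j k| <= qbound.
Proof.
rewrite /qbound [X in 1 + X](bigD1 i)//= addrCA lerDl addr_ge0// sumr_ge0// => j _.
by rewrite sumr_ge0// => k _; rewrite sumr_ge0.
Qed.

Lemma qform_bound (v w : 'I_N -> R) (A B : R) i : (forall j, `|v j| <= A) ->
  (forall j, `|w j| <= B) -> `|qform v w i| <= qbound * (A * B).
Proof.
move=> hv hw.
have A0 : 0 <= A by apply: le_trans (hv i).
have B0 : 0 <= B by apply: le_trans (hw i).
apply: le_trans (ler_wpM2r _ (qbound_row i)); last exact: mulr_ge0.
rewrite mulr_suml; apply: le_trans (ler_norm_sum _ _ _) _; apply: ler_sum => j _.
rewrite mulr_suml; apply: le_trans (ler_norm_sum _ _ _) _; apply: ler_sum => k _.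
by rewrite normrM ler_wpM2l// normrM ler_pM.
Qed.

(* [qtable x0 n m] is the Taylor coefficient of index [m] as soon as [m <= n]. *)
Fixpoint qtable (x0 : 'I_N -> R) (n : nat) : nat -> 'I_N -> R :=
  if n is n'.+1 then
    fun m i => if (m <= n')%N then qtable x0 n' m i else
      n'.+1%:R^-1 * \sum_(k < n'.+1) qform (qtable x0 n' k) (qtable x0 n' (n' - k)%N) i
  else fun _ => x0.

Definition qcoef (x0 : 'I_N -> R) (n : nat) : 'I_N -> R := qtable x0 n n.

Lemma qtableE (x0 : 'I_N -> R) n m : (m <= n)%N -> qtable x0 n m = qcoef x0 m.
Proof.
elim: n => [|n IH]; first by rewrite leqn0 => /eqP ->.
rewrite leq_eqVlt => /orP[/eqP -> //|]; rewrite ltnS => mn.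
by rewrite -IH//; apply/funext => i /=; rewrite mn.
Qed.

Lemma qcoefS (x0 : 'I_N -> R) n i : qcoef x0 n.+1 i =
  n.+1%:R^-1 * \sum_(k < n.+1) qform (qcoef x0 k) (qcoef x0 (n - k)%N) i.
Proof.
rewrite /qcoef /= ltnn; congr (_ * _); apply: eq_bigr => k _.
by rewrite !qtableE// ?leq_subr// -ltnS.
Qed.

(** The majorant is the Taylor series of M / (1 - qbound M t), the solution of u' = qbound u^2 with
    u(0) = M. In the recursion all n + 1 summands get the same bound, which cancels the factor 1 /
    (n + 1). *)
Lemma qcoef_bound (x0 : 'I_N -> R) (M : R) : 0 < M -> (forall i, `|x0 i| <= M) ->
  forall n i, `|qcoef x0 n i| <= M * (qbound * M) ^+ n.
Proof.
move=> M0 hx0 n; elim/ltn_ind: n => -[_ i|n IH i]; first by rewrite expr0 mulr1.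
rewrite qcoefS normrM ger0_norm ?invr_ge0// mulrC ler_pdivrMr//.
apply: (@le_trans _ _ (\sum_(k < n.+1) M * (qbound * M) ^+ n.+1)).
  apply: le_trans (ler_norm_sum _ _ _) _; apply: ler_sum => k _.
  apply: le_trans (qform_bound i (IH k (ltn_ord k)) (IH (n - k)%N _)) _.
    by rewrite ltnS leq_subr.
  have kn : (k <= n)%N by rewrite -ltnS.
  have E : (qbound * M) ^+ k * (qbound * M) ^+ (n - k) = (qbound * M) ^+ n.
    by rewrite -exprD subnKC.
  by rewrite [_ ^+ n.+1]exprS -E le_eqVlt; apply/orP; left; apply/eqP; ring.
by rewrite sumr_const card_ord mulr_natr.
Qed.

Lemma pseries_at0 (a : nat -> R) : pseries a 0 @ \oo --> a 0%N.
Proof.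
apply/cvgrPdist_le => e e0; near=> n.
have n0 : (0 < n)%N by near: n; exists 1%N.
rewrite -(prednK n0) /pseries seriesEord /= big_ord_recl /= expr0 mulr1 big1.
  by rewrite addr0 subrr normr0 ltW.
by move=> i _; rewrite expr0n mulr0.
Unshelve. all: end_near. Qed.

(** The domain depends on [x0] only through the bound [M]; this uniformity is what allows
    continuation by a fixed step. *)
Lemma qsol_local (x0 : 'I_N -> R) (y0 M : R) : 0 < M -> (forall i, `|x0 i| <= M) ->
  exists x, [/\ x y0 = x0, qsol x [set y | `|y - y0| * (qbound * M) < 1] &
                forall i, analytic_at (fun y => x y i) y0].
Proof.
move=> M0 hx0; set K := qbound * M.
have K0 : 0 < K by rewrite mulr_gt0 ?qbound_gt0.
have aMK i : geo_bounded (fun n => qcoef x0 n i) M K by move=> n; exact: qcoef_bound.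
pose x y i := limn (pseries (fun n => qcoef x0 n i) (y - y0)).
have cx i y : `|y - y0| * K < 1 ->
    pseries (fun n => qcoef x0 n i) (y - y0) @ \oo --> x y i.
  by move=> hy; exact: cvg_geo_bounded (aMK i) (ltW K0) hy.
exists x; split.
- apply/funext => i; rewrite /x subrr.
  exact/(cvg_lim (@norm_hausdorff R R^o))/pseries_at0.
- move=> y /= hy i.
  have h1 : is_derive y 1 (fun s : R => s - y0) 1.
    by rewrite -[X in is_derive _ _ _ X]subr0; apply: is_deriveB.
  have := is_derive_comp1 (f := fun s => limn (pseries (fun n => qcoef x0 n i) s))
    h1 (is_derive_pseries (aMK i) K0 hy).
  rewrite mulr1 => H; apply: is_derive_eq H _.
  apply: (cvg_lim (@norm_hausdorff R R^o)).
  have -> : pseries (pseries_diffs (fun n => qcoef x0 n i)) (y - y0) =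
     fun n => \sum_(j < N) \sum_(k < N) b i j k *
       pseries (cauchy_prod (fun n => qcoef x0 n j) (fun n => qcoef x0 n k)) (y - y0) n.
    apply/funext => n; rewrite /pseries seriesEord /=.
    under [RHS]eq_bigr do under eq_bigr do rewrite seriesEord mulr_sumr.
    under [RHS]eq_bigr do rewrite exchange_big.
    rewrite [RHS]exchange_big /=; apply: eq_bigr => m _.
    rewrite /pseries_diffs qcoefS mulrA divff ?pnatr_eq0// mul1r mulr_suml.
    transitivity (\sum_(l < m.+1) \sum_(j < N) \sum_(k < N)
        b i j k * (qcoef x0 l j * qcoef x0 (m - l)%N k) * (y - y0) ^+ m).
      apply: eq_bigr => l _; rewrite /qform mulr_suml; apply: eq_bigr => j _.
      by rewrite mulr_suml.
    rewrite exchange_big /=; apply: eq_bigr => j _.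
    rewrite exchange_big /=; apply: eq_bigr => k _.
    rewrite /cauchy_prod mulr_suml mulr_sumr; apply: eq_bigr => l _.
    by rewrite -mulrA.
  apply: cvg_big => //; last first.
    move=> j _; apply: cvg_big => //; last first.
      move=> k _; apply: cvgMr.
      exact: cvg_pseries_conv (ltW K0) hy (aMK j) (aMK k) (cx j y hy) (cx k y hy).
    exact: add_continuous.
  exact: add_continuous.
- by move=> i; exists (fun n => qcoef x0 n i), M, K; split => // y hy; exact: cx.
Qed.

(** Multiplied by exp(-C y) to the right of [y1], or by exp(C y) to the left, [E] cannot grow when
    moving away from [y1]. *)
Lemma gronwall_zero (E dE : R -> R) (C y1 y2 : R) :
  (forall y, Num.min y1 y2 <= y <= Num.max y1 y2 ->
     [/\ is_derive y 1 E (dE y), 0 <= E y & `|dE y| <= C * E y]) ->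
  E y1 = 0 -> E y2 = 0.
Proof.
move=> H E1.
have dexp (s y : R) : is_derive y 1 (fun y => expR (s * y)) (s * expR (s * y)).
  have h1 : is_derive y 1 (fun y : R => s * y) s.
    by apply: is_derive_eq (@is_deriveZ _ _ _ id s y 1 1 _) _; rewrite /GRing.scale /= mulr1.
  have := is_derive_comp1 (f := expR) h1 (is_derive_expR (s * y)).
  by rewrite mulrC.
have mm : Num.min y1 y2 <= y2 <= Num.max y1 y2 by rewrite ge_min le_max lexx !orbT.
have [_ E20 _] := H _ mm.
have [s sE] : exists s : R, s = if y1 <= y2 then - C else C by eexists.
have [|c hc] := @MVT_le R (fun y => E y * expR (s * y))
   (fun y => dE y * expR (s * y) + E y * (s * expR (s * y))) y1 y2.
  by move=> y /H[dEy _ _]; exact: is_deriveM' dEy (dexp s y).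
rewrite E1 mul0r subr0 => EE.
have [_ Ec dEc] := H _ hc.
suff : E y2 * expR (s * y2) <= 0.
  by rewrite pmulr_lle0 ?expR_gt0// => E2; apply/eqP; rewrite eq_le E2 E20.
rewrite EE (_ : _ * (y2 - y1) = expR (s * c) * ((dE c + s * E c) * (y2 - y1))); last by ring.
rewrite pmulr_rle0 ?expR_gt0//.
have := dEc; rewrite ler_norml => /andP[dl du].
move: sE; case: (leP y1 y2) => y12 ->.
  by rewrite mulr_le0_ge0// ?subr_ge0//; lra.
by rewrite mulr_ge0_le0// ?subr_le0 ?(ltW y12)//; lra.
Qed.

Lemma qsol_unique x z I y1 y2 : is_interval I -> qsol x I -> qsol z I ->
  I y1 -> I y2 -> x y1 = z y1 -> x y2 = z y2.
Proof.
move=> itvI sx sz I1 I2 xz1.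
have Iseg y : Num.min y1 y2 <= y <= Num.max y1 y2 -> I y.
  by case: (leP y1 y2) => _; apply: itvI.
pose S y := 1 + \sum_(i < N) (x y i * x y i + z y i * z y i).
have cS y : I y -> {for y, continuous S}.
  move=> Iy; apply: cvgD; first exact: cvg_cst.
  apply: cvg_big => // [|i _]; first exact: add_continuous.
  apply: cvgD; apply: cvgM.
  1,2: exact: is_derive_continuous (sx y Iy i).
  1,2: exact: is_derive_continuous (sz y Iy i).
(* A common bound for both solutions on the compact segment, from the maximum of a sum of squares
   and |w| <= 1 + w^2. *)
have [B hB] : exists B : R, forall y, Num.min y1 y2 <= y <= Num.max y1 y2 -> S y <= B.
  have mM : Num.min y1 y2 <= Num.max y1 y2 by rewrite ge_min !le_max lexx.
  have [|c _ hc] := EVT_max (f := S) mM.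
    apply: continuous_in_subspaceT => y; rewrite inE /= in_itv /= => /Iseg.
    exact: cS.
  by exists (S c) => y hy; apply: hc; rewrite in_itv.
have bnd y : Num.min y1 y2 <= y <= Num.max y1 y2 -> forall i, `|x y i| <= B /\ `|z y i| <= B.
  move=> hy i; have := hB y hy; rewrite /S (bigD1 i)//=.
  set T := \sum_(_ < _ | _) _.
  have T0 : 0 <= T by apply: sumr_ge0 => j _; rewrite addr_ge0// -expr2 sqr_ge0.
  have X0 := sqr_ge0 (x y i); have Z0 := sqr_ge0 (z y i).
  have P (w : R) : `|w| <= 1 + w * w.
    rewrite -[X in _ + X](real_normK (num_real w)) -subr_ge0.
    have := sqr_ge0 (`|w| - 2^-1); nra.
  by move: (P (x y i)) (P (z y i)); rewrite !expr2 in X0 Z0 => ? ? ?; split; lra.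
pose e y i := x y i - z y i.
pose E y := \sum_(i < N) e y i * e y i.
pose d y i := qform (x y) (x y) i - qform (z y) (z y) i.
have E0 y : 0 <= E y by apply: sumr_ge0 => i _; rewrite -expr2 sqr_ge0.
have eE y i : e y i * e y i <= E y.
  by rewrite /E (bigD1 i)//= lerDl sumr_ge0// => j _; rewrite -expr2 sqr_ge0.
have ee y i j : `|e y i| * `|e y j| <= E y.
  have := sqr_ge0 (`|e y i| - `|e y j|); rewrite sqrrB !real_normK ?num_real//.
  by have := eE y i; have := eE y j; rewrite !expr2 -mulr_natl; lra.
suff E2 : E y2 = 0.
  apply/funext => i; apply/eqP; rewrite -subr_eq0 -sqrf_eq0 expr2.
  by rewrite -expr2 eq_le sqr_ge0 andbT -E2 expr2; exact: (eE y2 i).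
pose Q : R := \sum_(i < N) \sum_(j < N) \sum_(k < N) `|b i j k|.
(* In the constant 4 B Q, one factor 2 comes from differentiating squares and the other from
   splitting the difference of the two quadratic forms into two bilinear terms. *)
apply: (@gronwall_zero E (fun y => \sum_(i < N) (d y i * e y i + e y i * d y i))
  (4 * B * Q) y1 y2).
  move=> y hy; split => //.
  - have -> : E = \sum_(i < N) (fun y => e y i * e y i).
      by apply/funext => s; rewrite fct_sumE.
    apply: is_derive_sum => i; apply: is_deriveM';
      apply: is_deriveB; solve [exact: sx (Iseg _ hy) i | exact: sz (Iseg _ hy) i].
  - apply: le_trans (ler_norm_sum _ _ _) _.
    rewrite (_ : 4 * B * Q * E y = 4 * B * E y * Q); last by ring.
    rewrite /Q mulr_sumr; apply: ler_sum => i _.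
    rewrite (mulrC (d y i)) -mulrDr normrM.
    have dE : d y i = \sum_(j < N) \sum_(k < N) b i j k *
        (e y j * x y k + z y j * e y k).
      rewrite /d /qform -sumrB; apply: eq_bigr => j _; rewrite -sumrB.
      by apply: eq_bigr => k _; rewrite /e; ring.
    have B0 : 0 <= B by apply: le_trans (bnd y hy i).1.
    have di F : (forall j k, `|e y j| * `|e y k| <= F) ->
        `|e y i| * `|d y i| <= 2 * B * F * \sum_(j < N) \sum_(k < N) `|b i j k|.
      move=> eF; rewrite dE !mulr_sumr; apply: le_trans (ler_wpM2l _ (ler_norm_sum _ _ _)) _ => //.
      rewrite mulr_sumr; apply: ler_sum => j _.
      apply: le_trans (ler_wpM2l _ (ler_norm_sum _ _ _)) _ => //.
      rewrite !mulr_sumr; apply: ler_sum => k _.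
      rewrite normrM mulrCA mulrC ler_wpM2r//.
      apply: (@le_trans _ _ (`|e y i| * (`|e y j| * B + B * `|e y k|))).
        rewrite ler_wpM2l//; apply: le_trans (ler_normD _ _) _; rewrite !normrM.
        by apply: lerD; [rewrite ler_wpM2l//; case: (bnd y hy k)|
                         rewrite ler_wpM2r//; case: (bnd y hy j)].
      rewrite mulrDr mulrA [X in _ + X]mulrCA [X in X + _]mulrC -mulrDr.
      rewrite [2 * B]mulrC -!mulrA ler_wpM2l//.
      by have := eF i j; have := eF i k; lra.
    have -> : `|d y i + d y i| = 2 * `|d y i|.
      by rewrite -mulr2n normrMn mulr_natl.
    by rewrite mulrCA; have := di _ (ee y); lra.
by rewrite /E big1// => i _; rewrite /e xz1 subrr mul0r.
Qed.

Lemma qsol_sub x D D' : D' `<=` D -> qsol x D -> qsol x D'.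
Proof. by move=> sub sx y /sub; exact: sx. Qed.

Lemma qsol_near x z y : (\forall s \near y, x s = z s) ->
  (forall i, is_derive y 1 (fun s => x s i) (qform (x y) (x y) i)) ->
  forall i, is_derive y 1 (fun s => z s i) (qform (z y) (z y) i).
Proof.
move=> e H i; rewrite -(nbhs_singleton e).
apply: near_eq_is_derive (H i).
by apply: filterS e => s ->.
Qed.

Definition cball (y r : R) : set R := [set s | `|s - y| < r].

Lemma cball_interval y r : is_interval (cball y r).
Proof.
move=> s t /=; rewrite /cball /= !ltr_norml => /andP[s1 s2] /andP[t1 t2] u /andP[u1 u2].
by rewrite ltr_norml; apply/andP; split; lra.
Qed.

Lemma near_cball y r s : cball y r s -> \forall t \near s, cball y r t.
Proof.
rewrite /cball /= => h; exists (r - `|s - y|) => /=; first by rewrite subr_gt0.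
move=> t /=; rewrite distrC => ht.
have := ler_distD s t y; lra.
Qed.

Lemma open_cball_sub D y : open D -> D y -> exists2 r : R, 0 < r & cball y r `<=` D.
Proof.
move=> oD Dy; have /nbhs_ballP[r r0 hr] : nbhs y D by exact: open_nbhs_nbhs.
by exists r => // s /= hs; apply: hr; rewrite /ball /= distrC.
Qed.

Lemma interval_setI (I J : set R) : is_interval I -> is_interval J -> is_interval (I `&` J).
Proof.
by move=> hI hJ s t [Is Js] [It Jt] u hu; split; [exact: hI hu|exact: hJ hu].
Qed.

(** Near each point uniqueness identifies the solution with the power series solution having the
    same value there. *)
Lemma qsol_analytic x D y0 : open D -> D y0 -> qsol x D ->
  forall i, analytic_at (fun y => x y i) y0.
Proof.
move=> oD Dy0 sx i; have [r r0 hr] := open_cball_sub oD Dy0.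
pose M : R := 1 + \sum_(j < N) `|x y0 j|.
have M0 : 0 < M by rewrite ltr_wpDr// sumr_ge0.
have hM j : `|x y0 j| <= M.
  by rewrite /M (bigD1 j)//= addrCA lerDl addr_ge0// sumr_ge0.
have [z [z0 sz anz]] := qsol_local y0 M0 hM.
have bM0 : 0 < qbound * M by rewrite mulr_gt0 ?qbound_gt0.
have m0 : 0 < Num.min r (qbound * M)^-1 by rewrite lt_min r0 invr_gt0.
apply: analytic_at_ext m0 _ (anz i) => y hy; congr (_ i).
pose J := cball y0 (Num.min r (qbound * M)^-1).
have sJ : J `<=` cball y0 r by move=> s; rewrite /J /cball /= lt_min => /andP[].
apply: (@qsol_unique z x J y0 y) => //; first exact: cball_interval.
- apply: qsol_sub sz => s; rewrite /J /cball /= lt_min => /andP[_].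
  by rewrite -ltr_pdivlMr// mul1r.
- by apply: qsol_sub sx => s /sJ; exact: hr.
- by rewrite /J /cball /= subrr normr0 lt_min r0 invr_gt0.
Qed.

Section Global.
Variables (x : R -> 'I_N -> R) (I : set R) (y1 M : R) (p : ('I_N -> R) -> R).
Hypotheses (openI : open I) (I1 : I y1) (sx : qsol x I) (M0 : 0 < M).
Hypothesis analytic_p : forall (z : R -> 'I_N -> R) y,
  (forall i, analytic_at (fun s => z s i) y) -> analytic_at (fun s => p (z s)) y.
Hypothesis px : forall y, I y -> p (x y) = 0.
Hypothesis p_bound : forall v, p v = 0 -> forall i, `|v i| <= M.

Let extends r z := qsol z (cball y1 r) /\ z y1 = x y1.

(** Near [y1] the extension agrees with [x], which satisfies the constraint; analyticity carries the
    equation over the whole interval. *)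
Lemma extends_constraint r z : extends r z -> forall y, cball y1 r y -> p (z y) = 0.
Proof.
move=> [sz z1] y yr.
have r0 : 0 < r by apply: le_lt_trans yr.
have [e e0 he] := open_cball_sub openI I1.
move: y yr; apply: (@analytic_identity _ (cball y1 r) (fun y => p (z y)) y1).
- exact: cball_interval.
- move=> s sr; apply: analytic_p => i.
  apply: (qsol_analytic (D := cball y1 r)) => //.
  by rewrite openE => t; exact: near_cball.
- by rewrite /cball /= subrr normr0.
- pose m := Num.min e r.
  have : cball y1 m y1 by rewrite /cball /= subrr normr0 lt_min e0.
  move=> h1; apply: filterS (near_cball h1) => s hs.
  have sub : cball y1 m `<=` cball y1 e `&` cball y1 r.
    by move=> t; rewrite /cball /= lt_min => /andP[].
  rewrite (@qsol_unique z x (cball y1 m) y1 s) ?px//.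
  + by apply: he; case: (sub _ hs).
  + exact: cball_interval.
  + by apply: qsol_sub sz => t /sub[].
  + by apply: qsol_sub sx => t /sub[/he].
Qed.

Lemma extends_step r z : 0 < r -> extends r z ->
  exists z', extends (r + (qbound * M)^-1 / 2) z'.
Proof.
move=> r0 ez; have [sz z1] := ez.
have bM0 : 0 < qbound * M by rewrite mulr_gt0 ?qbound_gt0.
set d := (qbound * M)^-1; have d0 : 0 < d by rewrite invr_gt0.
(* The restarting points at distance [r - h] from [y1] lie inside the present interval and within
   [d / 2] of its ends, so local solutions of radius [d] reach at least [d / 2] beyond. *)
pose h := Num.min (r / 2) (d / 2).
have h0 : 0 < h by rewrite lt_min !divr_gt0.
have [hr hd] : h <= r / 2 /\ h <= d / 2 by rewrite !ge_min !lexx orbT.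
have loc y2 : cball y1 r y2 -> exists2 u, qsol u (cball y2 d) &
    forall s, cball y1 r s -> cball y2 d s -> u s = z s.
  move=> y2r; have [u [u2 su _]] := qsol_local y2 M0 (p_bound (extends_constraint ez y2r)).
  have su' : qsol u (cball y2 d).
    by apply: qsol_sub su => s; rewrite /cball /= -ltr_pdivlMr// mul1r.
  exists u => // s hs1 hs2.
  apply: (@qsol_unique u z (cball y1 r `&` cball y2 d) y2 s) => //.
  - by apply: interval_setI; exact: cball_interval.
  - by apply: qsol_sub su' => t [].
  - by apply: qsol_sub sz => t [].
  - by split => //; rewrite /cball /= subrr normr0.
have [|u su uz] := loc (y1 + (r - h)).
  by rewrite /cball /= addrAC subrr add0r ger0_norm; lra.
have [|v sv vz] := loc (y1 - (r - h)).
  by rewrite /cball /= addrAC subrr add0r normrN ger0_norm; lra.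
(* The old solution is kept wherever it is defined; near its ends the local solutions agree with it,
   so the glued function solves the system there too. *)
pose z' y := if `|y - y1| < r then z y else if y1 < y then u y else v y.
exists z'; split; last by rewrite /z' subrr normr0 r0.
move=> y; rewrite /cball /= => hy.
have [yr|yr] := ltP `|y - y1| r.
  apply: (@qsol_near z); last exact: sz.
  by apply: filterS (near_cball yr) => s sr; rewrite /z' ifT.
have [y1y|yy1] := ltP y1 y.
  have yR : cball (y1 + (r - h)) d y.
    move: yr hy; rewrite /cball /= ger0_norm ?subr_ge0 ?(ltW y1y)// => yr hy.
    by rewrite ger0_norm; lra.
  apply: (@qsol_near u); last exact: su.
  have lt_s : \forall s \near y, y1 + (r - h) < s.
    apply: lt_nbhsr.
    by move: yr; rewrite ger0_norm ?subr_ge0 ?(ltW y1y)//; lra.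
  near=> s.
  have sR : y1 + (r - h) < s by near: s.
  have sd : cball (y1 + (r - h)) d s by near: s; exact: near_cball.
  rewrite /z'; case: ifPn => sr; first exact: uz.
  by rewrite ifT//; lra.
have yL : cball (y1 - (r - h)) d y.
  move: yr hy; rewrite /cball /= ler0_norm ?subr_le0// => yr hy.
  by rewrite ler0_norm; lra.
apply: (@qsol_near v); last exact: sv.
have lt_s : \forall s \near y, s < y1 - (r - h).
  apply: lt_nbhsl.
  by move: yr; rewrite ler0_norm ?subr_le0//; lra.
near=> s.
have sR : s < y1 - (r - h) by near: s.
have sd : cball (y1 - (r - h)) d s by near: s; exact: near_cball.
rewrite /z'; case: ifPn => sr; first exact: vz.
by rewrite ifF//; apply/negbTE; rewrite -leNgt; lra.
Unshelve. all: end_near. Qed.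

Lemma extends_all T : exists z, extends T z.
Proof.
have [r r0 hr] := open_cball_sub openI I1.
have bM0 : 0 < qbound * M by rewrite mulr_gt0 ?qbound_gt0.
set d := (qbound * M)^-1 / 2; have d0 : 0 < d by rewrite divr_gt0 ?invr_gt0.
have good n : exists z, extends (r + n%:R * d) z.
  elim: n => [|n [z ez]].
    by exists x; rewrite mul0r addr0; split => //; exact: qsol_sub sx.
  have [|z' ez'] := @extends_step (r + n%:R * d) z _ ez.
    by rewrite ltr_wpDr// mulr_ge0// ltW.
  by exists z'; rewrite -natr1 mulrDl mul1r addrA.
have [z [sz z1]] := good (Num.bound `|T / d|).
exists z; split => //; apply: qsol_sub sz => s; rewrite /cball /= => /lt_trans; apply.
have h := archi_boundP (normr_ge0 (T / d)).
have : T / d < (Num.bound `|T / d|)%:R by apply: le_lt_trans h; exact: ler_norm.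
by rewrite ltr_pdivrMr//; lra.
Qed.

(* The constraint [p] propagates by analyticity and bounds the solution, so every
   solution extends by a fixed time step. *)
Theorem qsol_global : is_interval I ->
  exists X, qsol X setT /\ forall y, I y -> X y = x y.
Proof.
move=> itvI; have [Z hZ] := choice extends_all.
(* Each value is read off a solution on an interval just large enough to contain the point;
   uniqueness makes the size irrelevant. *)
pose X y := Z (`|y - y1| + 1) y.
have XZ T y : cball y1 T y -> X y = Z T y.
  move=> yT; have T0 : 0 < T by exact: le_lt_trans yT.
  pose m := Num.min T (`|y - y1| + 1).
  have ym : cball y1 m y.
    by rewrite /cball /= lt_min ltrDl ltr01 andbT; exact: yT.
  have [[s1 e1] [s2 e2]] := (hZ T, hZ (`|y - y1| + 1)).
  apply: (@qsol_unique (Z (`|y - y1| + 1)) (Z T) (cball y1 m) y1 y) => //.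
  - exact: cball_interval.
  - by apply: qsol_sub s2 => t; rewrite /cball /= lt_min => /andP[].
  - by apply: qsol_sub s1 => t; rewrite /cball /= lt_min => /andP[].
  - by rewrite /cball /= subrr normr0 lt_min T0 ltr_wpDl.
  - by rewrite e1 e2.
have sX : qsol X setT.
  move=> y _; pose T := `|y - y1| + 1.
  have yT : cball y1 T y by rewrite /cball /= ltrDl.
  apply: (@qsol_near (Z T)); last by case: (hZ T) => sZ _; exact: sZ.
  by apply: filterS (near_cball yT) => s sT; rewrite (XZ T).
exists X; split => // y Iy; apply: (@qsol_unique X x I y1 y) => //.
- exact: qsol_sub sX.
- by rewrite /X; case: (hZ (`|y1 - y1| + 1)).
Qed.

End Global.
End QuadraticODE.

(** * Lines, projectors and isometries *)

Section Projectors.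
Variable R : realType.
Local Notation C := R[i].
Implicit Types (a b u v f F G D : 'rV[C]_3) (P Q : 'M[C]_3).

Lemma conjcD (x y : C) : ((x + y)^*)%C = x^*%C + y^*%C. Proof. exact: rmorphD. Qed.
Lemma conjcB (x y : C) : ((x - y)^*)%C = x^*%C - y^*%C. Proof. exact: rmorphB. Qed.
Lemma conjcM (x y : C) : ((x * y)^*)%C = x^*%C * y^*%C. Proof. exact: rmorphM. Qed.
Lemma conjcV (x : C) : ((x^-1)^*)%C = (x^*%C)^-1. Proof. exact: fmorphV. Qed.

Lemma conjc_cst (x : R) : ((x%:C)^*)%C = x%:C.
Proof. by apply: complexP; rewrite !re_imE //= oppr0. Qed.
Lemma realcD (x y : R) : (x + y)%:C = x%:C + y%:C. Proof. exact: rmorphD. Qed.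
Lemma realcB (x y : R) : (x - y)%:C = x%:C - y%:C. Proof. exact: rmorphB. Qed.
Lemma realcM (x y : R) : (x * y)%:C = x%:C * y%:C. Proof. exact: rmorphM. Qed.
Lemma realcV (x : R) : (x^-1)%:C = (x%:C)^-1. Proof. exact: fmorphV. Qed.

Lemma hdotDl a b u : hdot (a + b) u = hdot a u + hdot b u.
Proof. by rewrite /hdot -big_split /=; apply: eq_bigr => j _; rewrite mxE mulrDl. Qed.

Lemma hdotZl (c : C) a u : hdot (c *: a) u = c * hdot a u.
Proof. by rewrite /hdot mulr_sumr; apply: eq_bigr => j _; rewrite mxE mulrA. Qed.

Lemma hdotC a b : hdot b a = (hdot a b)^*%C.
Proof.
by rewrite /hdot rmorph_sum; apply: eq_bigr => j _; rewrite rmorphM /= conjcK mulrC.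
Qed.

Lemma hdotBl a b u : hdot (a - b) u = hdot a u - hdot b u.
Proof. by rewrite -scaleN1r hdotDl hdotZl mulN1r. Qed.

Lemma hdotDr a b u : hdot u (a + b) = hdot u a + hdot u b.
Proof. by rewrite hdotC hdotDl conjcD -!hdotC. Qed.

Lemma hdotZr (c : C) a u : hdot u (c *: a) = c^*%C * hdot u a.
Proof. by rewrite hdotC hdotZl conjcM -hdotC. Qed.

Lemma hdotBr a b u : hdot u (a - b) = hdot u a - hdot u b.
Proof. by rewrite hdotC hdotBl conjcB -!hdotC. Qed.

Lemma hdot0l u : hdot 0 u = 0.
Proof. by rewrite -(scale0r 0) hdotZl mul0r. Qed.

Lemma hdot0r u : hdot u 0 = 0.
Proof. by rewrite hdotC hdot0l conjc0. Qed.

Definition nsq F : R := Re (hdot F F).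

Lemma hdotE F : hdot F F = (nsq F)%:C.
Proof.
apply: complexP => //=; have := hdotC F F.
case: (hdot F F) => x y /= [] h; lra.
Qed.

Lemma nsqE F : nsq F = \sum_j (Re (F 0 j) ^+ 2 + Im (F 0 j) ^+ 2).
Proof.
rewrite /nsq /hdot !big_ord_recl !big_ord0 !re_add !re_mul !re_conj !im_conj /=.
by ring.
Qed.

Lemma nsq_ge0 F : 0 <= nsq F.
Proof. by rewrite nsqE sumr_ge0// => j _; rewrite addr_ge0// sqr_ge0. Qed.

Lemma nsq_eq0 F : (nsq F == 0) = (F == 0).
Proof.
apply/eqP/eqP => [|->]; last by rewrite /nsq hdot0l.
rewrite nsqE => /eqP; rewrite psumr_eq0; last first.
  by move=> j _; rewrite addr_ge0// sqr_ge0.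
move/allP => H; apply/rowP => j; rewrite mxE; apply/eqP.
apply: contraT => /sqr_norm_neq0; have := H j (mem_index_enum j) => /=.
by move/eqP ->; rewrite eqxx.
Qed.

Lemma nsq_gt0 F : F != 0 -> 0 < nsq F.
Proof. by move=> F0; rewrite lt_neqAle eq_sym nsq_eq0 F0 nsq_ge0. Qed.

Lemma hdot_neq0 F : F != 0 -> hdot F F != 0.
Proof. by rewrite hdotE fmorph_eq0 nsq_eq0. Qed.

Definition csq (z : C) : R := Re z ^+ 2 + Im z ^+ 2.

Lemma csqE z : (csq z)%:C = z * z^*%C.
Proof. by apply: complexP; rewrite !re_imE /= /csq; ring. Qed.

Lemma csq_ge0 z : 0 <= csq z. Proof. by rewrite addr_ge0// sqr_ge0. Qed.

Lemma csqM z w : csq (z * w) = csq z * csq w.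
Proof. by rewrite /csq !re_imE; ring. Qed.

Lemma csq_hdot_le a b : csq (hdot a b) <= nsq a * nsq b.
Proof.
have [->|b0] := eqVneq b 0.
  by rewrite hdot0r /csq /= expr0n addr0 mulr_ge0// nsq_ge0.
have nb := nsq_gt0 b0.
have : 0 <= nsq ((nsq b)%:C *: a - hdot a b *: b) by exact: nsq_ge0.
have -> : nsq ((nsq b)%:C *: a - hdot a b *: b) =
          nsq b * (nsq a * nsq b - csq (hdot a b)).
  apply: (@complexI R); rewrite /= -hdotE !hdotBl !hdotBr !hdotZl !hdotZr.
  rewrite !(realcM, realcB) csqE -(hdotE a) (hdotC a b) conjc_cst.
  by rewrite (hdotE b); ring.
by rewrite pmulr_rge0// subr_ge0.
Qed.

Lemma horizE F X : horiz F X = X - (hdot X F / hdot F F) *: F.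
Proof. by []. Qed.

Lemma hdot_horiz F X : F != 0 -> hdot (horiz F X) F = 0.
Proof. by move=> F0; rewrite hdotBl hdotZl divfK ?subrr// hdot_neq0. Qed.

Definition projm F : 'M[C]_3 := \matrix_(i, j) (F 0 i * (F 0 j)^*%C / hdot F F).

(** The differential of [projm] at [F] in a direction [D] orthogonal to [F]; the derivative of the
    normalising factor vanishes for such directions. *)
Definition dprojm F D : 'M[C]_3 :=
  \matrix_(i, j) ((D 0 i * (F 0 j)^*%C + F 0 i * (D 0 j)^*%C) / hdot F F).

Lemma is_cderive_hdot (F G : R -> 'rV[C]_3) t (dF dG : 'rV[C]_3) :
  (forall j, is_cderive (fun s => F s 0 j) t (dF 0 j)) ->
  (forall j, is_cderive (fun s => G s 0 j) t (dG 0 j)) ->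
  is_cderive (fun s => hdot (F s) (G s)) t (hdot dF (G t) + hdot (F t) dG).
Proof.
move=> hF hG; rewrite /hdot -big_split /=.
by apply: is_cderive_sum => j; apply: is_cderiveM => //; exact: is_cderive_conj.
Qed.

Lemma is_cderive_proj (F : R -> 'rV[C]_3) t (G dF : 'rV[C]_3) : F t = G ->
  (forall j, is_cderive (fun s => F s 0 j) t (dF 0 j)) -> G != 0 ->
  forall i j, is_cderive (fun s => projm (F s) i j) t (dprojm G (horiz G dF) i j).
Proof.
move=> <- hF F0 i j; have N0 := hdot_neq0 F0.
have h := is_cderiveM (is_cderiveM (hF i) (is_cderive_conj (hF j)))
   (is_cderiveV N0 (is_cderive_hdot hF hF)).
apply: is_cderive_ext; last apply: is_cderive_eq h _.
  by move=> s; rewrite mxE.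
rewrite !mxE conjcB !conjcM conjcV -!hdotC (hdotC dF (F t)).
by field.
Qed.

Lemma projZ (c : C) F : c != 0 -> projm (c *: F) = projm F.
Proof.
move=> c0; apply/matrixP => i j; rewrite !mxE hdotZl hdotZr conjcM.
have c0' : c^*%C != 0 by rewrite fmorph_eq0.
have [->|F0] := eqVneq (hdot F F) 0; first by rewrite !(mulr0, invr0).
by field; rewrite F0 c0 c0'.
Qed.

Definition pt (L : CP2 R) : 'M[C]_3 := projm (vpick (val L)).

Lemma CP2_line (L : CP2 R) : exists2 F : 'rV[C]_3, F != 0 & L = line F.
Proof.
have L0 : val L != 0%VS by rewrite -dimv_eq0 (eqP (valP L)).
exists (vpick (val L)); first by rewrite vpick0.
apply: val_inj; rewrite val_line ?vpick0//; apply/esym/eqP.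
by rewrite eqEdim -memvE memv_pick dim_vline vpick0 L0 (eqP (valP L)).
Qed.

Lemma pt_line F : F != 0 -> pt (line F) = projm F.
Proof.
move=> F0; rewrite /pt val_line//.
have := memv_pick <[F]>%VS; case/vlineP => c E.
rewrite E projZ//; apply: contraTneq F0 => c0.
have : vpick <[F]>%VS == 0 by rewrite E c0 scale0r.
by rewrite vpick0 => /eqP h; rewrite negbK -memv0 -h memv_line.
Qed.

Lemma proj_scale F i : projm F i i != 0 -> F 0 i != 0.
Proof. by rewrite mxE; apply: contra_neq => ->; rewrite !mul0r. Qed.

Lemma nsq_diag F : F != 0 -> exists i, F 0 i != 0.
Proof.
move=> F0; apply/existsP; apply: contraNT F0; rewrite negb_exists => /forallP H.
by apply/eqP/rowP => i; rewrite mxE; apply/eqP; move: (H i); rewrite negbK.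
Qed.

(** A nonzero column of the projector recovers the vector up to a scalar. *)
Lemma proj_line F G : F != 0 -> G != 0 -> projm F = projm G -> line F = line G.
Proof.
move=> F0 G0 E; have [j Fj] := nsq_diag F0.
have NF := hdot_neq0 F0; have NG := hdot_neq0 G0.
have Fj' : (F 0 j)^*%C != 0 by rewrite fmorph_eq0.
have EF : F = (hdot F F / (F 0 j)^*%C * ((G 0 j)^*%C / hdot G G)) *: G.
  apply/rowP => i; move/matrixP : E => /(_ i j); rewrite !mxE => E.
  have -> : F 0 i = (F 0 i * (F 0 j)^*%C / hdot F F) * (hdot F F / (F 0 j)^*%C).
    by field; rewrite Fj' NF.
  by rewrite E; field; rewrite Fj' NG.
apply: val_inj; rewrite !val_line//; apply/eqP.
rewrite eqEdim !dim_vline F0 G0 andbT -memvE.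
by apply/vlineP; exists (hdot F F / (F 0 j)^*%C * ((G 0 j)^*%C / hdot G G)).
Qed.

Lemma pt_inj : injective pt.
Proof.
move=> L L'; have [F F0 ->] := CP2_line L; have [G G0 ->] := CP2_line L'.
by rewrite !pt_line//; exact: proj_line.
Qed.

Definition mdot P Q : R := \sum_i \sum_j Re (P i j * (Q i j)^*%C).

(** This is cos^2 of the Fubini-Study distance between the two lines, hence the quantity that
    isometries should preserve. *)
Lemma mdot_proj F G : F != 0 -> G != 0 ->
  mdot (projm F) (projm G) = csq (hdot F G) / (nsq F * nsq G).
Proof.
move=> F0 G0; apply: (@complexI R); rewrite /= /mdot.
have H (P Q : 'M[C]_3) : \sum_i \sum_j Re (P i j * (Q i j)^*%C) =
    Re (\sum_i \sum_j P i j * (Q i j)^*%C).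
  by rewrite raddf_sum; apply: eq_bigr => i _; rewrite raddf_sum.
have E : \sum_i \sum_j projm F i j * (projm G i j)^*%C =
   (csq (hdot F G) / (nsq F * nsq G))%:C.
  rewrite realcM realcV realcM csqE -!hdotE -hdotC {2}/hdot.
  rewrite mulr_sumr mulr_suml exchange_big /=; apply: eq_bigr => j _.
  rewrite /hdot mulr_suml mulr_suml; apply: eq_bigr => i _.
  rewrite -!/(hdot _ _) !mxE !conjcM conjcV !conjcK -!hdotC.
  have := hdot_neq0 F0; have := hdot_neq0 G0 => ? ?.
  by field; apply/andP.
by rewrite H E.
Qed.

End Projectors.

(** * Maps preserving the metric do not decrease scalar products of projectors *)

Section Overlap.
Variable R : realType.
Local Notation C := R[i].
Implicit Types (u v w f G D : 'rV[C]_3).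

Lemma fs_metricE v X Y : fs_metric v X Y = Re (hdot (horiz v X) (horiz v Y)) / nsq v.
Proof.
rewrite /fs_metric hdotE -realcV re_mul /= mulr0 subr0; congr (_ * _).
Qed.

Lemma fs_metric_nsq v X : fs_metric v X X = nsq (horiz v X) / nsq v.
Proof. by rewrite fs_metricE. Qed.

Lemma nsqD_orth u w : hdot w u = 0 -> nsq (u + w) = nsq u + nsq w.
Proof.
by move=> wu; rewrite /nsq hdotDl !hdotDr wu (hdotC w u) wu conjc0 addr0 add0r re_add.
Qed.

Lemma nsqZ (c : C) u : nsq (c *: u) = csq c * nsq u.
Proof.
apply: (@complexI R); rewrite /= -hdotE hdotZl hdotZr realcM csqE -hdotE; ring.
Qed.

Lemma csq_real (x : R) : csq (x%:C) = x ^+ 2.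
Proof. by rewrite /csq /= expr0n addr0. Qed.

Lemma nsq_line u w (t : R) : hdot w u = 0 -> nsq (u + t%:C *: w) = nsq u + t ^+ 2 * nsq w.
Proof. by move=> wu; rewrite nsqD_orth ?nsqZ ?csq_real// hdotZl wu mulr0. Qed.

(* The line [u + t w] traces the geodesic at angle [atan (t |w|)] from [u]. *)
Lemma fs_metric_line u w (t : R) : hdot w u = 0 -> nsq u = 1 ->
  fs_metric (u + t%:C *: w) w w = nsq w / (1 + t ^+ 2 * nsq w) ^+ 2.
Proof.
move=> wu u1; rewrite fs_metric_nsq nsq_line// u1.
set n := nsq w; have n0 : 0 <= n by exact: nsq_ge0.
have N0 : 1 + t ^+ 2 * n != 0 by rewrite gt_eqF// ltr_pwDl// mulr_ge0// sqr_ge0.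
have -> : horiz (u + t%:C *: w) w =
   (1 + t ^+ 2 * n)^-1%:C *: (w - (t * n)%:C *: u).
  rewrite horizE hdotE nsq_line// u1 hdotDr hdotZr conjc_cst wu add0r.
  rewrite hdotE -/n scalerBr scalerDr opprD addrA scalerA scalerA.
  rewrite [w - _ - _]addrAC -{1}[w]scale1r -scalerBl; congr (_ *: _ - _ *: _).
    by rewrite -[1]/(1%:C) -!(realcM, realcV, realcB); congr (_%:C); field.
  by rewrite -!(realcM, realcV, realcB); congr (_%:C); field.
rewrite nsqZ csq_real -scaleNr nsqD_orth; last first.
  by rewrite hdotZl (hdotC w u) wu conjc0 mulr0.
rewrite nsqZ u1 /csq /= oppr0 -/n.
by field.
Qed.

Lemma mdot_projdproj f G D : f != 0 -> G != 0 ->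
  mdot (projm f) (dprojm G D) =
  2 * Re (hdot D f * (hdot G f)^*%C) / (nsq f * nsq G).
Proof.
move=> f0 G0; have nf := nsq_gt0 f0; have nG := nsq_gt0 G0.
rewrite /mdot; under eq_bigr do rewrite -raddf_sum.
rewrite -raddf_sum /=.
have -> : \sum_i \sum_j projm f i j * (dprojm G D i j)^*%C =
  (hdot f D * hdot G f + hdot f G * hdot D f) * ((nsq f * nsq G)^-1)%:C.
  have -> : hdot f D * hdot G f + hdot f G * hdot D f = \sum_i \sum_j
      (f 0 i * (f 0 j)^*%C) * ((D 0 i)^*%C * G 0 j + (G 0 i)^*%C * D 0 j).
    rewrite /hdot !mulr_suml -big_split /=; apply: eq_bigr => i _.
    by rewrite !mulr_sumr -big_split /=; apply: eq_bigr => j _; ring.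
  rewrite mulr_suml; apply: eq_bigr => i _; rewrite mulr_suml; apply: eq_bigr => j _.
  rewrite realcV realcM -!hdotE !mxE !conjcM conjcD !conjcM conjcV !conjcK -!hdotC.
  by have := hdot_neq0 f0; have := hdot_neq0 G0 => ? ?; field; apply/andP.
rewrite re_mul /= mulr0 subr0; congr (_ * _).
by rewrite (hdotC D f) (hdotC f G) (hdotC G f) !re_imE /=; ring.
Qed.

(** For an overlap h = cos^2 theta this says that theta changes no faster than the Fubini-Study
    speed. Since [D] is orthogonal to [G], the vector [f] may be replaced by its part orthogonal to
    [G] before Cauchy-Schwarz; that part supplies the factor 1 - h. *)
Lemma overlap_deriv_bound f G D : f != 0 -> G != 0 -> hdot D G = 0 ->
  mdot (projm f) (dprojm G D) ^+ 2 <=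
  4 * (nsq D / nsq G) * (mdot (projm f) (projm G) * (1 - mdot (projm f) (projm G))).
Proof.
move=> f0 G0 DG; have nf := nsq_gt0 f0; have nG := nsq_gt0 G0.
rewrite mdot_projdproj// mdot_proj//.
set z := hdot D f * _.
have zE : csq z = csq (hdot D f) * csq (hdot f G).
  by rewrite csqM; congr (_ * _); rewrite (hdotC f G) conjcK.
have Rez : Re z ^+ 2 <= csq z by rewrite /csq lerDl sqr_ge0.
pose c := hdot f G / hdot G G.
have nfc : nsq (f - c *: G) = nsq f - csq (hdot f G) / nsq G.
  apply: (@complexI R); rewrite /= -hdotE realcB realcM realcV csqE -!hdotE.
  rewrite !hdotBl !hdotBr !hdotZl !hdotZr (hdotC f G) /c conjcM conjcV -!hdotC.
  by have := hdot_neq0 G0 => ?; field.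
have hDf : hdot D f = hdot D (f - c *: G) by rewrite hdotBr hdotZr DG mulr0 subr0.
have CS : csq (hdot D f) <= nsq D * (nsq f - csq (hdot f G) / nsq G).
  by rewrite -nfc hDf; exact: csq_hdot_le.
rewrite expr_div_n exprMn ler_pdivrMr; last by rewrite exprn_gt0// mulr_gt0.
apply: (@le_trans _ _ (4 * (nsq D * (nsq f - csq (hdot f G) / nsq G) * csq (hdot f G)))).
  rewrite (_ : 2 ^+ 2 = 4); last by ring.
  rewrite ler_wpM2l//; apply: le_trans Rez _; rewrite zE ler_wpM2r//.
  exact: csq_ge0.
rewrite le_eqVlt; apply/orP; left; apply/eqP; field.
by rewrite !gt_eqF.
Qed.

(** With h = cos^2 theta the hypothesis bounds |theta'| by sqrt m / (1 + t^2 m), whose integral is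
    atan (sqrt m), and cos^2 (atan (sqrt m)) = 1 / (1 + m). The doubled angle is used, as 2 h - 1 =
    cos (2 theta). *)
Lemma angle_comparison (h dh : R -> R) (m : R) : 0 <= m -> h 0 = 1 ->
  (forall t : R, 0 <= t <= 1 -> [/\ is_derive t 1 h (dh t), 0 <= h t <= 1 &
     dh t ^+ 2 <= 4 * (m / (1 + t ^+ 2 * m) ^+ 2) * (h t * (1 - h t))]) ->
  (1 + m)^-1 <= h 1.
Proof.
move=> m0 h0 H.
pose B := 2 * atan (Num.sqrt m).
have pi0 := @pi_gt0 R.
have aB : 0 <= atan (Num.sqrt m) by rewrite -[X in X <= _](@atan0 R) le_atan// sqrtr_ge0.
have B0 : 0 <= B by rewrite mulr_ge0.
have Bpi : B < pi by have := atan_ltpi2 (Num.sqrt m); rewrite /B; lra.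
(* At t = 0 one has 2 h - 1 = 1, where [acos] is not differentiable. Damping by [cos a] keeps the
   argument inside (-1, 1) at the price of an initial angle [a], which tends to 0 afterwards. *)
have step (a : R) : 0 < a -> a < pi / 2 -> a + B <= pi ->
    cos (a + B) <= cos a * (2 * h 1 - 1).
  move=> a0 a2 aBpi.
  have ca0 : 0 < cos a by apply: cos_gt0_pihalf; lra.
  have ca1 : cos a < 1.
    by rewrite -[X in _ < X](@cos0 R) ltr_cos// in_itv /=; lra.
  pose X (t : R) := cos a * (2 * h t - 1).
  have X1 (t : R) : 0 <= t <= 1 -> -1 < X t < 1.
    move=> /H[_ /andP[h1 h2] _].
    have : X t <= cos a by rewrite /X; nra.
    have : - cos a <= X t by rewrite /X; nra.
    by lra.
  have dX (t : R) : 0 <= t <= 1 -> is_derive t 1 X (2 * cos a * dh t).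
    move=> /H[dht _ _].
    apply: is_derive_eq (is_deriveM' (is_derive_cst (cos a) t 1)
      (is_deriveB (is_deriveM' (is_derive_cst (2 : R) t 1) dht) (is_derive_cst (1 : R) t 1))) _.
    by rewrite /cst; ring.
  have dA (t : R) : is_derive t 1 (fun s => atan (Num.sqrt m * s))
      ((1 + (Num.sqrt m * t) ^+ 2)^-1 * Num.sqrt m).
    apply: (is_derive_comp1 (f := @atan R) (g := fun s => Num.sqrt m * s)).
    apply: is_derive_eq (is_deriveM' (is_derive_cst (Num.sqrt m) t 1) (is_derive_id t 1)) _.
    by rewrite /cst; ring.
  have [|c hc] := @MVT_le R (fun t => acos (X t) - 2 * atan (Num.sqrt m * t))
      (fun t => - (Num.sqrt (1 - X t ^+ 2))^-1 * (2 * cos a * dh t) -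
        2 * ((1 + (Num.sqrt m * t) ^+ 2)^-1 * Num.sqrt m)) 0 1.
    rewrite minEle maxEle ler01 => t ht; apply: is_deriveB.
      apply: (is_derive_comp1 (f := @acos R)); first exact: dX.
      exact: is_derive1_acos (X1 t ht).
  move: hc; rewrite minEle maxEle ler01 => hc.
  rewrite subr0 mulr1 mulr0 atan0 mulr0 subr0 mulr1 -/B.
  rewrite {2}/X h0 (_ : 2 * 1 - 1 = 1) ?mulr1; last by ring.
  rewrite cosK; last by rewrite in_itv /=; lra.
  have [_ /andP[hc0 hc1] dhc] := H c hc; have /andP[Xc1 Xc2] := X1 c hc.
  have Xlt1 : 0 < 1 - X c ^+ 2 by nra.
  have s0 : 0 < Num.sqrt (1 - X c ^+ 2) by rewrite sqrtr_gt0.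
  set d := (X in _ = X); have d0 : d <= 0.
    set s := Num.sqrt (1 - X c ^+ 2) in s0 *.
    have s2 : s ^+ 2 = 1 - X c ^+ 2 by rewrite sqr_sqrtr// ltW.
    set q := Num.sqrt m; have q0 : 0 <= q by exact: sqrtr_ge0.
    have q2 : q ^+ 2 = m by rewrite sqr_sqrtr.
    have N0 : 0 < 1 + c ^+ 2 * m by rewrite ltr_pwDl// mulr_ge0// sqr_ge0.
    (* Since 4 h (1 - h) = 1 - (2 h - 1)^2, the bound acquires the factor cos^2 a - X^2 <= 1 - X^2,
       which cancels the denominator of the derivative of [acos]. *)
    have key : (cos a * dh c) ^+ 2 <= (q / (1 + c ^+ 2 * m) * s) ^+ 2.
      rewrite exprMn [leRHS]exprMn s2 expr_div_n q2.
      apply: (@le_trans _ _ (cos a ^+ 2 * (4 * (m / (1 + c ^+ 2 * m) ^+ 2) * (h c * (1 - h c))))).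
        by rewrite ler_wpM2l// sqr_ge0.
      rewrite (_ : cos a ^+ 2 * _ = m / (1 + c ^+ 2 * m) ^+ 2 * (cos a ^+ 2 - X c ^+ 2)); last first.
        by rewrite /X; ring.
      rewrite ler_wpM2l ?divr_ge0 ?sqr_ge0// lerD2r.
      by rewrite expr_le1// ltW.
    have key2 : - (cos a * dh c) <= q / (1 + c ^+ 2 * m) * s.
      have : `|cos a * dh c| <= `|q / (1 + c ^+ 2 * m) * s| by rewrite -ler_sqr ?nnegrE// !real_normK ?num_real.
      rewrite [X in _ <= X]ger0_norm; last by rewrite mulr_ge0 ?divr_ge0// ltW.
      by apply: le_trans; rewrite -normrN ler_norm.
    rewrite /d -/s -/q exprMn q2 [m * _]mulrC.
    rewrite (_ : - s^-1 * _ = 2 * ((- (cos a * dh c)) / s)); last by ring.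
    rewrite -mulrBr pmulr_rle0// subr_le0 ler_pdivrMr// [X in X * s]mulrC.
    exact: key2.
  move=> E; have le1 : acos (X 1) <= a + B by lra.
  have X11 : -1 <= X 1 <= 1.
    by have := X1 1; rewrite ler01 lexx => /(_ isT) /andP[/ltW -> /ltW ->].
  have -> : cos a * (2 * h 1 - 1) = cos (acos (X 1)) by rewrite acosK.
  by rewrite leNgt ltr_cos ?in_itv /= ?acos_ge0 ?acos_lepi// -?leNgt//; lra.
have cB : cos B <= 2 * h 1 - 1.
  rewrite leNgt; apply/negP => lt.
  pose g (a : R) := cos a * (2 * h 1 - 1) - cos (a + B).
  have cg : {for 0, continuous g}.
    apply: cvgB; first by apply: cvgMl; exact: continuous_cos.
    apply: (@continuous_comp R R R (fun a => a + B)); last exact: continuous_cos.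
    by apply: cvgD => //; exact: cvg_cst.
  have g0 : g 0 < 0 by rewrite /g cos0 mul1r add0r subr_lt0.
  have ng0 : 0 < - g 0 by rewrite oppr_gt0.
  have /cvgrPdist_lt/(_ _ ng0)[e /= e0 he] := cg.
  (* Small enough for continuity at 0 to preserve the strict inequality and for both side conditions
     of [step]. *)
  pose a := Num.min (e / 2) (Num.min (pi / 4) (pi - B)).
  have a0 : 0 < a by rewrite !lt_min !divr_gt0// subr_gt0.
  have [ae [ap aB']] : a <= e / 2 /\ a <= pi / 4 /\ a <= pi - B.
    by rewrite !ge_min !lexx !orbT.
  have h1 := step a a0; have := he a; rewrite /= sub0r normrN gtr0_norm//.
  rewrite ltr_norml => h2; have h3 : a < e by lra.
  have h4 : a < pi / 2 by lra.
  have h5 : a + B <= pi by lra.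
  by move: (h2 h3) (h1 h4 h5) => /andP[]; rewrite /g; lra.
have cosB : cos B = 2 / (1 + m) - 1.
  rewrite /B mulr_natl cos_mulr2n cos_atan exprVn !sqr_sqrtr//; last exact: addr_ge0.
  by rewrite mulr_natl.
move: cB; rewrite cosB => cB.
have : 2 / (1 + m) <= 2 * h 1 by lra.
by rewrite ler_pM2l.
Qed.

Lemma is_derive_mdot (Q : 'M[C]_3) (P : R -> 'M[C]_3) (t : R) (dP : 'M[C]_3) :
  (forall i j, is_cderive (fun s => P s i j) t (dP i j)) ->
  is_derive t 1 (fun s => mdot Q (P s)) (mdot Q dP).
Proof.
move=> H; rewrite /mdot.
have E : (fun s => \sum_i \sum_j Re (Q i j * (P s i j)^*%C)) =
    \sum_i \sum_j (fun s => Re (Q i j * (P s i j)^*%C)).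
  by apply/funext => s; rewrite fct_sumE; apply: eq_bigr => i _; rewrite fct_sumE.
rewrite E; apply: is_derive_sum => i; apply: is_derive_sum => j.
by have [] := is_cderiveZ (Q i j) (is_cderive_conj (H i j)).
Qed.

Lemma mdot_projm_ge0 f G : f != 0 -> G != 0 -> 0 <= mdot (projm f) (projm G).
Proof. by move=> f0 G0; rewrite mdot_proj// divr_ge0 ?csq_ge0 ?mulr_ge0 ?nsq_ge0. Qed.

Lemma mdot_projm_le1 f G : f != 0 -> G != 0 -> mdot (projm f) (projm G) <= 1.
Proof.
move=> f0 G0; rewrite mdot_proj// ler_pdivrMr ?mul1r ?csq_hdot_le//.
by rewrite mulr_gt0 ?nsq_gt0.
Qed.

Lemma lineZ (c : C) F : c != 0 -> F != 0 -> line (c *: F) = line F.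
Proof.
by move=> c0 F0; apply: proj_line; rewrite ?projZ// scaler_eq0 negb_or c0.
Qed.

(* Along the geodesic from [p] to [q] the scalar product of projectors is
   [cos^2]; its derivative after [phi] is controlled by the preserved speed, so [phi] does
   not increase the distance. *)
Lemma mdot_isometry_le (phi : CP2 R -> CP2 R) p q : preserves_fs phi ->
  mdot (pt p) (pt q) <= mdot (pt (phi p)) (pt (phi q)).
Proof.
move=> iso; have [u0 u00 ->] := CP2_line p; have [v0 v00 ->] := CP2_line q.
have [f f0 Ef] := CP2_line (phi (line u0)).
have [g g0 Eg] := CP2_line (phi (line v0)).
rewrite Ef Eg !pt_line//.
pose c : C := (Num.sqrt (nsq u0))^-1%:C; pose u : 'rV[C]_3 := c *: u0.
have nu0 := nsq_gt0 u00.
have c0 : c != 0 by rewrite fmorph_eq0 invr_eq0 gt_eqF// sqrtr_gt0.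
have u1 : nsq u = 1.
  by rewrite nsqZ csq_real exprVn sqr_sqrtr ?ltW// mulVf// gt_eqF.
have un0 : u != 0 by rewrite scaler_eq0 negb_or c0.
have Eu : line u0 = line u by rewrite lineZ.
(* For orthogonal lines the left side is 0; otherwise the second line has a representative with
   scalar product 1 against [u], of the form [u + w] with [w] orthogonal to [u]. *)
have [z0|z0] := eqVneq (hdot v0 u) 0.
  rewrite mdot_proj// (hdotC v0 u0) (_ : hdot v0 u0 = 0).
    by rewrite conjc0 /csq /= expr0n addr0 mul0r mdot_projm_ge0.
  apply/eqP; have /eqP := z0; rewrite /u hdotZr mulf_eq0 fmorph_eq0.
  by rewrite (negbTE c0).
pose v : 'rV[C]_3 := (hdot v0 u)^-1 *: v0; pose w : 'rV[C]_3 := v - u.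
have vu : hdot v u = 1 by rewrite hdotZl mulVf.
have wu : hdot w u = 0 by rewrite hdotBl vu hdotE u1 subrr.
have Ev : line v0 = line (u + 1%:C *: w).
  by rewrite scale1r addrC subrK lineZ// invr_eq0.
have g_neq0 (t : R) : u + t%:C *: w != 0.
  rewrite -nsq_eq0 nsq_line// u1 gt_eqF// ltr_pwDl// mulr_ge0 ?sqr_ge0//.
  exact: nsq_ge0.
have -> : mdot (projm u0) (projm v0) = (1 + nsq w)^-1.
  have vn0 : v != 0 by rewrite scaler_eq0 negb_or invr_eq0 z0.
  have -> : projm u0 = projm u by rewrite projZ.
  have -> : projm v0 = projm v by rewrite projZ// invr_eq0.
  rewrite mdot_proj// u1 mul1r (hdotC v u) vu /csq conjc1 /= expr1n expr0n addr0 mul1r.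
  by rewrite -[v](subrK u) -/w addrC nsqD_orth// u1.
pose h (t : R) := mdot (projm f) (pt (phi (line (u + t%:C *: w)))).
have h0 : h 0 = 1.
  rewrite /h scale0r addr0 -Eu Ef pt_line// mdot_proj//.
  by rewrite hdotE csq_real expr2 divff// mulf_neq0// nsq_eq0.
have h1 : mdot (projm f) (projm g) = h 1 by rewrite /h -Ev Eg pt_line.
rewrite h1.
have D (t : R) : exists d : R, is_derive t 1 h d /\
    d ^+ 2 <= 4 * (nsq w / (1 + t ^+ 2 * nsq w) ^+ 2) * (h t * (1 - h t)).
  have [U [Phi [[oU Ut sPhi lPhi] met]]] := iso _ (g_neq0 t).
  set gt := u + t%:C *: w in Ut met *.
  have [Phi0 PhiE] := lPhi _ Ut.
  have dPhi : forall i j, is_cderive (fun s => projm (Phi (gt + s%:C *: w)) i j) 0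
     (dprojm (Phi gt) (horiz (Phi gt) (rderiv3 w Phi gt)) i j).
    have e0 : Phi (gt + 0%:C *: w) = Phi gt by rewrite scale0r addr0.
    have hj j : is_cderive (fun s => Phi (gt + s%:C *: w) 0 j) 0 (rderiv3 w Phi gt 0 j).
      by rewrite mxE; exact: (Ck_on_rderivable w (sPhi 1 j) Ut).
    exact: is_cderive_proj e0 hj Phi0.
  exists (mdot (projm f) (dprojm (Phi gt) (horiz (Phi gt) (rderiv3 w Phi gt)))); split.
    apply/is_derive_trans; have := is_derive_mdot (projm f) dPhi.
    apply: near_eq_is_derive; apply: filterS (near_line w oU Ut) => s Us.
    rewrite /h; congr (mdot _ _).
    have -> : u + (t + s)%:C *: w = gt + s%:C *: w by rewrite realcD scalerDl addrA.
    by have [Ps ->] := lPhi _ Us; rewrite pt_line.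
  have hE : h t = mdot (projm f) (projm (Phi gt)) by rewrite /h PhiE pt_line.
  rewrite hE -(fs_metric_line t wu u1) -met fs_metric_nsq.
  by apply: overlap_deriv_bound => //; exact: hdot_horiz.
have [dh hdh] := choice D.
apply: (angle_comparison (dh := dh)) => // [|t _]; first exact: nsq_ge0.
have [dt bt] := hdh t; split => //.
have [G G0 EG] := CP2_line (phi (line (u + t%:C *: w))).
by rewrite /h EG pt_line// mdot_projm_ge0//= mdot_projm_le1.
Qed.

End Overlap.

(** * The projector equation of minimal Lagrangian surfaces *)

Section LiftGeometry.
Variable R : realType.
Local Notation C := R[i].
Local Notation V := (R[i]^o).
Implicit Types (F : V -> 'rV[C]_3) (U : set V) (v w z : V).

Lemma rderive_linear U (h : V -> C) v z : open U -> U z -> Ck_on 1 U h ->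
  rderive v h z = (Re v)%:C * pdx h z + (Im v)%:C * pdy h z.
Proof.
move=> oU Uz Ch.
have hc : is_cderive (fun t : R => z + t%:C *: v : C) 0 v.
  apply: is_cderive_eq (is_cderiveD (is_cderive_cst (z : C) 0)
    (is_cderiveM (is_cderive_real (is_derive_id (0 : R) 1)) (is_cderive_cst (v : C) 0))) _.
  by rewrite mulr0 addr0 add0r mul1r.
have E : z + (0 : R)%:C *: v = z by rewrite scale0r addr0.
have Uc : U (z + (0 : R)%:C *: v) by rewrite E.
have := C1_chain oU Ch Uc hc; rewrite E => h1.
exact: is_cderive_unique (Ck_on_rderivable v Ch Uz) h1.
Qed.

Lemma Ck_on_hdot k U (F G : V -> 'rV[C]_3) : open U ->
  (forall j, Ck_on k U (fun z => F z 0 j)) -> (forall j, Ck_on k U (fun z => G z 0 j)) ->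
  Ck_on k U (fun z => hdot (F z) (G z)).
Proof.
move=> oU hF hG; apply: (Ck_on_sum (f := fun j z => F z 0 j * (G z 0 j)^*%C)) => // j.
by apply: Ck_onM => //; exact: Ck_on_conj.
Qed.

(** Here f', d' are derivatives of the lift and of its horizontal part [d], and [k] is the covariant
    derivative. Splitting f' = d + a f and d' = k + a d - (|d|^2 / |f|^2) f isolates the factor [a],
    which depends on the lift; it cancels. *)
Lemma dprojm_deriv_algebra (f f' d d' k : 'rV[C]_3) (i j : 'I_3) : f != 0 ->
  d = horiz f f' -> k = horiz f d' - (hdot f' f / hdot f f) *: d ->
  hdot d' f + hdot d f' = 0 ->
  (d' 0 i * (f 0 j)^*%C + d 0 i * (f' 0 j)^*%C +
   (f' 0 i * (d 0 j)^*%C + f 0 i * (d' 0 j)^*%C)) / hdot f f +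
  (d 0 i * (f 0 j)^*%C + f 0 i * (d 0 j)^*%C) *
  (- (hdot f' f + hdot f f') / hdot f f ^+ 2) =
  (k 0 i * (f 0 j)^*%C + f 0 i * (k 0 j)^*%C +
   2 * d 0 i * (d 0 j)^*%C) / hdot f f
  - 2 * hdot d d * f 0 i * (f 0 j)^*%C / hdot f f ^+ 2.
Proof.
move=> f0 dE kE orth; have N0 := hdot_neq0 f0.
have df : hdot d f = 0 by rewrite dE hdot_horiz.
pose a := hdot f' f / hdot f f.
have Df' : f' = d + a *: f by rewrite dE horizE subrK.
have hDD : hdot d f' = hdot d d by rewrite Df' hdotDr hdotZr df mulr0 addr0.
have DD' : d' = k + a *: d - (hdot d d / hdot f f) *: f.
  rewrite kE -/a subrK horizE.
  have -> : hdot d' f = - hdot d d by apply/eqP; rewrite -addr_eq0 -hDD orth.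
  by rewrite mulNr scaleNr opprK addrK.
have EF l : f' 0 l = d 0 l + a * f 0 l by rewrite {1}Df' !mxE.
have ED l : d' 0 l = k 0 l + a * d 0 l - hdot d d / hdot f f * f 0 l.
  by rewrite DD' !mxE.
have EN : hdot f' f + hdot f f' = (a + a^*%C) * hdot f f.
  by rewrite /a conjcM conjcV -!hdotC; field.
rewrite EN !EF !ED !conjcB !conjcD !conjcM conjcV -!hdotC.
by field.
Qed.

Section OneLift.
Variables (U : set V) (F : V -> 'rV[C]_3).
Hypotheses (oU : open U) (sF : smooth_on U F) (F0 : forall z, U z -> F z != 0).

Definition pentry i j z := projm (F z) i j.

Lemma smooth_hdotV k : Ck_on k U (fun z => (hdot (F z) (F z))^-1).
Proof.
apply: Ck_onV => //; last exact: Ck_on_hdot.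
by move=> z Uz; exact/hdot_neq0/F0.
Qed.

Lemma smooth_pentry k i j : Ck_on k U (pentry i j).
Proof.
apply: (Ck_on_ext (f := fun z => F z 0 i * (F z 0 j)^*%C * (hdot (F z) (F z))^-1)) => //.
  by move=> z _; rewrite /pentry mxE.
apply: Ck_onM => //; first by apply: Ck_onM => //; apply: Ck_on_conj.
exact: smooth_hdotV.
Qed.

Lemma smooth_rderiv3 k v j : Ck_on k U (fun z => rderiv3 v F z 0 j).
Proof.
apply: (Ck_on_ext (f := rderive v (fun z => F z 0 j))) => //.
  by move=> z _; rewrite mxE.
by apply: Ck_on_rderive; exact: sF.
Qed.

Lemma smooth_dlift k v j : Ck_on k U (fun z => dlift F v z 0 j).
Proof.
apply: (Ck_on_ext (f := fun z => rderiv3 v F z 0 j +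
   (-1) * (hdot (rderiv3 v F z) (F z) * (hdot (F z) (F z))^-1 * F z 0 j))) => //.
  by move=> z _; rewrite /dlift !mxE mulN1r.
apply: Ck_onD => //; first exact: smooth_rderiv3.
apply: Ck_onM => //; first exact: Ck_on_cst.
apply: Ck_onM => //; apply: Ck_onM => //.
  by apply: Ck_on_hdot => // l; exact: smooth_rderiv3.
exact: smooth_hdotV.
Qed.

Lemma is_cderive_lift v z j : U z ->
  is_cderive (fun t => F (z + t%:C *: v) 0 j) 0 (rderiv3 v F z 0 j).
Proof. by move=> Uz; rewrite mxE; exact: (Ck_on_rderivable v (sF 1 j) Uz). Qed.

Lemma rderive_pentry v z i j : U z ->
  rderive v (pentry i j) z = dprojm (F z) (dlift F v z) i j.
Proof.
move=> Uz; apply: is_cderive_unique (Ck_on_rderivable v (smooth_pentry 1 i j) Uz) _.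
apply: (is_cderive_proj (F := fun t => F (z + t%:C *: v))).
- by rewrite scale0r addr0.
- by move=> l; exact: is_cderive_lift.
- exact: F0.
Qed.

Lemma hdot_dlift v z : U z -> hdot (dlift F v z) (F z) = 0.
Proof. by move=> Uz; apply: hdot_horiz; exact: F0. Qed.

Definition covd v z := cov_deriv F v v z.

Lemma hdot_covd v z : U z -> hdot (covd v z) (F z) = 0.
Proof.
move=> Uz; rewrite /covd /cov_deriv; set X := rderiv3 _ _ _; set c := (_ / _).
rewrite hdotBl (hdot_horiz _ (F0 Uz)) sub0r hdotZl.
by rewrite (hdot_dlift v Uz) mulr0 oppr0.
Qed.

(** The terms in [covd] are the image of the covariant derivative; those quadratic in [dlift] are
    the second fundamental form of CP^2 in the Hermitian matrices. *)
Lemma rderive2_pentry v z i j : U z ->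
  rderive v (rderive v (pentry i j)) z =
  (covd v z 0 i * (F z 0 j)^*%C + F z 0 i * (covd v z 0 j)^*%C +
   2 * dlift F v z 0 i * (dlift F v z 0 j)^*%C) / hdot (F z) (F z)
  - 2 * hdot (dlift F v z) (dlift F v z) * F z 0 i * (F z 0 j)^*%C / hdot (F z) (F z) ^+ 2.
Proof.
move=> Uz; have N0 := hdot_neq0 (F0 Uz).
apply: is_cderive_unique (Ck_on_rderivable v (Ck_on_rderive v (smooth_pentry 2 i j)) Uz) _.
pose c (t : R) := z + t%:C *: v.
have c0 : c 0 = z by rewrite /c scale0r addr0.
have hF l : is_cderive (fun t => F (c t) 0 l) 0 (rderiv3 v F z 0 l).
  exact: is_cderive_lift.
have hD l : is_cderive (fun t => dlift F v (c t) 0 l) 0 (rderiv3 v (dlift F v) z 0 l).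
  by rewrite [X in is_cderive _ _ X]mxE; exact: (Ck_on_rderivable v (smooth_dlift 1 v l) Uz).
apply: (rderive_local (f := fun y => (dlift F v y 0 i * (F y 0 j)^*%C +
   F y 0 i * (dlift F v y 0 j)^*%C) * (hdot (F y) (F y))^-1) oU Uz).
  by move=> y Uy; rewrite rderive_pentry// [RHS]mxE.
have hN : hdot (F (c 0)) (F (c 0)) != 0 by rewrite c0.
have := is_cderiveM (is_cderiveD
  (is_cderiveM (hD i) (is_cderive_conj (hF j)))
  (is_cderiveM (hF i) (is_cderive_conj (hD j))))
  (is_cderiveV hN (is_cderive_hdot hF hF)).
rewrite /= c0 => h; apply: is_cderive_eq h _.
(* Differentiate [hdot (dlift F v) F = 0]. *)
have orth : hdot (rderiv3 v (dlift F v) z) (F z) + hdot (dlift F v z) (rderiv3 v F z) = 0.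
  have := is_cderive_hdot hD hF; rewrite c0 => h.
  apply: is_cderive_unique h _.
  have e y : U y -> 0 = hdot (dlift F v y) (F y) by move=> Uy; rewrite hdot_dlift.
  exact: (rderive_local (v := v) oU Uz e (is_cderive_cst 0 0)).
exact: dprojm_deriv_algebra (F0 Uz) (erefl _) (erefl _) orth.
Qed.

Lemma pullback_metricE v w z :
  pullback_metric F z v w = Re (hdot (dlift F v z) (dlift F w z)) / nsq (F z).
Proof. by rewrite /pullback_metric fs_metricE. Qed.

Lemma rderiv3_linear v z : U z -> rderiv3 v F z =
  (Re v)%:C *: rderiv3 (1 : V) F z + (Im v)%:C *: rderiv3 ('i%C : V) F z.
Proof.
move=> Uz; apply/rowP => j; rewrite [LHS]mxE (rderive_linear v oU Uz (sF 1 j)).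
rewrite [RHS]mxE [X in _ = X + _]mxE [X in _ = _ + X]mxE.
by congr (_ * _ + _ * _); rewrite [RHS]mxE.
Qed.

End OneLift.

Lemma horizD (f X Y : 'rV[C]_3) : horiz f (X + Y) = horiz f X + horiz f Y.
Proof. by rewrite /horiz hdotDl mulrDl scalerDl opprD addrACA. Qed.

Lemma horizZ (f X : 'rV[C]_3) (c : C) : horiz f (c *: X) = c *: horiz f X.
Proof. by rewrite /horiz hdotZl scalerBr scalerA mulrA. Qed.

Lemma horiz_linear (f X Y : 'rV[C]_3) (a b : C) :
  horiz f (a *: X + b *: Y) = a *: horiz f X + b *: horiz f Y.
Proof. by rewrite horizD !horizZ. Qed.

(** The projector embedding doubles the Fubini-Study metric, whence the factors [2 * lam] later. *)
Lemma mdot_dprojm (f d e : 'rV[C]_3) : f != 0 -> hdot d f = 0 -> hdot e f = 0 ->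
  mdot (dprojm f d) (dprojm f e) = 2 * Re (hdot d e) / nsq f.
Proof.
move=> f0 df ef; have nf := nsq_gt0 f0; have N0 := hdot_neq0 f0.
rewrite /mdot; under eq_bigr do rewrite -raddf_sum.
rewrite -raddf_sum /=.
have -> : \sum_i \sum_j dprojm f d i j * (dprojm f e i j)^*%C =
    (hdot d e + hdot e d) * ((nsq f)^-1)%:C.
  have fe : hdot f e = 0 by rewrite hdotC ef conjc0.
  have -> : hdot d e + hdot e d = (hdot d e * hdot f f + hdot d f * hdot e f +
      (hdot f e * hdot f d + hdot f f * hdot e d)) * (hdot f f)^-1.
    by rewrite df fe !mul0r; field.
  rewrite realcV -!hdotE.
  have -> : hdot d e * hdot f f + hdot d f * hdot e f +
      (hdot f e * hdot f d + hdot f f * hdot e d) = \sum_i \sum_j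
      (d 0 i * (f 0 j)^*%C + f 0 i * (d 0 j)^*%C) * ((e 0 i)^*%C * f 0 j + (f 0 i)^*%C * e 0 j).
    rewrite {1 2 3 4 5 6 7 8}/hdot !mulr_suml -!big_split /=; apply: eq_bigr => i _.
    by rewrite !mulr_sumr -!big_split /=; apply: eq_bigr => j _; ring.
  rewrite !mulr_suml; apply: eq_bigr => i _; rewrite !mulr_suml; apply: eq_bigr => j _.
  by rewrite !mxE !conjcM conjcD !conjcM conjcV !conjcK -!hdotC; field.
rewrite re_mul /= mulr0 subr0; congr (_ * _).
by rewrite (hdotC d e) re_add re_conj; ring.
Qed.

(* Three pairwise orthogonal vectors resolve the identity: a one-sided inverse of a
   square matrix is two-sided. *)
Lemma orthogonal_resolution (f d e : 'rV[C]_3) (i j : 'I_3) :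
  f != 0 -> d != 0 -> e != 0 -> hdot d f = 0 -> hdot e f = 0 -> hdot d e = 0 ->
  f 0 i * (f 0 j)^*%C / hdot f f + d 0 i * (d 0 j)^*%C / hdot d d +
  e 0 i * (e 0 j)^*%C / hdot e e = (i == j)%:R.
Proof.
move=> f0 d0 e0 df ef de.
pose a (k : 'I_3) := if k == 0 then f else if k == 1 then d else e.
pose A := \matrix_(k < 3, l < 3) (a k 0 l)^*%C.
pose B := \matrix_(l < 3, k < 3) (a k 0 l / hdot (a k) (a k)).
have fd : hdot f d = 0 by rewrite hdotC df conjc0.
have fe : hdot f e = 0 by rewrite hdotC ef conjc0.
have ed : hdot e d = 0 by rewrite hdotC de conjc0.
have AB : A *m B = 1%:M.
  apply/matrixP => k l; rewrite !mxE.
  have -> : \sum_j0 A k j0 * B j0 l = hdot (a l) (a k) / hdot (a l) (a l).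
    by rewrite {1}/hdot mulr_suml; apply: eq_bigr => m _; rewrite !mxE mulrCA mulrA.
  have [->|kl] := eqVneq k l.
    by rewrite divff//; apply: hdot_neq0; rewrite /a; case: ifP => // _; case: ifP.
  suff -> : hdot (a l) (a k) = 0 by rewrite mul0r.
  move: kl; rewrite /a.
  case: k => -[|[|[|k]]] //= ?; case: l => -[|[|[|l]]] //= ?.
have := mulmx1C AB => /matrixP/(_ i j); rewrite !mxE => <-.
rewrite !big_ord_recl big_ord0 !mxE /a /= addr0.
by rewrite -addrA; congr (_ + (_ + _)); rewrite mulrAC.
Qed.

(** For a conformal Lagrangian map [f], [d], [e] are orthogonal over the complex numbers, so
    resolving the identity expresses d d^* + e e^* through 1 and the projector. The vector s d + t e
    is the sum of the two covariant derivatives, tangential by minimality. *)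
Lemma conformal_laplacian (f d e : 'rV[C]_3) (lam s t : R) (i j : 'I_3) :
  f != 0 -> 0 < lam -> nsq d = lam * nsq f -> nsq e = lam * nsq f ->
  hdot d f = 0 -> hdot e f = 0 -> hdot d e = 0 ->
  ((s%:C *: d + t%:C *: e) 0 i * (f 0 j)^*%C + f 0 i * ((s%:C *: d + t%:C *: e) 0 j)^*%C +
   2 * (d 0 i * (d 0 j)^*%C + e 0 i * (e 0 j)^*%C)) / hdot f f
  - 2 * (hdot d d + hdot e e) * f 0 i * (f 0 j)^*%C / hdot f f ^+ 2 =
  (2 * lam)%:C * ((i == j)%:R - 3 * projm f i j) +
    s%:C * dprojm f d i j + t%:C * dprojm f e i j.
Proof.
move=> f0 l0 nd ne df ef de; have nf := nsq_gt0 f0; have N0 := hdot_neq0 f0.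
have d0 : d != 0 by rewrite -nsq_eq0 nd gt_eqF// mulr_gt0.
have e0 : e != 0 by rewrite -nsq_eq0 ne gt_eqF// mulr_gt0.
have lC : lam%:C != 0 by rewrite fmorph_eq0 gt_eqF.
rewrite -(orthogonal_resolution i j f0 d0 e0 df ef de).
rewrite !(hdotE d) !(hdotE e) nd ne !realcM -!hdotE !mxE !conjcD !conjcM !conjc_cst.
have -> : (2 : R)%:C = 2 :> C by rewrite rmorph_nat.
by field; apply/andP.
Qed.

Lemma normal_part_algebra (a b c x y l : R) (X d e : 'rV[C]_3) : l != 0 ->
  a = l -> b = 0 -> c = l ->
  X - ((c * x - b * y) / (a * c - b ^+ 2))%:C *: d
    - ((a * y - b * x) / (a * c - b ^+ 2))%:C *: e =
  X - (x / l)%:C *: d - (y / l)%:C *: e.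
Proof.
move=> h -> -> ->; have -> : (l * x - 0 * y) / (l * l - 0 ^+ 2) = x / l by field.
by have -> : (l * y - 0 * x) / (l * l - 0 ^+ 2) = y / l by field.
Qed.

Lemma mean_curvature_algebra (D a b d e A B : 'rV[C]_3) (x y s t l g h k : R) : l != 0 ->
  g = l -> h = 0 -> k = l ->
  A = a - (x / l)%:C *: d - (s / l)%:C *: e -> B = b - (y / l)%:C *: d - (t / l)%:C *: e ->
  ((2 * (g * k - h ^+ 2))^-1)%:C *: (k%:C *: A - (2 * h)%:C *: D + g%:C *: B) =
  ((2 * l)^-1)%:C *: (a + b - ((x + y) / l)%:C *: d - ((s + t) / l)%:C *: e).
Proof.
move=> l1 -> -> -> -> ->; rewrite mulr0 scale0r subr0 -scalerDr scalerA -realcM.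
have -> : (2 * (l * l - 0 ^+ 2))^-1 * l = (2 * l)^-1 by field.
rewrite !mulrDl !realcD; congr (_ *: _).
move: (x / l)%:C (y / l)%:C (s / l)%:C (t / l)%:C => p q r u.
by apply/rowP => j; rewrite !mxE; ring.
Qed.

(** Applied to [f], the matrix identity isolates [w] and gives [w = 0]; applied to [d], it then
    gives [hdot d e = 0], whose imaginary part is the Lagrangian condition. *)
Lemma conformal_laplacian_inv (f d e w : 'rV[C]_3) (lam : R) :
  f != 0 -> 0 < lam -> nsq d = lam * nsq f -> nsq e = lam * nsq f ->
  hdot d f = 0 -> hdot e f = 0 -> hdot w f = 0 ->
  (forall i j, (w 0 i * (f 0 j)^*%C + f 0 i * (w 0 j)^*%C +
   2 * (d 0 i * (d 0 j)^*%C + e 0 i * (e 0 j)^*%C)) / hdot f f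
  - 2 * (hdot d d + hdot e e) * f 0 i * (f 0 j)^*%C / hdot f f ^+ 2 =
  (2 * lam)%:C * ((i == j)%:R - 3 * projm f i j)) ->
  w = 0 /\ hdot d e = 0.
Proof.
move=> f0 l0 nd ne df ef wf H; have nf := nsq_gt0 f0; have N0 := hdot_neq0 f0.
have lC : lam%:C != 0 by rewrite fmorph_eq0 gt_eqF.
have fw : hdot f w = 0 by rewrite hdotC wf conjc0.
have fd : hdot f d = 0 by rewrite hdotC df conjc0.
have fe : hdot f e = 0 by rewrite hdotC ef conjc0.
have T i j : w 0 i * (f 0 j)^*%C + f 0 i * (w 0 j)^*%C +
    2 * (d 0 i * (d 0 j)^*%C + e 0 i * (e 0 j)^*%C) =
    2 * lam%:C * (hdot f f * (i == j)%:R - f 0 i * (f 0 j)^*%C).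
  have E (x : C) : x = (x / hdot f f - 2 * (hdot d d + hdot e e) * f 0 i * (f 0 j)^*%C / hdot f f ^+ 2)
      * hdot f f + 2 * (hdot d d + hdot e e) * f 0 i * (f 0 j)^*%C / hdot f f by field.
  apply: etrans (E _) _; rewrite H mxE !(hdotE d) !(hdotE e) nd ne !realcM -!hdotE.
  have -> : (2 : R)%:C = 2 :> C by rewrite rmorph_nat.
  by field.
have delta (a : 'rV[C]_3) i : \sum_j (i == j)%:R * a 0 j = a 0 i.
  rewrite (bigD1 i)//= eqxx mul1r big1 ?addr0// => j ji.
  by rewrite eq_sym (negbTE ji) mul0r.
have Ta (a : 'rV[C]_3) i : w 0 i * hdot a f + f 0 i * hdot a w +
    2 * (d 0 i * hdot a d + e 0 i * hdot a e) =
    2 * lam%:C * (hdot f f * a 0 i - f 0 i * hdot a f).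
  have -> : w 0 i * hdot a f + f 0 i * hdot a w +
      2 * (d 0 i * hdot a d + e 0 i * hdot a e) =
      \sum_j (w 0 i * (f 0 j)^*%C + f 0 i * (w 0 j)^*%C +
       2 * (d 0 i * (d 0 j)^*%C + e 0 i * (e 0 j)^*%C)) * a 0 j.
    rewrite /hdot !mulr_sumr -!big_split mulr_sumr -big_split /=.
    by apply: eq_bigr => j _; ring.
  under eq_bigr do rewrite T.
  have -> : hdot f f * a 0 i - f 0 i * hdot a f = \sum_j
      (hdot f f * ((i == j)%:R * a 0 j) - f 0 i * (a 0 j * (f 0 j)^*%C)).
    by rewrite sumrB -!mulr_sumr delta.
  rewrite mulr_sumr; by apply: eq_bigr => j _; ring.
have w0 : w = 0.
  apply/rowP => i; rewrite mxE; have := Ta f i; rewrite fw fd fe.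
  rewrite !mulr0 !addr0 mulr0 [f 0 i * _]mulrC subrr mulr0 addr0.
  by move/eqP; rewrite mulf_eq0 (negbTE N0) orbF => /eqP.
split => //.
have e0 : e != 0 by rewrite -nsq_eq0 ne gt_eqF// mulr_gt0.
have [i ei] := nsq_diag e0.
have := Ta d i; rewrite df w0 hdot0r (hdotE d) nd realcM -hdotE.
rewrite !mulr0 !add0r subr0 => h.
have : 2 * (e 0 i * hdot d e) = 0.
  have -> : 2 * (e 0 i * hdot d e) = 2 * (d 0 i * (lam%:C * hdot f f) + e 0 i * hdot d e) -
    2 * lam%:C * (hdot f f * d 0 i) by ring.
  by rewrite h subrr.
by move/eqP; rewrite !mulf_eq0 (negbTE ei) pnatr_eq0 => /eqP.
Qed.

Definition pmx (p : V -> 'M[C]_3) v z : 'M[C]_3 :=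
  \matrix_(i, j) rderive v (fun y => p y i j) z.

(* For the projector [p] on the line, minimal Lagrangian and conformal amounts to
   [Lap p = 2 lam (1 - 3 p)], lam being the conformal factor; a tangential term is
   allowed because the mean curvature only sees the normal part. *)
Definition projector_eqs (p : V -> 'M[C]_3) z (lam s t : R) : Prop :=
  [/\ 0 < lam,
      mdot (pmx p (1 : V) z) (pmx p (1 : V) z) = 2 * lam,
      mdot (pmx p ('i%C : V) z) (pmx p ('i%C : V) z) = 2 * lam,
      mdot (pmx p (1 : V) z) (pmx p ('i%C : V) z) = 0 &
      forall i j, pdx (pdx (fun y => p y i j)) z + pdy (pdy (fun y => p y i j)) z =
        (2 * lam)%:C * ((i == j)%:R - 3 * p z i j) +
        s%:C * pmx p (1 : V) z i j + t%:C * pmx p ('i%C : V) z i j].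

Section AtPoint.
Variables (U : set V) (F : V -> 'rV[C]_3) (z : V).
Hypotheses (oU : open U) (sF : smooth_on U F) (F0 : forall z, U z -> F z != 0) (Uz : U z).
Let D1 := dlift F (1 : V) z.
Let D2 := dlift F ('i%C : V) z.
Let f := F z.
Let c1 := covd F (1 : V) z.
Let c2 := covd F ('i%C : V) z.
Let f0 : f != 0 := F0 Uz.
Let D1f : hdot D1 f = 0 := hdot_dlift F0 _ Uz.
Let D2f : hdot D2 f = 0 := hdot_dlift F0 _ Uz.

Let c1f : hdot c1 f = 0 := hdot_covd F0 _ Uz.
Let c2f : hdot c2 f = 0 := hdot_covd F0 _ Uz.

Lemma pmx_projm v : pmx (fun y => projm (F y)) v z = dprojm f (dlift F v z).
Proof.
apply/matrixP => i j; rewrite mxE; exact: (rderive_pentry oU sF F0 v i j Uz).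
Qed.

Lemma laplacian_projm i j :
  pdx (pdx (fun y => projm (F y) i j)) z + pdy (pdy (fun y => projm (F y) i j)) z =
  ((c1 + c2) 0 i * (f 0 j)^*%C + f 0 i * ((c1 + c2) 0 j)^*%C +
   2 * (D1 0 i * (D1 0 j)^*%C + D2 0 i * (D2 0 j)^*%C)) / hdot f f
  - 2 * (hdot D1 D1 + hdot D2 D2) * f 0 i * (f 0 j)^*%C / hdot f f ^+ 2.
Proof.
have h1 := rderive2_pentry oU sF F0 (1 : V) i j Uz.
have h2 := rderive2_pentry oU sF F0 ('i%C : V) i j Uz.
etransitivity; first exact: (congr2 +%R h1 h2).
have E (d e a b k : 'rV[C]_3) :
    ((a 0 i * (k 0 j)^*%C + k 0 i * (a 0 j)^*%C + 2 * d 0 i * (d 0 j)^*%C) / hdot k k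
     - 2 * hdot d d * k 0 i * (k 0 j)^*%C / hdot k k ^+ 2) +
    ((b 0 i * (k 0 j)^*%C + k 0 i * (b 0 j)^*%C + 2 * e 0 i * (e 0 j)^*%C) / hdot k k
     - 2 * hdot e e * k 0 i * (k 0 j)^*%C / hdot k k ^+ 2) =
    ((a + b) 0 i * (k 0 j)^*%C + k 0 i * ((a + b) 0 j)^*%C +
      2 * (d 0 i * (d 0 j)^*%C + e 0 i * (e 0 j)^*%C)) / hdot k k
    - 2 * (hdot d d + hdot e e) * k 0 i * (k 0 j)^*%C / hdot k k ^+ 2.
  by rewrite !mxE conjcD; ring.
exact: E.
Qed.

Lemma conformal_frame lam : 0 < lam ->
  (forall v w : R[i], pullback_metric F z v w = lam * Re (v * w^*%C)) ->
  [/\ nsq D1 = lam * nsq f, nsq D2 = lam * nsq f & Re (hdot D1 D2) = 0].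
Proof.
move=> l0 H; have nf := nsq_gt0 f0.
have H11 := H 1 1; have H22 := H 'i%C 'i%C; have H12 := H 1 'i%C.
rewrite !pullback_metricE -/D1 -/D2 -/f !re_imE /= in H11 H22 H12.
have e1 : Re (hdot D1 D1) / nsq f = lam by rewrite H11; ring.
have e2 : Re (hdot D2 D2) / nsq f = lam by rewrite H22; ring.
have e12 : Re (hdot D1 D2) / nsq f = 0 by rewrite H12; ring.
split.
- by rewrite /nsq -/(nsq f) -e1 divfK// gt_eqF.
- by rewrite /nsq -/(nsq f) -e2 divfK// gt_eqF.
- by apply: (mulIf (invr_neq0 (lt0r_neq0 nf))); rewrite e12 mul0r.
Qed.

Lemma fs_formE v w : fs_form f (rderiv3 v F z) (rderiv3 w F z) =
  - Im (hdot (dlift F v z) (dlift F w z)) / nsq f.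
Proof.
rewrite /fs_form fs_metricE horizZ hdotZl -/(dlift F v z) -/(dlift F w z).
by rewrite re_mul /= mul0r mul1r sub0r.
Qed.

Lemma normal_part_conformal lam X : lam != 0 ->
  pullback_metric F z (1 : V) (1 : V) = lam ->
  pullback_metric F z ('i%C : V) ('i%C : V) = lam ->
  pullback_metric F z (1 : V) ('i%C : V) = 0 ->
  normal_part F z X = X - (fs_metric f X D1 / lam)%:C *: D1 - (fs_metric f X D2 / lam)%:C *: D2.
Proof.
move=> l0 g11 g22 g12.
exact: normal_part_algebra l0 g11 g12 g22.
Qed.

Lemma mean_curvature_conformal lam : lam != 0 ->
  pullback_metric F z (1 : V) (1 : V) = lam ->
  pullback_metric F z ('i%C : V) ('i%C : V) = lam ->
  pullback_metric F z (1 : V) ('i%C : V) = 0 ->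
  mean_curvature F z = (2 * lam)^-1%:C *: (c1 + c2
    - ((fs_metric f c1 D1 + fs_metric f c2 D1) / lam)%:C *: D1
    - ((fs_metric f c1 D2 + fs_metric f c2 D2) / lam)%:C *: D2).
Proof.
move=> l0 g11 g22 g12.
have A1 := normal_part_conformal c1 l0 g11 g22 g12.
have A2 := normal_part_conformal c2 l0 g11 g22 g12.
exact: (mean_curvature_algebra (second_form F (1 : V) ('i%C : V) z) l0 g11 g12 g22 A1 A2).
Qed.

Lemma projector_eqs_of_lift : conformal_at F z -> lagrangian_at F z -> minimal_at F z ->
  exists lam s t, projector_eqs (fun y => projm (F y)) z lam s t.
Proof.
move=> [lam l0 conf] lag min; have nf := nsq_gt0 f0.
have [n1 n2 re12] := conformal_frame l0 conf.
have im12 : Im (hdot D1 D2) = 0.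
  have := lag (1 : V) ('i%C : V); rewrite fs_formE -/D1 -/D2 => /eqP.
  by rewrite mulf_eq0 invr_eq0 (gt_eqF nf) orbF oppr_eq0 => /eqP.
(* Conformality supplies the real part and the Lagrangian condition the imaginary part. *)
have D12 : hdot D1 D2 = 0 by exact: complexP.
have pm v w : mdot (pmx (fun y => projm (F y)) v z) (pmx (fun y => projm (F y)) w z) =
    2 * Re (hdot (dlift F v z) (dlift F w z)) / nsq f.
  rewrite (pmx_projm v) (pmx_projm w).
  exact: (mdot_dprojm f0 (hdot_dlift F0 v Uz) (hdot_dlift F0 w Uz)).
have g11 := conf 1 1; have g22 := conf 'i%C 'i%C; have g12 := conf 1 'i%C.
have e1 : pullback_metric F z (1 : V) (1 : V) = lam by rewrite g11 !re_imE /=; ring.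
have e2 : pullback_metric F z ('i%C : V) ('i%C : V) = lam by rewrite g22 !re_imE /=; ring.
have e12 : pullback_metric F z (1 : V) ('i%C : V) = 0 by rewrite g12 !re_imE /=; ring.
have [s [t mc]] : exists s t : R, mean_curvature F z =
    (2 * lam)^-1%:C *: (c1 + c2 - s%:C *: D1 - t%:C *: D2).
  by eexists; eexists; exact: (mean_curvature_conformal (lt0r_neq0 l0) e1 e2 e12).
have W : c1 + c2 = s%:C *: D1 + t%:C *: D2.
  have E (k : C) (a b c : 'rV[C]_3) : k != 0 -> k *: (a - b - c) = 0 -> a = b + c.
    move=> k0 /eqP; rewrite scaler_eq0 (negbTE k0) /= => /eqP h.
    by apply/eqP; rewrite -subr_eq0 opprD addrA h.
  apply: (E ((2 * lam)^-1)%:C); last by rewrite -mc.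
  by rewrite fmorph_eq0 invr_eq0 mulf_eq0 pnatr_eq0 (gt_eqF l0).
exists lam, s, t; split => //.
- by rewrite pm -/D1 -/(nsq D1) n1; field; rewrite gt_eqF.
- by rewrite pm -/D2 -/(nsq D2) n2; field; rewrite gt_eqF.
- by rewrite pm -/D1 -/D2 re12 mulr0 mul0r.
move=> i j; rewrite laplacian_projm W (pmx_projm (1 : V)) (pmx_projm ('i%C : V)).
exact: (conformal_laplacian s t i j f0 l0 n1 n2 D1f D2f D12).
Qed.

Lemma dlift_linear v : dlift F v z = (Re v)%:C *: D1 + (Im v)%:C *: D2.
Proof.
exact: etrans (congr1 (horiz f) (rderiv3_linear oU sF v Uz)) (horiz_linear _ _ _ _ _).
Qed.

Lemma lift_of_projector_eqs lam : projector_eqs (fun y => projm (F y)) z lam 0 0 ->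
  [/\ immersion_at F z, conformal_at F z, lagrangian_at F z & minimal_at F z].
Proof.
move=> [l0 m11 m22 m12 L]; have nf := nsq_gt0 f0.
have pm v w : mdot (pmx (fun y => projm (F y)) v z) (pmx (fun y => projm (F y)) w z) =
    2 * Re (hdot (dlift F v z) (dlift F w z)) / nsq f.
  rewrite (pmx_projm v) (pmx_projm w).
  exact: (mdot_dprojm f0 (hdot_dlift F0 v Uz) (hdot_dlift F0 w Uz)).
have solve2 (x l : R) : 2 * x / nsq f = 2 * l -> x = l * nsq f.
  move=> h; have -> : x = 2 * x / nsq f * nsq f / 2 by field; rewrite gt_eqF.
  by rewrite h; field.
have n1 : nsq D1 = lam * nsq f by apply: solve2; rewrite -m11; exact/esym/pm.
have n2 : nsq D2 = lam * nsq f by apply: solve2; rewrite -m22; exact/esym/pm.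
have wf : hdot (c1 + c2) f = 0.
  exact: etrans (hdotDl c1 c2 f) (etrans (congr2 +%R c1f c2f) (addr0 0)).
have [W D12] : c1 + c2 = 0 /\ hdot D1 D2 = 0.
  apply: (conformal_laplacian_inv f0 l0 n1 n2 D1f D2f wf) => i j.
  by rewrite -laplacian_projm L !mul0r !addr0.
have hD v w : hdot (dlift F v z) (dlift F w z) =
    ((Re v * Re w + Im v * Im w) * (lam * nsq f))%:C.
  have E (d e : 'rV[C]_3) (a b a' b' n : R) : nsq d = n -> nsq e = n -> hdot d e = 0 ->
      hdot (a%:C *: d + b%:C *: e) (a'%:C *: d + b'%:C *: e) = ((a * a' + b * b') * n)%:C.
    move=> nd ne de; have ed : hdot e d = 0 by rewrite hdotC de conjc0.
    rewrite hdotDl !hdotDr !hdotZl !hdotZr !conjc_cst de ed !hdotE nd ne.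
    by rewrite !(realcM, realcD); ring.
  by rewrite (dlift_linear v) (dlift_linear w); exact: (E D1 D2 _ _ _ _ _ n1 n2 D12).
have g v w : pullback_metric F z v w = lam * (Re v * Re w + Im v * Im w).
  rewrite pullback_metricE hD -/f.
  have -> (x : R) : Re x%:C = x by [].
  by field; rewrite gt_eqF.
split.
- move=> v v0; have := hD v v; rewrite v0 hdot0l => /esym/eqP.
  rewrite fmorph_eq0 !mulf_eq0 (gt_eqF l0) (gt_eqF nf) !orbF -!expr2.
  rewrite paddr_eq0 ?sqr_ge0// !sqrf_eq0 => /andP[/eqP a /eqP b].
  exact: complexP.
- exists lam => // v w; rewrite g !re_imE; congr (_ * _); ring.
- by move=> v w; rewrite -/f fs_formE hD /= oppr0 mul0r.
- have e1 : pullback_metric F z (1 : V) (1 : V) = lam by rewrite g /=; ring.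
  have e2 : pullback_metric F z ('i%C : V) ('i%C : V) = lam by rewrite g /=; ring.
  have e12 : pullback_metric F z (1 : V) ('i%C : V) = 0 by rewrite g /=; ring.
  have E (a b d k : 'rV[C]_3) : a + b = 0 -> fs_metric k a d + fs_metric k b d = 0.
    move=> ab; rewrite !fs_metricE -mulrDl -re_add -hdotDl -horizD ab /horiz.
    by rewrite hdot0l mul0r scale0r subr0 hdot0l mul0r.
  have E0 (k : C) (l x y : R) (a d e : 'rV[C]_3) : a = 0 -> x = 0 -> y = 0 ->
      k *: (a - (x / l)%:C *: d - (y / l)%:C *: e) = 0.
    by move=> -> -> ->; rewrite mul0r !scale0r !subr0 scaler0.
  exact: etrans (mean_curvature_conformal (lt0r_neq0 l0) e1 e2 e12)
    (E0 _ _ _ _ _ _ _ W (E _ _ _ _ W) (E _ _ _ _ W)).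
Qed.

End AtPoint.
End LiftGeometry.

(** * Dictionary between minimal Lagrangian maps and projector fields *)

Section ProjectorMaps.
Variable R : realType.
Local Notation C := R[i].
Local Notation V := (R[i]^o).
Implicit Types (U D : set V) (f : V -> CP2 R) (p : V -> 'M[C]_3) (v w z : V).

Lemma Ck_on_sub (W : normedModType R[i]) k (U D : set W) (h : W -> C) :
  D `<=` U -> Ck_on k U h -> Ck_on k D h.
Proof.
move=> DU; elim: k h => [|k IH] h [c d]; first by split => // z /DU; exact: c.
split=> [z /DU|v]; first exact: c.
by have [d1 d2] := d v; split => [z /DU|]; [exact: d1|exact: IH].
Qed.

Lemma Ck_on_local (W : normedModType R[i]) k (D : set W) (h : W -> C) :
  (forall z : W, D z -> exists U : set W, [/\ open U, U z & Ck_on k U h]) -> Ck_on k D h.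
Proof.
elim: k h => [|k IH] h H.
  by split => // z /H[U [_ Uz [c _]]]; exact: c.
split=> [z /H[U [_ Uz [c _]]]|v]; first exact: c.
split=> [z /H[U [_ Uz [_ d]]]|]; first by case: (d v) => + _; apply.
by apply: IH => z /H[U [oU Uz [_ d]]]; exists U; split => //; case: (d v).
Qed.

Lemma rderive_ext (W : normedModType R[i]) (U : set W) (v z : W) (g h : W -> C) :
  open U -> U z -> (forall y, U y -> g y = h y) -> Ck_on 1 U g ->
  rderive v g z = rderive v h z.
Proof.
move=> oU Uz e Cg.
have Ch : Ck_on 1 U h by exact: Ck_on_ext e Cg.
exact: is_cderive_unique (rderive_local oU Uz e (Ck_on_rderivable v Cg Uz))
  (Ck_on_rderivable v Ch Uz).
Qed.

Lemma projector_eqs_ext U p q z lam s t : open U -> U z ->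
  (forall y, U y -> p y = q y) -> (forall i j, Ck_on 2 U (fun y => p y i j)) ->
  projector_eqs p z lam s t -> projector_eqs q z lam s t.
Proof.
move=> oU Uz e Cp [l0 m1 m2 m3 L].
have e' i j y : U y -> p y i j = q y i j by move=> /e ->.
have C1 i j : Ck_on 1 U (fun y => p y i j) by exact: Ck_onS.
have d1 v i j y : U y -> rderive v (fun y => p y i j) y = rderive v (fun y => q y i j) y.
  by move=> Uy; exact: (rderive_ext v oU Uy (e' i j) (C1 i j)).
have pm v : pmx p v z = pmx q v z.
  by apply/matrixP => i j; rewrite !mxE d1.
have d2 v i j : rderive v (rderive v (fun y => p y i j)) z =
    rderive v (rderive v (fun y => q y i j)) z.
  exact: (rderive_ext v oU Uz (d1 v i j) (Ck_on_rderive v (Cp i j))).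
split; rewrite -?pm// => i j; rewrite -(e z Uz).
exact: etrans (esym (congr2 +%R (d2 (1 : V) i j) (d2 ('i%C : V) i j))) (L i j).
Qed.

Lemma projector_of_mli D f : minimal_lagrangian_immersion D f ->
  (forall k i j, Ck_on k D (fun z => pt (f z) i j)) /\
  (forall z, D z -> exists lam s t, projector_eqs (fun y => pt (f y)) z lam s t).
Proof.
move=> mli.
have H z : D z -> exists U F, [/\ open U, U z, smooth_on U F,
    (forall y, U y -> F y != 0) & (forall y, U y -> projm (F y) = pt (f y)) /\
    [/\ immersion_at F z, conformal_at F z, lagrangian_at F z & minimal_at F z]].
  move=> /mli[U [F [[oU Uz sF lF] geo]]]; exists U, F; split => //.
  - by move=> y /lF[].
  - by split; [move=> y /lF[F0 ->]; rewrite pt_line|exact: geo].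
split=> [k i j|z /H[U [F [oU Uz sF F0 [E [_ conf lag min]]]]]].
  apply: Ck_on_local => z /H[U [F [oU Uz sF F0 [E _]]]]; exists U; split => //.
  by apply: Ck_on_ext (smooth_pentry oU sF F0 k i j) => // y /E <-.
have [lam [s [t eqs]]] := projector_eqs_of_lift oU sF F0 Uz conf lag min.
exists lam, s, t; apply: projector_eqs_ext E _ eqs => // i j.
exact: (smooth_pentry oU sF F0 2 i j).
Qed.

(** A nonzero column of the projector is a lift of the line that is as smooth as the projector; this
    provides local lifts for a map known only through its projectors. *)
Lemma projm_col (F : 'rV[C]_3) (j : 'I_3) : F != 0 -> projm F j j != 0 ->
  let G : 'rV[C]_3 := \row_i projm F i j in
  [/\ G != 0, line G = line F & projm G = projm F].
Proof.
move=> F0 Fj.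
have fj0 : (F 0 j)^*%C / hdot F F != 0.
  by rewrite mulf_neq0 ?invr_neq0 ?hdot_neq0// fmorph_eq0; exact: proj_scale Fj.
have -> : \row_i projm F i j = ((F 0 j)^*%C / hdot F F) *: F.
  by apply/rowP => i; rewrite !mxE; ring.
by rewrite /= scaler_eq0 negb_or fj0 lineZ// projZ.
Qed.

Lemma open_neq0C : open [set x : V | x != 0].
Proof.
rewrite openE => x /= x0; apply/nbhs_ballP; exists `|x|; first by rewrite /= normr_gt0.
move=> w; rewrite -ball_normE /=; apply: contraTneq => ->.
by rewrite subr0 ltxx.
Qed.

Lemma mli_of_projector D f : open D ->
  (forall k i j, Ck_on k D (fun z => pt (f z) i j)) ->
  (forall z, D z -> exists lam, projector_eqs (fun y => pt (f y)) z lam 0 0) ->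
  minimal_lagrangian_immersion D f.
Proof.
move=> oD sm eqs z0 Dz0; have [u u0 fu] := CP2_line (f z0).
have [j uj] := nsq_diag u0.
have pj0 : pt (f z0) j j != 0.
  rewrite fu pt_line// mxE mulf_neq0 ?invr_neq0 ?hdot_neq0//.
  by rewrite mulf_neq0// fmorph_eq0.
pose U := D `&` [set z | pt (f z) j j != 0].
pose F z := \row_i pt (f z) i j.
have oU : open U.
  rewrite openE => z [Dz pz].
  have c : {for z, continuous (fun z => pt (f z) j j : V)} := Ck_on_continuous (sm 0 j j) Dz.
  apply: filterI; first exact: open_nbhs_nbhs.
  apply: (c [set x | x != 0]); apply: open_nbhs_nbhs; split => //.
  exact: open_neq0C.
have HF z : U z -> [/\ F z != 0, line (F z) = f z & projm (F z) = pt (f z)].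
  move=> [Dz pz]; have [g g0 fg] := CP2_line (f z).
  move: pz; rewrite /= fg pt_line// => pz.
  have -> : F z = \row_i projm g i j by rewrite /F fg pt_line.
  exact: projm_col.
have sF : smooth_on U F.
  move=> k i; apply: (Ck_on_ext (f := fun z => pt (f z) i j)) => //.
    by move=> z _; rewrite [RHS]mxE.
  by apply: Ck_on_sub (sm k i j) => z [].
exists U, F; split.
  by split => // z /HF[a b c]; split.
move=> z Uz; have [Dz _] := Uz.
have F0 y : U y -> F y != 0 by move=> /HF[].
have [lam e] := eqs z Dz.
apply: (lift_of_projector_eqs oU sF F0 Uz (lam := lam)).
have E y : U y -> pt (f y) = projm (F y) by move=> /HF[].
have sm2 i k : Ck_on 2 U (fun y => pt (f y) i k) by apply: Ck_on_sub (sm 2 i k) => y [].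
exact: (projector_eqs_ext oU Uz E sm2 e).
Qed.

End ProjectorMaps.

(** * The exponential coordinate *)

Section ExponentialMap.
Variable R : realType.
Local Notation C := R[i].
Local Notation V := (R[i]^o).
Implicit Types (U : set V) (h : V -> C) (v w z : V).

Lemma continuous_lift_re (g : R -> R) w :
  {for Re w, continuous g} -> {for w, continuous ((fun w => (g (Re w))%:C) : V -> V)}.
Proof.
move=> /cvgrPdist_lt cg; apply/continuous_complexP => e e0.
have [d /= d0 hd] := cg e e0; exists d => // y h1 _.
rewrite subrr normr0; split => //; rewrite distrC; apply: hd.
by rewrite /= distrC.
Qed.

Lemma continuous_re_comp (g : R -> R) h w : {for w, continuous (h : V -> V)} ->
  {for Re (h w), continuous g} -> {for w, continuous ((fun w => (g (Re (h w)))%:C) : V -> V)}.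
Proof.
by move=> ch cg; exact: (@continuous_comp V V V h (fun u : V => (g (Re u))%:C : V) w ch (continuous_lift_re cg)).
Qed.

Lemma continuous_lift_im (g : R -> R) w :
  {for Im w, continuous g} -> {for w, continuous ((fun w => (g (Im w))%:C) : V -> V)}.
Proof.
move=> /cvgrPdist_lt cg; apply/continuous_complexP => e e0.
have [d /= d0 hd] := cg e e0; exists d => // y _ h1.
rewrite subrr normr0; split => //; rewrite distrC; apply: hd.
by rewrite /= distrC.
Qed.

Lemma Ck_on_re k U h : open U -> Ck_on k U h -> Ck_on k U (fun z => (Re (h z))%:C).
Proof.
move=> oU Ch; apply: (Ck_on_ext (f := fun z => 2^-1 * (h z + (h z)^*%C))) => //.
  move=> z _; have -> : h z + (h z)^*%C = 2 * (Re (h z))%:C.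
    by apply: complexP; rewrite !re_imE /=; ring.
  by rewrite mulKf// pnatr_eq0.
apply: Ck_onM => //; first exact: Ck_on_cst.
by apply: Ck_onD => //; exact: Ck_on_conj.
Qed.

Lemma Ck_on_im k U h : open U -> Ck_on k U h -> Ck_on k U (fun z => (Im (h z))%:C).
Proof.
move=> oU Ch; apply: (Ck_on_ext (f := fun z => (Re (- 'i%C * h z))%:C)) => //.
  by move=> z _; congr (_%:C); rewrite !re_imE /=; ring.
by apply: Ck_on_re => //; apply: Ck_onM => //; exact: Ck_on_cst.
Qed.

Lemma is_cderive_line (z v : V) : is_cderive (fun t : R => z + t%:C *: v : C) 0 v.
Proof.
apply: is_cderive_eq (is_cderiveD (is_cderive_cst (z : C) 0)
  (is_cderiveM (is_cderive_real (is_derive_id (0 : R) 1)) (is_cderive_cst (v : C) 0))) _.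
by rewrite mulr0 addr0 add0r mul1r.
Qed.

Lemma line0 (z v : V) : z + (0 : R)%:C *: v = z.
Proof. by rewrite scale0r addr0. Qed.

Lemma chain_dir W U (g : V -> V) h v z : open W -> open U -> W z ->
  (forall z, W z -> U (g z)) -> Ck_on 1 W g -> Ck_on 1 U h ->
  is_cderive (fun t => h (g (z + t%:C *: v))) 0
    ((Re (rderive v g z))%:C * pdx h (g z) + (Im (rderive v g z))%:C * pdy h (g z)).
Proof.
move=> oW oU Wz gU Cg Ch.
have Ug : U (g (z + (0 : R)%:C *: v)) by rewrite line0; exact: gU.
by have := C1_chain oU Ch Ug (Ck_on_rderivable v Cg Wz); rewrite line0.
Qed.

Lemma Ck_on_le1 k U h : Ck_on k.+1 U h -> Ck_on 1 U h.
Proof. by elim: k h => // k IH h /Ck_onS /IH. Qed.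

Lemma Ck_on_comp k W U (g : V -> V) h : open W -> open U ->
  (forall z, W z -> U (g z)) -> (forall k, Ck_on k W g) -> Ck_on k U h ->
  Ck_on k W (fun z => h (g z)).
Proof.
move=> oW oU gU Cg; elim: k h => [|k IH] h Ch.
all: have c z : W z -> {for z, continuous ((fun z => h (g z)) : V -> V)}.
- 1,3: move=> Wz.
  1,2: apply: (@continuous_comp V V V g h z); first exact: (Ck_on_continuous (Cg 0%N) Wz).
  1,2: exact: (Ck_on_continuous Ch (gU z Wz)).
- by split.
apply: (Ck_onS_intro (dh := fun v z => (Re (rderive v g z))%:C * pdx h (g z) +
   (Im (rderive v g z))%:C * pdy h (g z))) => //.
- move=> v z Wz; apply: (chain_dir v oW oU Wz gU (Cg 1%N)).
  exact: Ck_on_le1 Ch.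
- move=> v; have Cd : Ck_on k W (rderive v g) by apply: Ck_on_rderive; exact: Cg.
  apply: Ck_onD => //; apply: Ck_onM => //.
  + exact: Ck_on_re.
  + by apply: IH; exact: Ck_on_rderive.
  + exact: Ck_on_im.
  + by apply: IH; exact: Ck_on_rderive.
Qed.

Lemma ii1 : 'i%C * 'i%C = -1 :> C.
Proof. by apply: complexP; rewrite !re_imE /=; ring. Qed.

(** The covering exp (i w) of the punctured plane, turning translations by reals into rotations. *)
Definition ew w : V := cexp ('i%C * w).

Lemma ewE w : ew w = (expR (- Im w))%:C * ((cos (Re w))%:C + 'i%C * (sin (Re w))%:C).
Proof.
rewrite /ew /cexp !re_imE /= !mul0r !mul1r sub0r add0r; congr (_ * _).
by apply: complexP; rewrite !re_imE /=; ring.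
Qed.

Lemma Re_ew w : Re (ew w) = expR (- Im w) * cos (Re w).
Proof. by rewrite ewE !re_imE /=; ring. Qed.
Lemma Im_ew w : Im (ew w) = expR (- Im w) * sin (Re w).
Proof. by rewrite ewE !re_imE /=; ring. Qed.

Lemma csq_ew w : csq (ew w) = expR (- Im w) ^+ 2.
Proof.
rewrite /csq Re_ew Im_ew !exprMn -mulrDr cos2Dsin2 mulr1 //.
Qed.

Lemma ew_neq0 w : ew w != 0.
Proof.
apply/eqP => e; have := csq_ew w; rewrite e /csq /= expr0n addr0 => /esym/eqP.
by rewrite sqrf_eq0 gt_eqF// expR_gt0.
Qed.

Lemma is_cderive_ew (c : R -> V) t c' : is_cderive c t c' ->
  is_cderive (fun s => ew (c s)) t ('i%C * c' * ew (c t)).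
Proof.
move=> [hr hi].
have he : is_derive t 1 (fun s => expR (- Im (c s))) (- Im c' * expR (- Im (c t))).
  have h1 : is_derive t 1 (fun s => - Im (c s)) (- Im c') by exact: is_deriveN.
  have := is_derive_comp1 (f := expR) h1 (is_derive_expR (- Im (c t))).
  by rewrite mulrC.
have hc := is_derive_comp1 (f := @cos R) hr (is_derive_cos (Re (c t))).
have hs := is_derive_comp1 (f := @sin R) hr (is_derive_sin (Re (c t))).
have H := is_cderiveM (is_cderive_real he)
  (is_cderiveD (is_cderive_real hc) (is_cderiveZ 'i%C (is_cderive_real hs))).
apply: is_cderive_ext; last apply: is_cderive_eq H _.
  by move=> s; rewrite ewE.
by rewrite ewE; apply: complexP; rewrite !re_imE /=; ring.
Qed.

Lemma continuous_ew w : {for w, continuous (ew : V -> V)}.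
Proof.
have -> : (ew : V -> V) = (fun w => (expR (- Im w))%:C * ((cos (Re w))%:C + 'i%C * (sin (Re w))%:C)).
  by apply/funext => y; rewrite ewE.
apply: (@cvgM R[i] _ (nbhs w)).
  apply: (@continuous_lift_im (fun x => expR (- x)) w).
  apply: (@continuous_comp R R R (fun x => - x)); first exact: opp_continuous.
  exact: continuous_expR.
apply: (@cvgD _ R[i]^o _ (nbhs w)); first exact/continuous_lift_re/continuous_cos.
apply: (@cvgM R[i] _ (nbhs w)); first exact: cvg_cst.
exact/continuous_lift_re/continuous_sin.
Qed.

Lemma smooth_ew k : Ck_on k setT ew.
Proof.
elim: k => [|k IH]; first by split => // z _; exact: continuous_ew.
apply: (Ck_onS_intro (dh := fun v w => 'i%C * v * ew w)); first exact: openT.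
- by move=> z _; exact: continuous_ew.
- move=> v z _; have := is_cderive_ew (is_cderive_line z v).
  by rewrite line0.
- by move=> v; apply: Ck_onM; [exact: openT|exact/Ck_on_cst/openT|].
Qed.

Lemma rderive_ew v w : rderive v ew w = 'i%C * v * ew w.
Proof.
apply: is_cderive_unique (Ck_on_rderivable v (smooth_ew 1) I) _.
by have := is_cderive_ew (is_cderive_line w v); rewrite line0.
Qed.

Section Pullback.
Variables (U S : set V) (h : V -> C).
Hypotheses (oU : open U) (oS : open S) (SU : forall w, S w -> U (ew w)).

Lemma rderive_pullback v w : Ck_on 1 U h -> S w ->
  rderive v (fun w => h (ew w)) w =
  (Re ('i%C * v * ew w))%:C * pdx h (ew w) + (Im ('i%C * v * ew w))%:C * pdy h (ew w).
Proof.
move=> Ch Sw; have CS : Ck_on 1 S ew by apply: Ck_on_sub (smooth_ew 1).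
have := chain_dir v oS oU Sw SU CS Ch; rewrite rderive_ew => H.
apply: is_cderive_unique (Ck_on_rderivable (k := 0) v _ Sw) H.
by apply: (Ck_on_comp (k := 1) oS oU SU _ Ch) => k; exact: Ck_on_sub (smooth_ew k).
Qed.

Lemma rderive2_pullback v w : Ck_on 2 U h -> S w ->
  rderive v (rderive v (fun w => h (ew w))) w =
  let b := 'i%C * v * ew w in let b' := 'i%C * v * b in
  (Re b')%:C * pdx h (ew w) + (Im b')%:C * pdy h (ew w) +
  (Re b)%:C * ((Re b)%:C * pdx (pdx h) (ew w) + (Im b)%:C * pdy (pdx h) (ew w)) +
  (Im b)%:C * ((Re b)%:C * pdx (pdy h) (ew w) + (Im b)%:C * pdy (pdy h) (ew w)).
Proof.
move=> Ch Sw; set b := 'i%C * v * ew w; set b' := 'i%C * v * b => /=.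
have Sk k : Ck_on k S ew by exact: Ck_on_sub (smooth_ew k).
have C1 : Ck_on 1 U h by exact: Ck_onS.
have CS : Ck_on 2 S (fun w => h (ew w)) by exact: (Ck_on_comp oS oU SU Sk Ch).
apply: is_cderive_unique (Ck_on_rderivable v (Ck_on_rderive v CS) Sw) _.
have E y : S y -> (Re ('i%C * v * ew y))%:C * pdx h (ew y) +
    (Im ('i%C * v * ew y))%:C * pdy h (ew y) = rderive v (fun w => h (ew w)) y.
  by move=> Sy; rewrite rderive_pullback.
apply: (rderive_local (v := v) oS Sw E).
have hb : is_cderive (fun t => 'i%C * v * ew (w + t%:C *: v)) 0 b'.
  have := is_cderive_ew (is_cderive_line w v); rewrite line0 => H.
  exact: is_cderiveZ H.
have [hbr hbi] := hb.
have hx := chain_dir v oS oU Sw SU (Sk 1%N) (Ck_on_rderive (1 : V) Ch).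
have hy := chain_dir v oS oU Sw SU (Sk 1%N) (Ck_on_rderive ('i%C : V) Ch).
rewrite rderive_ew -/b in hx hy.
have := is_cderiveD (is_cderiveM (is_cderive_real hbr) hx) (is_cderiveM (is_cderive_real hbi) hy).
rewrite /= line0 -/b => H; apply: is_cderive_eq H _.
by rewrite -/(pdx h) -/(pdy h) addrACA addrA.
Qed.

Lemma re_i1 (e : C) : (Re ('i%C * 1 * e) = - Im e) * (Im ('i%C * 1 * e) = Re e).
Proof. by case: e => a b; split; rewrite !re_imE /=; ring. Qed.

Lemma re_ii (e : C) : (Re ('i%C * 'i%C * e) = - Re e) * (Im ('i%C * 'i%C * e) = - Im e).
Proof. by case: e => a b; split; rewrite !re_imE /=; ring. Qed.

Lemma realcN (r : R) : (- r)%:C = - r%:C.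
Proof. by apply: complexP; rewrite !re_imE /= ?oppr0. Qed.

(** The directions 1 and i move exp (i w) = e along i e and - e, orthogonal vectors of equal length;
    the first order terms and the mixed second derivatives cancel between the two. *)
Lemma complex_laplacian_algebra (e x y xx yx xy yy : C) :
  (Re ('i%C * 1 * ('i%C * 1 * e)))%:C * x + (Im ('i%C * 1 * ('i%C * 1 * e)))%:C * y +
  (Re ('i%C * 1 * e))%:C * ((Re ('i%C * 1 * e))%:C * xx + (Im ('i%C * 1 * e))%:C * yx) +
  (Im ('i%C * 1 * e))%:C * ((Re ('i%C * 1 * e))%:C * xy + (Im ('i%C * 1 * e))%:C * yy) +
  ((Re ('i%C * 'i%C * ('i%C * 'i%C * e)))%:C * x + (Im ('i%C * 'i%C * ('i%C * 'i%C * e)))%:C * y +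
  (Re ('i%C * 'i%C * e))%:C * ((Re ('i%C * 'i%C * e))%:C * xx + (Im ('i%C * 'i%C * e))%:C * yx) +
  (Im ('i%C * 'i%C * e))%:C * ((Re ('i%C * 'i%C * e))%:C * xy + (Im ('i%C * 'i%C * e))%:C * yy)) =
  (csq e)%:C * (xx + yy).
Proof.
case: e => a b.
rewrite !ii1 !mulr1 !mulN1r !opprK.
have r1 : 'i%C * (a +i* b) = (- b) +i* a by apply: complexP; rewrite !re_imE /=; ring.
have r2 : 'i%C * ((- b) +i* a) = (- a) +i* (- b) by apply: complexP; rewrite !re_imE /=; ring.
rewrite !r1 !r2 /csq.
have -> : Re (- (a +i* b)) = - a by [].
have -> : Im (- (a +i* b)) = - b by [].
rewrite /= !expr2 realcD !realcM.
rewrite !realcN; move: (a%:C) (b%:C) => {r1 r2} a' b'; ring.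
Qed.

Lemma laplacian_pullback w : Ck_on 2 U h -> S w ->
  pdx (pdx (fun w => h (ew w))) w + pdy (pdy (fun w => h (ew w))) w =
  (csq (ew w))%:C * (pdx (pdx h) (ew w) + pdy (pdy h) (ew w)).
Proof.
move=> Ch Sw.
have h1 := rderive2_pullback (1 : V) Ch Sw; have h2 := rderive2_pullback ('i%C : V) Ch Sw.
exact: (etrans (congr2 +%R h1 h2) (complex_laplacian_algebra (ew w) _ _ _ _ _ _)).
Qed.

End Pullback.

Lemma mdot_comb (P Q : 'M[C]_3) (a b c d : R) :
  mdot (a%:C *: P + b%:C *: Q) (c%:C *: P + d%:C *: Q) =
  a * c * mdot P P + b * d * mdot Q Q + (a * d + b * c) * mdot P Q.
Proof.
rewrite /mdot !mulr_sumr -!big_split /=; apply: eq_bigr => i _.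
rewrite !mulr_sumr -!big_split /=; apply: eq_bigr => j _.
by rewrite !mxE !re_imE /=; ring.
Qed.

Lemma tangential_algebra (a b lam s t : R) (x y q d : C) :
  (a ^+ 2 + b ^+ 2)%:C * ((2 * lam)%:C * (d - 3 * q) + s%:C * y + t%:C * x) =
  (2 * (lam * (a ^+ 2 + b ^+ 2)))%:C * (d - 3 * q) +
  (- b * s + a * t)%:C * ((- b)%:C * y + a%:C * x) +
  (- a * s - b * t)%:C * ((- a)%:C * y + (- b)%:C * x).
Proof. by rewrite !(realcD, realcM, realcN, expr2); ring. Qed.

(** Conformal invariance: a holomorphic change of variable multiplies the Laplacian and the squared
    lengths by the same factor [csq (ew w)], the squared modulus of its derivative, and rotates the
    tangential terms. *)
Lemma projector_eqs_pullback U S (p : V -> 'M[C]_3) w lam s t :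
  open U -> open S -> (forall w, S w -> U (ew w)) ->
  (forall i j, Ck_on 2 U (fun z => p z i j)) -> S w ->
  projector_eqs p (ew w) lam s t ->
  exists s' t', projector_eqs (fun w => p (ew w)) w (lam * csq (ew w)) s' t'.
Proof.
move=> oU oS SU Cp Sw [l0 m1 m2 m12 L].
have C1 i j : Ck_on 1 U (fun z => p z i j) by exact: Ck_onS.
have n0 : 0 < csq (ew w) by rewrite csq_ew exprn_gt0// expR_gt0.
have pmE v : pmx (fun w => p (ew w)) v w =
   (Re ('i%C * v * ew w))%:C *: pmx p (1 : V) (ew w) +
   (Im ('i%C * v * ew w))%:C *: pmx p ('i%C : V) (ew w).
  apply/matrixP => i j; rewrite ![in RHS]mxE [LHS]mxE.
  exact: (rderive_pullback oU oS SU v (C1 i j) Sw).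
pose a := Re (ew w); pose b := Im (ew w).
have px : pmx (fun w => p (ew w)) (1 : V) w =
   (- b)%:C *: pmx p (1 : V) (ew w) + a%:C *: pmx p ('i%C : V) (ew w).
  by rewrite pmE; congr (_%:C *: _ + _%:C *: _); rewrite ?re_i1 ?re_ii.
have py : pmx (fun w => p (ew w)) ('i%C : V) w =
   (- a)%:C *: pmx p (1 : V) (ew w) + (- b)%:C *: pmx p ('i%C : V) (ew w).
  by rewrite pmE; congr (_%:C *: _ + _%:C *: _); rewrite ?re_i1 ?re_ii.
have nE : csq (ew w) = a ^+ 2 + b ^+ 2 by [].
exists (- b * s + a * t), (- a * s - b * t); split.
- exact: mulr_gt0.
- by rewrite px mdot_comb m1 m2 m12 nE; ring.
- by rewrite py mdot_comb m1 m2 m12 nE; ring.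
- by rewrite px py mdot_comb m1 m2 m12; ring.
- move=> i j; rewrite (laplacian_pullback oU oS SU (Cp i j) Sw) L px py nE.
  rewrite !mxE; exact: tangential_algebra.
Qed.

Lemma similarity_solve (a b n : R) (P Q A B : 'M[C]_3) : n = a ^+ 2 + b ^+ 2 -> n != 0 ->
  A = (- b)%:C *: P + a%:C *: Q -> B = (- a)%:C *: P + (- b)%:C *: Q ->
  P = (- b / n)%:C *: A + (- a / n)%:C *: B /\ Q = (a / n)%:C *: A + (- b / n)%:C *: B.
Proof.
move=> nE n0 -> ->.
have k1 : (n^-1)%:C * (a%:C * a%:C + b%:C * b%:C) = 1 :> C.
  by rewrite -!realcM -realcD -realcM -!expr2 -nE mulVf.
split; apply/matrixP => i j; rewrite !(mxE, realcM, realcN); move: k1;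
  move: (n^-1)%:C (a%:C) (b%:C) (P i j) (Q i j) => k a' b' x y k1.
- by transitivity (k * (a' * a' + b' * b') * x); [rewrite k1 mul1r|ring].
- by transitivity (k * (a' * a' + b' * b') * y); [rewrite k1 mul1r|ring].
Qed.

Lemma divide_equation (n rho : R) (x d u v u' v' : C) : n != 0 ->
  n%:C * x = (2 * rho)%:C * d + 0%:C * u + 0%:C * v ->
  x = (2 * (rho / n))%:C * d + 0%:C * u' + 0%:C * v'.
Proof.
rewrite !mul0r !addr0 => n0 e; have nC : n%:C != 0 by rewrite fmorph_eq0.
have E : (2 * rho)%:C = n%:C * (2 * (rho / n))%:C by rewrite -realcM; congr (_%:C); field.
by rewrite -[x](mulKf nC) e E -mulrA mulKf.
Qed.

(** The differential of the covering is a similarity, so the first derivatives of [p] are solved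
    from those of the pullback and the scaling is undone. *)
Lemma projector_eqs_pushforward U S (p : V -> 'M[C]_3) w rho :
  open U -> open S -> (forall w, S w -> U (ew w)) ->
  (forall i j, Ck_on 2 U (fun z => p z i j)) -> S w ->
  projector_eqs (fun w => p (ew w)) w rho 0 0 ->
  projector_eqs p (ew w) (rho / csq (ew w)) 0 0.
Proof.
move=> oU oS SU Cp Sw [l0 m1 m2 m12 L].
have C1 i j : Ck_on 1 U (fun z => p z i j) by exact: Ck_onS.
have n0 : 0 < csq (ew w) by rewrite csq_ew exprn_gt0// expR_gt0.
have pmE v : pmx (fun w => p (ew w)) v w =
   (Re ('i%C * v * ew w))%:C *: pmx p (1 : V) (ew w) +
   (Im ('i%C * v * ew w))%:C *: pmx p ('i%C : V) (ew w).
  apply/matrixP => i j; rewrite ![in RHS]mxE [LHS]mxE.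
  exact: (rderive_pullback oU oS SU v (C1 i j) Sw).
pose a := Re (ew w); pose b := Im (ew w); pose n := csq (ew w).
have nE : n = a ^+ 2 + b ^+ 2 by [].
have nn0 : n != 0 by rewrite gt_eqF.
have nn1 : a ^+ 2 + b ^+ 2 != 0 by rewrite -nE.
pose X := pmx (fun w => p (ew w)) (1 : V) w; pose Y := pmx (fun w => p (ew w)) ('i%C : V) w.
have [] := similarity_solve (P := pmx p (1 : V) (ew w)) (Q := pmx p ('i%C : V) (ew w)) (A := X) (B := Y) nE nn0.
- by rewrite /X pmE; congr (_%:C *: _ + _%:C *: _); rewrite ?re_i1 ?re_ii.
- by rewrite /Y pmE; congr (_%:C *: _ + _%:C *: _); rewrite ?re_i1 ?re_ii.
move=> P1 P2; split.
- exact: divr_gt0.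
- by rewrite P1 mdot_comb m1 m2 m12 -/n nE; field.
- by rewrite P2 mdot_comb m1 m2 m12 -/n nE; field.
- by rewrite P1 P2 mdot_comb m1 m2 m12 -/n nE; field.
- move=> i j.
  have e1 := esym (laplacian_pullback oU oS SU (Cp i j) Sw).
  have e := etrans e1 (L i j).
  apply: (divide_equation _ _ nn0 e).
Qed.

Lemma ewD w1 w2 : ew (w1 + w2) = ew w1 * ew w2.
Proof.
rewrite !ewE; case: w1 w2 => [a b] [c d] /=; rewrite opprD expRD cosD sinD.
by rewrite !(realcB, realcD, realcM); move: (expR _)%:C (expR _)%:C (cos a)%:C (cos c)%:C
  (sin a)%:C (sin c)%:C => p q x y s t; rewrite -[X in _ - X]mul1r -[X in _ - X * _]opprK -ii1; ring.
Qed.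

Lemma ew_translation t w : ew (translation t w) = rotation t (ew w).
Proof. by rewrite /translation addrC ewD. Qed.

Lemma ew_surj z : z != 0 -> exists w, ew w = z.
Proof.
case: z => a b z0.
have n0 : 0 < a ^+ 2 + b ^+ 2.
  rewrite lt_neqAle eq_sym addr_ge0 ?sqr_ge0// andbT; apply: contra z0.
  by rewrite paddr_eq0 ?sqr_ge0// !sqrf_eq0 => /andP[/eqP -> /eqP ->].
pose r := Num.sqrt (a ^+ 2 + b ^+ 2).
have r0 : 0 < r by rewrite sqrtr_gt0.
have r2 : r ^+ 2 = a ^+ 2 + b ^+ 2 by rewrite sqr_sqrtr// ltW.
pose c := a / r; have c2 : 1 - c ^+ 2 = (b / r) ^+ 2.
  by rewrite /c !expr_div_n r2; field; rewrite gt_eqF.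
have hc : -1 <= c <= 1.
  by rewrite -ler_norml -(@ler_sqr _ `|c| 1) ?nnegrE// expr1n real_normK ?num_real// -subr_ge0 c2 sqr_ge0.
pose th := if 0 <= b then acos c else - acos c.
exists (th +i* (- ln r)); rewrite ewE /= opprK lnK ?posrE//.
have ct : cos th = a / r by rewrite /th; case: ifP => _; rewrite ?cosN acosK ?in_itv.
have st : sin th = b / r.
  rewrite /th; case: ifP => b0; rewrite ?sinN sin_acos// c2 sqrtr_sqr.
    by rewrite ger0_norm// divr_ge0// ltW.
  rewrite ler0_norm ?opprK// ler_pdivrMr// mul0r ltW//.
  by rewrite ltNge b0.
rewrite ct st; apply: complexP; rewrite !re_imE /=; field; exact: lt0r_neq0.
Qed.

(** The difference d = x - y satisfies cos d = 1. Reduced modulo 2 pi to [0, 2 pi), it must be 0, by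
    injectivity of cos on [0, pi] applied to the remainder or to 2 pi minus it. *)
Lemma cos_sin_periodic (T : Type) (g : R -> T) (x y : R) :
  (forall x, g (x + 2 * pi) = g x) -> cos x = cos y -> sin x = sin y -> g x = g y.
Proof.
have perz (T' : Type) (g' : R -> T') : (forall x, g' (x + 2 * pi) = g' x) ->
    forall (n : int) x, g' (x + n%:~R * (2 * pi)) = g' x.
  move=> gp; have pn (n : nat) : forall x, g' (x + n%:R * (2 * pi)) = g' x.
    elim: n => [|n IH] u; first by rewrite mul0r addr0.
    by rewrite -natr1 mulrDl mul1r addrA gp IH.
  case=> [n|n] u; first exact: pn.
  by rewrite NegzE rmorphN /= mulNr -(pn n.+1 (_ - _)) addrNK.
move=> gp hc hs; pose d := x - y.
have p0 : 0 < 2 * pi :> R by rewrite mulr_gt0// pi_gt0.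
have cd : cos d = 1.
  by rewrite /d cosD cosN sinN hc hs mulrN opprK -!expr2 cos2Dsin2.
pose k := Num.floor (d / (2 * pi)); pose d' := d - k%:~R * (2 * pi).
have cd' : cos d' = 1.
  rewrite -cd -[d](subrK (k%:~R * (2 * pi))) -/d' perz// => u.
  by rewrite mulrC -[2]/(1 *+ 2) mulr_natr cosD2pi.
have d'0 : 0 <= d'.
  by rewrite subr_ge0 -ler_pdivlMr// floor_le.
have d'1 : d' < 2 * pi.
  by have := floorD1_gt (d / (2 * pi)); rewrite -/k rmorphD /= ltr_pdivrMr// mulrDl mul1r /d' => h; rewrite ltrBlDr addrC.
have dz : d' = 0.
  case: (leP d' pi) => hp.
    by apply: cos_inj; rewrite ?in_itv/= ?d'0 ?lexx ?pi_ge0// cd' cos0.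
  have : 2 * pi - d' = 0.
    apply: cos_inj; rewrite ?in_itv/= ?lexx ?pi_ge0//.
      by rewrite subr_ge0 ltW// lerBlDr; lra.
    transitivity (cos d'); last by rewrite cd' cos0.
    rewrite -cosN opprB -(perz _ (@cos R) _ 1 (d' - _)); last first.
      by move=> u; rewrite mulrC mulr_natr cosD2pi.
    by rewrite mul1r subrK.
  lra.
have -> : x = y + k%:~R * (2 * pi).
  by have := dz; rewrite /d' /d => /eqP; rewrite subr_eq add0r subr_eq addrC => /eqP.
by rewrite perz.
Qed.

Lemma ew_eq w w' : ew w = ew w' ->
  [/\ Im w = Im w', cos (Re w) = cos (Re w') & sin (Re w) = sin (Re w')].
Proof.
move=> e; have h := congr1 (@csq R) e; move: h; rewrite !csq_ew => /eqP.
rewrite eqrXn2 ?expR_ge0// => /eqP h.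
have hI : Im w = Im w' by apply/oppr_inj/expR_inj.
have E0 : expR (- Im w') != 0 by rewrite gt_eqF// expR_gt0.
split => //; apply: (mulfI E0).
  by have := congr1 (@complex.Re R) e; rewrite !Re_ew hI.
by have := congr1 (@complex.Im R) e; rewrite !Im_ew hI.
Qed.

Lemma is_derive_logabs (x y : R -> R) (t x' y' : R) :
  is_derive t 1 x x' -> is_derive t 1 y y' -> 0 < x t ->
  is_derive t 1 (fun s => 2^-1 * ln (x s ^+ 2 + y s ^+ 2))
    ((x t * x' + y t * y') / (x t ^+ 2 + y t ^+ 2)).
Proof.
move=> hx hy x0; have n0 : 0 < x t ^+ 2 + y t ^+ 2 by rewrite ltr_pwDl ?exprn_gt0 ?sqr_ge0.
have hn : is_derive t 1 (fun s => x s ^+ 2 + y s ^+ 2) (2 * (x t * x' + y t * y')).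
  apply: (@is_derive_eq _ _ _ _ _ _ _ _
    (@is_deriveD _ _ _ _ _ _ _ _ _ (is_deriveM' hx hx) (is_deriveM' hy hy))).
  by ring.
have hl := is_derive_comp1 (f := @ln R) (g := fun s => x s ^+ 2 + y s ^+ 2) hn (is_derive1_ln n0).
have hc : is_derive t 1 (fun=> 2^-1 : R) (0 : R) by exact: is_derive_cst.
apply: (@is_derive_eq _ _ _ _ _ _ _ _ (is_deriveM' hc hl)).
by field; rewrite gt_eqF.
Qed.

Lemma is_derive_arg (x y : R -> R) (t x' y' : R) :
  is_derive t 1 x x' -> is_derive t 1 y y' -> 0 < x t ->
  is_derive t 1 (fun s => atan (y s / x s))
    ((x t * y' - y t * x') / (x t ^+ 2 + y t ^+ 2)).
Proof.
move=> hx hy x0; have n0 : 0 < x t ^+ 2 + y t ^+ 2 by rewrite ltr_pwDl ?exprn_gt0 ?sqr_ge0.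
have xn : x t != 0 by rewrite gt_eqF.
have hv : is_derive t 1 (fun s => (x s)^-1) (- x' / x t ^+ 2).
  apply: DeriveDef; first by apply: derivableV => //; exact: ex_derive.
  by rewrite deriveV//= derive_val /GRing.scale /= mulrC mulNr mulrN.
apply: (@is_derive_eq _ _ _ _ _ _ _ _
  (is_derive_comp1 (f := @atan R) (is_deriveM' hy hv) (is_derive1_atan _))).
field.
by rewrite ?gt_eqF.
Qed.

Lemma log_derivative_algebra (z v : C) : 0 < Re z ->
  ((Re z * Re v + Im z * Im v) / (Re z ^+ 2 + Im z ^+ 2))%:C +
  'i%C * ((Re z * Im v - Im z * Re v) / (Re z ^+ 2 + Im z ^+ 2))%:C = v * z^-1.
Proof.
case: z v => a b [c d] /= a0.
have n0 : a ^+ 2 + b ^+ 2 != 0 by rewrite gt_eqF// ltr_pwDl ?exprn_gt0 ?sqr_ge0.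
by apply: complexP; rewrite !re_imE /=; field.
Qed.

Definition right_half : set V := [set z | 0 < Re z].

Definition log1 (z : V) : V := (2^-1 * ln (csq z))%:C + 'i%C * (atan (Im z / Re z))%:C.

Lemma ew_log1 z : right_half z -> ew (- 'i%C * log1 z) = z.
Proof.
case: z => a b; rewrite /right_half /= => a0.
have n0 : 0 < a ^+ 2 + b ^+ 2 by rewrite ltr_pwDl ?exprn_gt0 ?sqr_ge0.
have s0 : 0 < Num.sqrt (a ^+ 2 + b ^+ 2) by rewrite sqrtr_gt0.
have [er ei] : Re (- 'i%C * log1 (a +i* b)) = atan (b / a) /\
    - Im (- 'i%C * log1 (a +i* b)) = 2^-1 * ln (a ^+ 2 + b ^+ 2).
  by rewrite /log1 !re_imE /=; split; ring.
rewrite ewE er ei.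
have -> : expR (2^-1 * ln (a ^+ 2 + b ^+ 2)) = Num.sqrt (a ^+ 2 + b ^+ 2).
  apply/eqP; rewrite -(@eqrXn2 _ 2)// ?expR_ge0 ?sqrtr_ge0// sqr_sqrtr ?(ltW n0)//.
  by rewrite -expRM_natl mulrA divff ?mul1r ?lnK// pnatr_eq0.
have ct : cos (atan (b / a)) = a / Num.sqrt (a ^+ 2 + b ^+ 2).
  rewrite cos_atan; have -> : 1 + (b / a) ^+ 2 = (a ^+ 2 + b ^+ 2) / a ^+ 2.
    by rewrite expr_div_n; field; rewrite gt_eqF.
  by rewrite sqrtrM ?(ltW n0)// sqrtrV ?sqr_ge0// sqrtr_sqr gtr0_norm// invfM invrK mulrC.
have st : sin (atan (b / a)) = b / Num.sqrt (a ^+ 2 + b ^+ 2).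
  have := atanK (b / a); rewrite /tan ct => /(congr1 (fun u => u * (a / Num.sqrt (a ^+ 2 + b ^+ 2)))).
  rewrite divfK ?mulf_neq0 ?invr_eq0 ?gt_eqF// => ->.
  by rewrite mulrA divfK// gt_eqF.
by rewrite ct st; apply: complexP; rewrite !re_imE /=; field; rewrite gt_eqF.
Qed.

Lemma open_right_half : open right_half.
Proof.
rewrite openE => z z0; apply/nbhs_ballP; exists (Re z)%:C; first by rewrite /= ltcR.
move=> w; rewrite -ball_normE /= => /normc_ltP[+ _]; rewrite /right_half /= => h.
have {h} : `|Re z - Re w| < Re z by move: h; case: (z) (w) => a b [c d].
by move=> /ltr_normlW; rewrite gtrBl.
Qed.

Lemma smooth_id k U : open U -> Ck_on k U (id : V -> V).
Proof.
case: k => [|k] oU; first by split => // z _; exact: cvg_id.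
apply: (Ck_onS_intro (dh := fun v _ => v)) => //.
- by move=> z _; exact: cvg_id.
- by move=> v z _; exact: is_cderive_line.
- by move=> v; exact: Ck_on_cst.
Qed.

(** The derivative in direction [v] is v / z, already known to be smooth, so continuity and this one
    formula settle every order. *)
Lemma smooth_log1 k : Ck_on k right_half log1.
Proof.
have oH := open_right_half.
have cl z : right_half z -> {for z, continuous (log1 : V -> V)}.
  move=> Hz; have Hz' : 0 < Re z by [].
  have cn : {for z, continuous ((fun z : V => z * (z)^*%C) : V -> V)}.
    apply: (Ck_on_continuous (U := setT) (k := 0) _ I).
    apply: Ck_onM; [exact: openT|exact/smooth_id/openT|].
    by apply: Ck_on_conj; [exact: openT|exact/smooth_id/openT].
  have cq : {for z, continuous ((fun z : V => (Im z)%:C * ((Re z)%:C)^-1) : V -> V)}.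
    apply: (Ck_on_continuous (U := right_half) (k := 0) _ Hz).
    apply: Ck_onM; [exact: oH|exact: Ck_on_im oH (smooth_id 0 oH)|].
    apply: Ck_onV; [exact: oH| |exact: Ck_on_re oH (smooth_id 0 oH)].
    by move=> u u0; rewrite fmorph_eq0 gt_eqF.
  have nE (u : V) : Re (u * (u)^*%C) = csq u by case: u => a b; rewrite /csq /=; ring.
  have c1 : {for z, continuous ((fun z => (2^-1 * ln (csq z))%:C) : V -> V)}.
    have -> : ((fun z => (2^-1 * ln (csq z))%:C) : V -> V) = fun z => (2^-1 * ln (Re (z * (z)^*%C)))%:C.
      by apply/funext => u; rewrite nE.
    apply: (continuous_re_comp (g := fun x => 2^-1 * ln x) cn).
    apply: (@cvgM R _ (nbhs _)); first exact: cvg_cst.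
    apply: continuous_ln; rewrite nE /csq.
    by rewrite ltr_pwDl ?exprn_gt0 ?sqr_ge0.
  have c2 : {for z, continuous ((fun z => (atan (Im z / Re z))%:C) : V -> V)}.
    have -> : ((fun z => (atan (Im z / Re z))%:C) : V -> V) = fun z => (atan (Re ((Im z)%:C * ((Re z)%:C)^-1)))%:C.
      by apply/funext => u; rewrite -realcV -realcM.
    by apply: (continuous_re_comp (g := @atan R) cq); exact: continuous_atan.
  apply: (@cvgD _ R[i]^o _ (nbhs z)); first exact: c1.
  by apply: (@cvgM R[i] _ (nbhs z)); [exact: cvg_cst|exact: c2].
case: k => [|k]; first by split.
apply: (Ck_onS_intro (dh := fun v z => v * z^-1) oH cl).
- move=> v z Hz; have [hr hi] := is_cderive_line z v.
  have a0 : 0 < Re (z + (0 : R)%:C *: v) by rewrite line0.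
  have H := is_cderiveD (is_cderive_real (is_derive_logabs hr hi a0))
    (is_cderiveZ 'i%C (is_cderive_real (is_derive_arg hr hi a0))).
  by apply: is_cderive_eq H _; rewrite line0; exact: log_derivative_algebra.
- move=> v; apply: Ck_onM => //; first exact: Ck_on_cst.
  apply: Ck_onV => //; last exact: smooth_id.
  by move=> z z0; apply: contraTneq z0 => ->; rewrite /right_half /= ltxx.
Qed.

(** Near [z0 = ew w0] the covering has the smooth local inverse w0 - i log (z / z0), defined where
    [z / z0] lies in the right half plane. *)
Lemma smooth_of_pullback k (h : V -> C) :
  Ck_on k setT (fun w => h (ew w)) -> Ck_on k (punctured_plane R) h.
Proof.
move=> Ch; apply: Ck_on_local => z0 /= z00.
have [w0 e0] := ew_surj z00.
have oH := open_right_half.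
have ci j (W : set V) : open W -> Ck_on j W (fun z : V => z / z0 : V).
  by move=> oW; apply: Ck_onM; [exact: oW|exact: smooth_id|exact: Ck_on_cst].
pose U : set V := (fun z : V => z / z0 : V) @^-1` right_half.
have oU : open U.
  apply: open_comp oH => z _.
  exact: (Ck_on_continuous (ci 0%N setT openT) I).
have Cg j : Ck_on j U (fun z : V => w0 + - 'i%C * log1 (z / z0) : V).
  apply: Ck_onD; [exact: oU|exact: Ck_on_cst|].
  apply: Ck_onM; [exact: oU|exact: Ck_on_cst|].
  apply: (Ck_on_comp oU oH) (smooth_log1 j); first by move=> z.
  by move=> j'; exact: ci.
exists U; split; first exact: oU.
- by rewrite /U /= divff// /right_half /= ltr01.
- apply: (Ck_on_ext oU _ (Ck_on_comp oU openT _ Cg Ch)); last by [].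
  by move=> z Uz /=; rewrite ewD e0 ew_log1// mulrC divfK.
Qed.

End ExponentialMap.

(** * Projectors as real vectors *)

Section VectorCalculus.
Variables (R : realType).
Implicit Types (t : R).

Definition is_vderive n (u : R -> 'rV[R]_n) t (du : 'rV[R]_n) : Prop :=
  forall j, is_derive t 1 (fun s => u s 0 j) (du 0 j).

Lemma is_derive_eqv (f : R -> R) t (a b : R) : a = b -> is_derive t 1 f a -> is_derive t 1 f b.
Proof. by move=> ->. Qed.

Lemma is_derive_sumf n (f : 'I_n -> R -> R) t (df : 'I_n -> R) :
  (forall i, is_derive t 1 (f i) (df i)) ->
  is_derive t 1 (fun s => \sum_(i < n) f i s) (\sum_(i < n) df i).
Proof.
move=> H; have -> : (fun s => \sum_(i < n) f i s) = \sum_(i < n) f i.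
  by apply/funext => s; rewrite fct_sumE.
exact: is_derive_sum.
Qed.

Lemma is_derive_scale (f : R -> R) t c (a : R) : is_derive t 1 f a ->
  is_derive t 1 (fun s => c * f s) (c * a).
Proof.
move=> h; have hc : is_derive t 1 (fun=> c) (0 : R) by exact: is_derive_cst.
by apply: is_derive_eqv (is_deriveM' hc h); rewrite mul0r add0r.
Qed.

Lemma is_derive_uniq (f : R -> R) t (a b : R) : is_derive t 1 f a -> is_derive t 1 f b -> a = b.
Proof. by move=> [_ <-] [_ <-]. Qed.

Section Dim.
Variable n : nat.
Implicit Types (u v : R -> 'rV[R]_n) (x y z : 'rV[R]_n).

Definition dot x y : R := \sum_j x 0 j * y 0 j.

Lemma dotC x y : dot x y = dot y x.
Proof. by apply: eq_bigr => j _; rewrite mulrC. Qed.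

Lemma dotDl x y z : dot (x + y) z = dot x z + dot y z.
Proof. by rewrite -big_split; apply: eq_bigr => j _; rewrite mxE mulrDl. Qed.

Lemma dotZl (c : R) x y : dot (c *: x) y = c * dot x y.
Proof. by rewrite /dot mulr_sumr; apply: eq_bigr => j _; rewrite mxE mulrA. Qed.

Lemma dotNl x y : dot (- x) y = - dot x y.
Proof. by rewrite -scaleN1r dotZl mulN1r. Qed.

Lemma dotDr x y z : dot z (x + y) = dot z x + dot z y.
Proof. by rewrite dotC dotDl !(dotC z). Qed.

Lemma dotZr (c : R) x y : dot x (c *: y) = c * dot x y.
Proof. by rewrite dotC dotZl dotC. Qed.

Lemma dotNr x y : dot x (- y) = - dot x y.
Proof. by rewrite dotC dotNl dotC. Qed.

Lemma dotE x y : dot x y = (x *m y^T) 0 0.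
Proof. by rewrite mxE; apply: eq_bigr => j _; rewrite mxE. Qed.

Lemma dot_eq0 x : dot x x = 0 -> x = 0.
Proof.
move=> /eqP; rewrite psumr_eq0 => [|j _]; last by rewrite -expr2 sqr_ge0.
by move=> /allP H; apply/rowP => j; have := H j (mem_index_enum _); rewrite mxE mulf_eq0 orbb => /eqP.
Qed.

(* Linear relations depend only on scalar products, so a distance-preserving map
   respects them. *)
Lemma gram_rel m (x x' : 'rV[R]_n) (B B' : 'M[R]_(m, n)) c : dot x x = dot x' x' ->
  x *m B^T = x' *m B'^T -> B *m B^T = B' *m B'^T -> x = c *m B -> x' = c *m B'.
Proof.
move=> e1 e2 e3 e; apply/eqP; rewrite -subr_eq0; apply/eqP/dot_eq0.
have E (w : 'rV[R]_n) (A : 'M[R]_(m, n)) : dot (w - c *m A) (w - c *m A) =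
    dot w w - 2 * ((w *m A^T) *m c^T) 0 0 + (c *m (A *m A^T) *m c^T) 0 0.
  rewrite !(dotDl, dotDr, dotNl, dotNr) (dotC (c *m A) w) !(dotE _ (c *m A)).
  by rewrite trmx_mul !mulmxA; ring.
by rewrite E -e1 -e2 -e3 -E e subrr /dot big1// => j _; rewrite mxE mul0r.
Qed.

Lemma is_vderive_uniq u t x y : is_vderive u t x -> is_vderive u t y -> x = y.
Proof. by move=> h1 h2; apply/rowP => j; exact: is_derive_uniq (h1 j) (h2 j). Qed.

Lemma is_vderive_eq u t x y : x = y -> is_vderive u t x -> is_vderive u t y.
Proof. by move=> ->. Qed.

Lemma is_vderive_ext u v t x : u =1 v -> is_vderive u t x -> is_vderive v t x.
Proof. by move=> /funext ->. Qed.

Lemma is_vderive_cst x t : is_vderive (fun=> x) t 0.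
Proof. by move=> j; rewrite mxE; exact: is_derive_cst. Qed.

Lemma is_derive_dot u v t x y : is_vderive u t x -> is_vderive v t y ->
  is_derive t 1 (fun s => dot (u s) (v s)) (dot x (v t) + dot (u t) y).
Proof.
by move=> hu hv; rewrite /dot -big_split; apply: is_derive_sumf => j; exact: is_deriveM'.
Qed.

Lemma is_vderive_mulmx p (A : 'M[R]_(n, p)) u t x : is_vderive u t x ->
  is_vderive (fun s => u s *m A) t (x *m A).
Proof.
move=> hu j; rewrite mxE.
have -> : (fun s => (u s *m A) 0 j) = fun s => \sum_k A k j * u s 0 k.
  by apply/funext => s; rewrite mxE; apply: eq_bigr => k _; rewrite mulrC.
apply: is_derive_eqv (is_derive_sumf (df := fun k => A k j * x 0 k) _).
  by apply: eq_bigr => k _; rewrite mulrC.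
by move=> k; exact: is_derive_scale.
Qed.

Lemma is_vderive_trans u t x : is_vderive (fun s => u (t + s)) 0 x <-> is_vderive u t x.
Proof. by split => h j; have := h j; rewrite (is_derive_trans (fun s => u s 0 j)). Qed.

End Dim.

Definition pdim : nat := #|{: 'I_3 * 'I_3 * bool}|.

Local Notation C := R[i].
Local Notation V := (R[i]^o).
Implicit Types P Q : 'M[C]_3.

(* An isometry of the 3 x 3 complex matrices, with [mdot], onto a Euclidean space. *)
Definition mvec P : 'rV[R]_pdim :=
  \row_k let: (i, j, b) := enum_val k in if b then Im (P i j) else Re (P i j).

Definition unvec (u : 'rV[R]_pdim) : 'M[C]_3 :=
  \matrix_(i, j) (u 0 (enum_rank (i, j, false)) +i* u 0 (enum_rank (i, j, true))).

Lemma mvecE P i j b : mvec P 0 (enum_rank (i, j, b)) = if b then Im (P i j) else Re (P i j).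
Proof. by rewrite mxE enum_rankK. Qed.

Lemma mvecK : cancel mvec unvec.
Proof. by move=> P; apply/matrixP => i j; rewrite mxE !mvecE; case: (P i j). Qed.

Lemma unvecK : cancel unvec mvec.
Proof.
move=> u; apply/rowP => k; rewrite -(enum_valK k); case: (enum_val k) => [[i j] []].
all: by rewrite mvecE mxE.
Qed.

Lemma sum_pdim (f : 'I_pdim -> R) :
  \sum_k f k = \sum_i \sum_j (f (enum_rank (i, j, false)) + f (enum_rank (i, j, true))).
Proof.
rewrite (reindex (@enum_rank {: 'I_3 * 'I_3 * bool})) /=; last first.
  by apply: onW_bij; exact: enum_rank_bij.
transitivity (\sum_(x : 'I_3 * 'I_3) \sum_(b : bool) f (enum_rank (x, b))).
  by rewrite pair_bigA /=; apply: eq_bigr => -[x b].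
by rewrite [RHS]pair_bigA /=; apply: eq_bigr => -[i j] _; rewrite big_bool addrC.
Qed.

Lemma dot_mvec P Q : dot (mvec P) (mvec Q) = mdot P Q.
Proof.
rewrite /dot sum_pdim; apply: eq_bigr => i _; apply: eq_bigr => j _.
by rewrite !mvecE !re_imE; ring.
Qed.

Lemma mvecD P Q : mvec (P + Q) = mvec P + mvec Q.
Proof.
by apply/rowP => k; rewrite !mxE; case: (enum_val k) => [[i j] []]; rewrite mxE !re_imE.
Qed.

Lemma mvecZ (c : R) P : mvec (c%:C *: P) = c *: mvec P.
Proof.
by apply/rowP => k; rewrite !mxE; case: (enum_val k) => [[i j] []]; rewrite mxE !re_imE /=; ring.
Qed.

(* Projectors on lines are cut out by polynomial equations, which propagate by analyticity. *)
Definition isproj P : Prop :=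
  [/\ forall i j, P i j = (P j i)^*%C, forall i j k l, P i j * P k l = P i l * P k j &
      \sum_i P i i = 1].

Lemma isproj_projm (F : 'rV[C]_3) : F != 0 -> isproj (projm F).
Proof.
move=> F0; have n0 := hdot_neq0 F0; split.
- by move=> i j; rewrite !mxE !conjcM conjcV hdotE conjc_real conjcK; congr (_ / _); rewrite mulrC.
- by move=> i j k l; rewrite !mxE; ring.
- by under eq_bigr do rewrite mxE; rewrite -mulr_suml divff.
Qed.

(** Trace 1 yields a nonzero diagonal entry, and the rank one relations say that its column spans
    the image. *)
Lemma isprojP P : isproj P -> exists2 F : 'rV[C]_3, F != 0 & P = projm F.
Proof.
move=> [he rk tr].
have [j Pj] : exists j, P j j != 0.
  apply/existsP; apply: contraT; rewrite negb_exists => /forallP H.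
  have := tr; rewrite big1 => [/esym/eqP|i _]; first by rewrite oner_eq0.
  by apply/eqP; have := H i; rewrite negbK.
pose F : 'rV[C]_3 := \row_i P i j.
have hF : hdot F F = P j j.
  rewrite /hdot; transitivity (\sum_i P i i * P j j); last by rewrite -mulr_suml tr mul1r.
  by apply: eq_bigr => i _; rewrite !mxE -he rk.
exists F; first by apply/eqP => /rowP/(_ j)/eqP; rewrite !mxE (negbTE Pj).
apply/matrixP => i k; rewrite [RHS]mxE hF !mxE -he rk mulfK//.
Qed.

Lemma is_vderive_mvec (p : R -> 'M[C]_3) t (dp : 'M[C]_3) :
  is_vderive (fun s => mvec (p s)) t (mvec dp) <->
  forall i j, is_cderive (fun s => p s i j) t (dp i j).
Proof.
split=> [H i j|H k].
  split; have := H (enum_rank (i, j, _)).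
    by move=> /(_ false); rewrite mvecE; under eq_fun do rewrite mvecE.
  by move=> /(_ true); rewrite mvecE; under eq_fun do rewrite mvecE.
rewrite -(enum_valK k); case: (enum_val k) => [[i j] b].
rewrite mvecE; under eq_fun do rewrite mvecE.
by have [] := H i j; case: b.
Qed.

Lemma is_vderive_pmx U (p : V -> 'M[C]_3) (v w : V) :
  (forall i j, Ck_on 1 U (fun z => p z i j)) -> U w ->
  is_vderive (fun t : R => mvec (p (w + t%:C *: v))) 0 (mvec (pmx p v w)).
Proof.
move=> Cp Uw; apply/is_vderive_mvec => i j; rewrite mxE.
exact: (Ck_on_rderivable v (Cp i j) Uw).
Qed.

Lemma pmx_of_vderive (p : V -> 'M[C]_3) (v w : V) du :
  is_vderive (fun t : R => mvec (p (w + t%:C *: v))) 0 du -> mvec (pmx p v w) = du.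
Proof.
rewrite -(unvecK du) => /is_vderive_mvec H; congr mvec; apply/matrixP => i j; rewrite mxE.
exact: (proj2 ((rderiveP v (fun y => p y i j) w _).1 (H i j))).
Qed.

End VectorCalculus.

(** Lying in a row space is a linear equation, the vanishing of the product with the cokernel
    matrix, and may be differentiated. *)
Lemma is_vderive_sub (R : realType) n k (A : 'M[R]_(k, n)) (u : R -> 'rV[R]_n) (t : R) du :
  is_vderive u t du -> (\forall s \near t, (u s <= A)%MS) -> (du <= A)%MS.
Proof.
move=> hu uA; rewrite submxE; apply/eqP.
apply: is_vderive_uniq (is_vderive_mulmx (cokermx A) hu) _ => j.
have H : \forall s \near t, 0 = (u s *m cokermx A) 0 j.
  by apply: filterS uA => s; rewrite submxE => /eqP ->; rewrite mxE.
rewrite mxE; apply: near_eq_is_derive H (is_derive_cst (0 : R) t 1); exact: oner_neq0.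
Qed.

(** * The linear flow of a translationally equivariant map *)

Section Flow.
Variables (R : realType) (n : nat) (I : set R) (q qx : R -> R -> 'rV[R]_n).
Hypothesis gram : forall x x1 y1 x2 y2, I y1 -> I y2 ->
  dot (q (x1 + x) y1) (q (x2 + x) y2) = dot (q x1 y1) (q x2 y2).

Definition rows_at m (p : 'I_m -> R * R) (x : R) : 'M[R]_(m, n) :=
  \matrix_i q ((p i).1 + x) (p i).2.

(** Choose finitely many points for which the rank is maximal; a further vector outside their span
    would raise it. *)
Lemma span_points : exists m (p : 'I_m -> R * R),
  (forall i, I (p i).2) /\ forall x y, I y -> (q x y <= rows_at p 0)%MS.
Proof.
pose P r := `[< exists m (p : 'I_m -> R * R), (forall i, I (p i).2) /\ \rank (rows_at p 0) = r >].
have P0 : exists r, P r.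
  exists 0%N; apply/asboolP; exists 0%N, (fun=> (0, 0)); split; first by case.
  by apply/eqP; rewrite -leqn0 rank_leq_row.
have Pn r : P r -> (r <= n)%N by move=> /asboolP[m [p [_ <-]]]; exact: rank_leq_col.
case: (ex_maxnP P0 Pn) => r /asboolP[m [p [Ip rp]]] mx.
exists m, p; split=> // x y Iy; apply: contraT => nle.
pose p' (i : 'I_m.+1) := if unlift ord0 i is Some j then p j else (x, y).
have Ip' i : I (p' i).2 by rewrite /p'; case: unliftP => [j _|_] /=.
have sB : (rows_at p 0 <= rows_at p' 0)%MS.
  apply/row_subP => i; have -> : row i (rows_at p 0) = row (lift ord0 i) (rows_at p' 0).
    by rewrite !rowK /p' liftK.
  exact: row_sub.
have sq : (q x y <= rows_at p' 0)%MS.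
  have -> : q x y = row ord0 (rows_at p' 0) by rewrite rowK /p' unlift_none /= addr0.
  exact: row_sub.
have lt : (\rank (rows_at p 0) < \rank (rows_at p' 0))%N.
  apply: rank_ltmx; rewrite ltmxErank sB /= ltn_neqAle mxrankS// andbT.
  apply: contra nle => /eqP e; apply: submx_trans sq _.
  by rewrite -(geq_leqif (mxrank_leqif_sup sB)) e.
have : P (\rank (rows_at p' 0)) by apply/asboolP; exists m.+1, p'.
by move=> /mx; rewrite -rp leqNgt lt.
Qed.

Variables (m : nat) (p : 'I_m -> R * R).
Hypotheses (Ip : forall i, I (p i).2)
  (span : forall x y, I y -> (q x y <= rows_at p 0)%MS).
Local Notation B := (rows_at p 0).

(** The linear map carrying each base row to its translate by [x]. Only its action on the row space
    of [B] is meaningful; elsewhere it depends on the chosen pseudo-inverse. *)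
Definition flow x : 'M[R]_n := pinvmx B *m rows_at p x.

Lemma mul_tr_rows (u : 'rV[R]_n) x i : (u *m (rows_at p x)^T) 0 i = dot u (row i (rows_at p x)).
Proof. by rewrite mxE; apply: eq_bigr => j _; rewrite !mxE. Qed.

Lemma rows_gram x : rows_at p x *m (rows_at p x)^T = B *m B^T.
Proof.
apply/matrixP => i j.
have H x' : (rows_at p x' *m (rows_at p x')^T) i j =
    dot (q ((p i).1 + x') (p i).2) (q ((p j).1 + x') (p j).2).
  by rewrite mxE; apply: eq_bigr => k _; rewrite !mxE.
by rewrite !H !addr0 !gram.
Qed.

(** The coefficients expressing [q x y] through the base points are unchanged by translation,
    because by [gram_rel] linear relations only see scalar products. *)
Lemma q_flow x t y : I y -> q (x + t) y = q x y *m flow t.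
Proof.
move=> Iy; rewrite mulmxA; have E := mulmxKpV (span x Iy).
apply: (gram_rel (x := q x y) (B := B)) (esym E).
- by rewrite gram.
- by apply/rowP => i; rewrite !mul_tr_rows !rowK addr0 gram.
- by rewrite rows_gram.
Qed.

Lemma rows_flow x : rows_at p x = B *m flow x.
Proof.
apply/row_matrixP => i; rewrite row_mul !rowK addr0; exact: q_flow.
Qed.

Lemma flow_sub (u : 'rV[R]_n) x : (u <= B)%MS -> (u *m flow x <= B)%MS.
Proof.
move=> uB; rewrite /flow mulmxA; apply: submx_trans (submxMl _ _) _.
by apply/row_subP => i; rewrite rowK; exact: span.
Qed.

Lemma flow_dot (u v : 'rV[R]_n) x : (u <= B)%MS -> (v <= B)%MS ->
  dot (u *m flow x) (v *m flow x) = dot u v.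
Proof.
move=> /submxP[c ->] /submxP[d ->]; rewrite -!mulmxA -!rows_flow.
by rewrite !dotE !trmx_mul !mulmxA -(mulmxA c) rows_gram mulmxA.
Qed.

Lemma flow_add (u : 'rV[R]_n) x t : (u <= B)%MS ->
  u *m flow x *m flow t = u *m flow (x + t).
Proof.
move=> /submxP[c ->]; rewrite -[c *m B *m flow x]mulmxA -rows_flow -mulmxA -[RHS]mulmxA -rows_flow; congr (_ *m _).
by apply/row_matrixP => i; rewrite row_mul !rowK addrA -q_flow.
Qed.

Lemma flow0 (u : 'rV[R]_n) : (u <= B)%MS -> u *m flow 0 = u.
Proof. by move=> uB; rewrite mulmxA mulmxKpV. Qed.

Lemma flow_period T (u : 'rV[R]_n) : (forall x y, I y -> q (x + T) y = q x y) ->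
  (u <= B)%MS -> u *m flow T = u.
Proof.
move=> per uB; rewrite -[RHS]flow0//; rewrite /flow; congr (_ *m (_ *m _)).
by apply/row_matrixP => i; rewrite !rowK addr0 per.
Qed.

Hypothesis qx_derive : forall x y, I y -> is_vderive (fun s => q s y) x (qx x y).

Definition flow_gen : 'M[R]_n := pinvmx B *m \matrix_i qx (p i).1 (p i).2.
Local Notation L := flow_gen.

Lemma derive_rows (c : 'rV[R]_m) x :
  is_vderive (fun s => c *m rows_at p s) x (c *m \matrix_i qx ((p i).1 + x) (p i).2).
Proof.
move=> j; rewrite mxE.
have -> : (fun s => (c *m rows_at p s) 0 j) = fun s => \sum_i c 0 i * rows_at p s i j.
  by apply/funext => s; rewrite mxE.
apply: is_derive_sumf => i; apply: is_derive_scale; rewrite mxE.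
have := (is_vderive_trans (fun s => q s (p i).2) _ _).2 (qx_derive ((p i).1 + x) (Ip i)).
move=> h.
have := (is_vderive_trans (fun s => q ((p i).1 + s) (p i).2) x (qx ((p i).1 + x) (p i).2)).1.
move=> /(_ _)/(_ j) H; under eq_fun do rewrite mxE; apply: H => {}j.
by have := h j; under eq_fun do rewrite -addrA.
Qed.

Lemma q_gen x y : I y -> qx x y = q x y *m L.
Proof.
move=> Iy; have h : is_vderive (fun s => q (x + s) y) 0 (qx x y).
  exact: ((is_vderive_trans (fun s => q s y) x _).2 (qx_derive x Iy)).
apply: is_vderive_uniq h _.
have := derive_rows (q x y *m pinvmx B) 0.
have -> : \matrix_i qx ((p i).1 + 0) (p i).2 = \matrix_i qx (p i).1 (p i).2.
  by apply/row_matrixP => i; rewrite !rowK addr0.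
rewrite -mulmxA -/L; apply: is_vderive_ext => s.
by rewrite -mulmxA -/(flow s) -q_flow.
Qed.

Lemma flow_derive (u : 'rV[R]_n) x : (u <= B)%MS ->
  is_vderive (fun s => u *m flow s) x (u *m flow x *m L).
Proof.
move=> uB; have := derive_rows (u *m pinvmx B) x.
have -> : \matrix_i qx ((p i).1 + x) (p i).2 = rows_at p x *m L.
  by apply/row_matrixP => i; rewrite row_mul !rowK; exact: q_gen.
move=> h; apply: is_vderive_ext (is_vderive_eq _ h) => [s|]; rewrite -mulmxA//.
by rewrite -[in RHS](mulmxA u) /flow -!(mulmxA (pinvmx B)).
Qed.

Lemma gen_derive (u : 'rV[R]_n) : (u <= B)%MS -> is_vderive (fun s => u *m flow s) 0 (u *m L).
Proof. by move=> uB; have := flow_derive 0 uB; rewrite flow0. Qed.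

Lemma gen_sub (u : 'rV[R]_n) : (u <= B)%MS -> (u *m L <= B)%MS.
Proof.
move=> uB; apply: is_vderive_sub (gen_derive uB) _.
by near=> s; exact: flow_sub.
Unshelve. all: by end_near. Qed.

(** Differentiate at 0 the constant scalar product of [flow_dot]. *)
Lemma gen_skew (u v : 'rV[R]_n) : (u <= B)%MS -> (v <= B)%MS ->
  dot (u *m L) v = - dot u (v *m L).
Proof.
move=> uB vB; have := is_derive_dot (gen_derive uB) (gen_derive vB).
rewrite !flow0// => h; apply/eqP; rewrite -addr_eq0; apply/eqP.
apply: is_derive_uniq h _.
under eq_fun do rewrite flow_dot//.
exact: is_derive_cst.
Qed.

Lemma gen_flow (u : 'rV[R]_n) x : (u <= B)%MS -> u *m L *m flow x = u *m flow x *m L.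
Proof.
move=> uB; apply: is_vderive_uniq (is_vderive_mulmx (flow x) (gen_derive uB)) _.
have := (is_vderive_trans (fun s => u *m flow s) x _).2 (flow_derive x uB).
by apply: is_vderive_ext => s; rewrite addrC flow_add.
Qed.

End Flow.

Section NearOpen.
Variables (R : realType) (I : set R).
Hypothesis openI : open I.

Lemma near_open_set y (P : R -> Prop) : I y -> (forall z, I z -> P z) -> \forall z \near y, P z.
Proof.
by move=> Iy H; have : nbhs y I by [exact: open_nbhs_nbhs]; apply: filterS.
Qed.

Lemma is_derive_on (f g : R -> R) (y a : R) : I y -> (forall y, I y -> f y = g y) ->
  is_derive y 1 f a -> is_derive y 1 g a.
Proof.
move=> Iy fg hf; have H : \forall z \near y, f z = g z by exact: near_open_set.
by apply: near_eq_is_derive H hf; exact: oner_neq0.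
Qed.

Lemma derive_eq_on (f g : R -> R) (y a b : R) : I y -> (forall y, I y -> f y = g y) ->
  is_derive y 1 f a -> is_derive y 1 g b -> a = b.
Proof. by move=> Iy fg hf; apply: is_derive_uniq; exact: is_derive_on hf. Qed.

Lemma is_derive_const (c t : R) : is_derive t 1 (fun=> c) (0 : R).
Proof. exact: is_derive_cst. Qed.

Lemma derive0_on (f : R -> R) (y a c : R) : I y -> (forall y, I y -> f y = c) ->
  is_derive y 1 f a -> a = 0.
Proof. by move=> Iy fc hf; exact: (derive_eq_on (g := fun=> c) Iy fc hf (is_derive_const c y)). Qed.

Lemma dot0l n (u : 'rV[R]_n) : dot 0 u = 0.
Proof. by rewrite /dot big1// => j _; rewrite mxE mul0r. Qed.

Lemma is_vderive_on n (u v : R -> 'rV[R]_n) (y : R) du : I y -> (forall y, I y -> u y = v y) ->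
  is_vderive u y du -> is_vderive v y du.
Proof. by move=> Iy uv h j; apply: is_derive_on Iy _ (h j) => z /uv ->. Qed.

End NearOpen.

(** * The profile equation *)

Section Strip.
Variables (R : realType) (n : nat) (I : set R) (q qx qy qxx qyy : R -> R -> 'rV[R]_n).
Variables (e : 'rV[R]_n) (lam s t : R -> R -> R).
Hypothesis openI : open I.

Hypothesis gram : forall x x1 y1 x2 y2, I y1 -> I y2 ->
  dot (q (x1 + x) y1) (q (x2 + x) y2) = dot (q x1 y1) (q x2 y2).
Variables (m : nat) (p : 'I_m -> R * R).
Hypotheses (Ip : forall i, I (p i).2)
  (span : forall x y, I y -> (q x y <= rows_at q p 0)%MS).
Hypotheses (dx : forall x y, I y -> is_vderive (fun s => q s y) x (qx x y))
  (dxx : forall x y, I y -> is_vderive (fun s => qx s y) x (qxx x y))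
  (dy : forall x y, I y -> is_vderive (q x) y (qy x y))
  (dyy : forall x y, I y -> is_vderive (qy x) y (qyy x y)).
Hypotheses (qq : forall x y, I y -> dot (q x y) (q x y) = 1)
  (eq1 : forall x y, I y -> dot e (q x y) = 1)
  (lam0 : forall x y, I y -> 0 < lam x y)
  (exx : forall x y, I y -> dot (qx x y) (qx x y) = 2 * lam x y)
  (eyy : forall x y, I y -> dot (qy x y) (qy x y) = 2 * lam x y)
  (exy : forall x y, I y -> dot (qx x y) (qy x y) = 0)
  (lapl : forall x y, I y -> qxx x y + qyy x y =
     (2 * lam x y) *: (e - 3 *: q x y) + s x y *: qx x y + t x y *: qy x y).
Local Notation B := (rows_at q p 0).
Local Notation L := (flow_gen q qx p).
Local Notation flow := (flow q p).

Let qxE x y : I y -> qx x y = q x y *m L.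
Proof. by move=> Iy; exact: (q_gen gram Ip span dx). Qed.

Let qxB x y : I y -> (qx x y <= B)%MS.
Proof.
by move=> Iy; rewrite qxE//; apply: (gen_sub gram Ip span dx); exact: span.
Qed.

Let qyB x y : I y -> (qy x y <= B)%MS.
Proof.
move=> Iy; apply: is_vderive_sub (dy x Iy) _.
by apply: (near_open_set openI Iy) => z Iz; exact: span.
Qed.

Let qxxE x y : I y -> qxx x y = q x y *m L *m L.
Proof.
move=> Iy; apply: is_vderive_uniq (dxx x Iy) _; rewrite -qxE//.
apply: is_vderive_ext (is_vderive_mulmx L (dx x Iy)) => z.
by rewrite -qxE.
Qed.

Let skew0 (u : 'rV[R]_n) : (u <= B)%MS -> dot (u *m L) u = 0.
Proof.
move=> uB; have := gen_skew gram Ip span dx uB uB; rewrite [dot u _]dotC; lra.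
Qed.

Let dot_q_qx x y : I y -> dot (q x y) (qx x y) = 0.
Proof. by move=> Iy; rewrite qxE// dotC skew0// span. Qed.

Let dot_q_qy x y : I y -> dot (q x y) (qy x y) = 0.
Proof.
move=> Iy; have := derive0_on openI Iy (@qq x) (is_derive_dot (dy x Iy) (dy x Iy)).
by rewrite (dotC (qy x y)); lra.
Qed.

Let dot_e_qx x y : I y -> dot e (qx x y) = 0.
Proof.
move=> Iy; have h := is_derive_dot (is_vderive_cst e x) (dx x Iy).
rewrite -[LHS]add0r -{1}(dot0l (q x y)); apply: is_derive_uniq h _.
by under eq_fun do rewrite eq1//; exact: is_derive_const.
Qed.

Let dot_e_qy x y : I y -> dot e (qy x y) = 0.
Proof.
move=> Iy; have h := is_derive_dot (is_vderive_cst e y) (dy x Iy).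
by rewrite -[LHS]add0r -{1}(dot0l (q x y)); exact: (derive0_on openI Iy (@eq1 x) h).
Qed.

Let dot_qyy_qx x y : I y -> dot (qyy x y) (qx x y) = 0.
Proof.
move=> Iy; have h := is_derive_dot (dyy x Iy) (is_vderive_mulmx L (dy x Iy)).
have := derive0_on (c := 0) openI Iy _ h.
rewrite -qxE// [dot (qy x y) _]dotC skew0 ?qyB// addr0; apply => z Iz.
by rewrite -qxE// dotC exy.
Qed.

Let dot_qyy_qy x y : I y -> dot (qyy x y) (qy x y) = - dot (qxx x y) (qy x y).
Proof.
move=> Iy; have hL := is_vderive_mulmx L (dy x Iy).
have qLB : (q x y *m L <= B)%MS by rewrite -(qxE x Iy); exact: qxB.
(* This evaluates the y-derivative of |q_x|^2; comparing it with that of |q_y|^2, which is equal by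
   conformality, gives the claim. *)
have E1 : dot (qy x y *m L) (q x y *m L) = - dot (qxx x y) (qy x y).
  by rewrite (qxxE x Iy) (gen_skew gram Ip span dx (qyB x Iy) qLB) dotC.
have H z : I z -> dot (qy x z) (qy x z) = dot (q x z *m L) (q x z *m L).
  by move=> Iz; rewrite -(qxE x Iz) (exx x Iz) (eyy x Iz).
have := derive_eq_on openI Iy H (is_derive_dot (dyy x Iy) (dyy x Iy)) (is_derive_dot hL hL).
rewrite [dot (q x y *m L) _]dotC E1 (dotC (qy x y) (qyy x y)); lra.
Qed.

(* Skewness of the generator [L] makes the x-derivative of the conformal factor
   vanish and forces the remaining tangential terms to cancel. *)
Lemma tangential_s x y : I y -> s x y = 0.
Proof.
move=> Iy; have := congr1 (fun v => dot v (qx x y)) (lapl x Iy).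
rewrite !(dotDl, dotZl, dotNl) dot_qyy_qx// dot_e_qx// dot_q_qx// exx//.
rewrite (dotC (qy x y)) exy// qxxE// -[q x y *m L]qxE// skew0 ?qxB//.
have := lam0 x Iy => l0 h; apply/eqP.
have : s x y * lam x y = 0 by lra.
by move=> /eqP; rewrite mulf_eq0 (gt_eqF l0) orbF.
Qed.

Lemma tangential_t x y : I y -> t x y = 0.
Proof.
move=> Iy; have := congr1 (fun v => dot v (qy x y)) (lapl x Iy).
rewrite !(dotDl, dotZl, dotNl) dot_qyy_qy// dot_e_qy// dot_q_qy// eyy// exy//.
have := lam0 x Iy => l0 h; apply/eqP.
have : t x y * lam x y = 0 by lra.
by move=> /eqP; rewrite mulf_eq0 (gt_eqF l0) orbF.
Qed.

Lemma lamE x y : I y -> 2 * lam x y = dot (q x y *m L) (q x y *m L).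
Proof. by move=> Iy; rewrite -qxE// exx. Qed.

Lemma lam_flow x y : I y -> lam x y = lam 0 y.
Proof.
move=> Iy; suff : 2 * lam x y = 2 * lam 0 y by lra.
rewrite !lamE// -[x]add0r (q_flow gram Ip span)// -(gen_flow gram Ip span dx) ?span//.
by rewrite (flow_dot gram Ip span)// -qxE// qxB.
Qed.

Lemma qyyE x y : I y -> qyy x y = (2 * lam x y) *: (e - 3 *: q x y) - q x y *m L *m L.
Proof.
move=> Iy; have := lapl x Iy; rewrite tangential_s// tangential_t// !scale0r !addr0 => <-.
by rewrite qxxE// addrC addKr.
Qed.

Lemma qy_flow x y : I y -> qy x y = qy 0 y *m flow x.
Proof.
move=> Iy; apply: is_vderive_uniq (dy x Iy) _.
apply: (is_vderive_on openI Iy _ (is_vderive_mulmx (flow x) (dy 0 Iy))) => z Iz.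
by rewrite -(q_flow gram Ip span)// add0r.
Qed.

Lemma qyy_flow x y : I y -> qyy x y = qyy 0 y *m flow x.
Proof.
move=> Iy; apply: is_vderive_uniq (dyy x Iy) _.
by apply: (is_vderive_on openI Iy _ (is_vderive_mulmx (flow x) (dyy 0 Iy))) => z Iz; rewrite -qy_flow.
Qed.

(** The equation expresses [2 * lam] times [e] through q, q_yy and q L L, all carried along by the
    flow; [lam] does not depend on x and is positive, so [e] must be fixed. *)
Lemma e_flow x y : I y -> e *m flow x = e.
Proof.
move=> Iy; have l0 := lam0 0 Iy.
have := qyy_flow x Iy; rewrite !qyyE// lam_flow// mulmxBl -scalemxAl mulmxBl -scalemxAl.
have -> : q x y = q 0 y *m flow x by rewrite -(q_flow gram Ip span)// add0r.
have -> : q 0 y *m L *m L *m flow x = q 0 y *m flow x *m L *m L.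
  have qLB : (q 0 y *m L <= B)%MS by rewrite -qxE// qxB.
  by rewrite (gen_flow gram Ip span dx _ qLB) (gen_flow gram Ip span dx)// span.
move=> /addIr /(congr1 (fun v => (2 * lam 0 y)^-1 *: v)).
have l2 : 2 * lam 0 y != 0 by rewrite mulf_neq0 ?gt_eqF.
by rewrite !scalerA mulVf// !scale1r => /addIr.
Qed.

End Strip.

(** * Coefficient tensors of bilinear maps *)

Section BilinearTensor.
Variables (R : realType) (N : nat).
Implicit Types v w : 'I_N -> R.

Definition unit_state (j : 'I_N) : 'I_N -> R := fun k => (k == j)%:R.

Lemma linear_form_sum (f : ('I_N -> R) -> R) v :
  (forall a v w, f (fun k => a * v k + w k) = a * f v + f w) ->
  f v = \sum_j v j * f (unit_state j).
Proof.
move=> fl; have f0 : f (fun=> 0) = 0.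
  by have := fl (- 1) (fun=> 0) (fun=> 0); rewrite !mulN1r !addNr.
have H (r : seq 'I_N) : f (fun k => \sum_(j <- r) v j * unit_state j k) =
    \sum_(j <- r) v j * f (unit_state j).
  elim: r => [|j r IH]; first by rewrite big_nil -[RHS]f0; congr f; apply/funext => k; rewrite big_nil.
  by rewrite big_cons -IH -fl; congr f; apply/funext => k; rewrite big_cons.
rewrite -H; congr f; apply/funext => k.
rewrite (bigD1 k)//= /unit_state eqxx mulr1 big1 ?addr0// => j jk.
by rewrite eq_sym (negbTE jk) mulr0.
Qed.

(** It lets a bilinear field be written in matrix notation and fed to the theory of quadratic
    systems, its coefficients being its values on unit states. *)
Lemma qform_bilinear (F : ('I_N -> R) -> ('I_N -> R) -> 'I_N -> R) v w i :
  (forall a v v' w i, F (fun k => a * v k + v' k) w i = a * F v w i + F v' w i) ->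
  (forall a v w w' i, F v (fun k => a * w k + w' k) i = a * F v w i + F v w' i) ->
  qform (fun i j k => F (unit_state j) (unit_state k) i) v w i = F v w i.
Proof.
move=> Fl Fr; rewrite (linear_form_sum (f := fun v => F v w i)) => [|a v1 v2]; last exact: Fl.
apply: eq_bigr => j _.
rewrite (linear_form_sum (f := fun w => F (unit_state j) w i)) => [|a v1 v2]; last exact: Fr.
by rewrite mulr_sumr; apply: eq_bigr => k _; ring.
Qed.

End BilinearTensor.

(** * Global solution of the profile equation *)

Section GlobalExtension.
Variables (R : realType) (n : nat) (e : 'rV[R]_n) (L : 'M[R]_n).

Definition state_dim : nat := #|{: 'I_n + 'I_n + bool}|.
Local Notation St := ('I_state_dim -> R).
Implicit Types v w : St.

Definition pack (Q D : 'rV[R]_n) (r k : R) : St := fun i =>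
  match enum_val i with
  | inl (inl j) => Q 0 j | inl (inr j) => D 0 j | inr true => r | inr false => k
  end.
Definition stQ v : 'rV[R]_n := \row_j v (enum_rank (inl (inl j))).
Definition stD v : 'rV[R]_n := \row_j v (enum_rank (inl (inr j))).
Definition str v : R := v (enum_rank (inr true)).
Definition stk v : R := v (enum_rank (inr false)).

Lemma stQ_pack Q D r k : stQ (pack Q D r k) = Q.
Proof. by apply/rowP => j; rewrite mxE /pack enum_rankK. Qed.
Lemma stD_pack Q D r k : stD (pack Q D r k) = D.
Proof. by apply/rowP => j; rewrite mxE /pack enum_rankK. Qed.
Lemma str_pack Q D r k : str (pack Q D r k) = r.
Proof. by rewrite /str /pack enum_rankK. Qed.
Lemma stk_pack Q D r k : stk (pack Q D r k) = k.
Proof. by rewrite /stk /pack enum_rankK. Qed.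
Definition st_pack := (stQ_pack, stD_pack, str_pack, stk_pack).

Lemma stQ_lin a v w : stQ (fun k => a * v k + w k) = a *: stQ v + stQ w.
Proof. by apply/rowP => j; rewrite !mxE. Qed.
Lemma stD_lin a v w : stD (fun k => a * v k + w k) = a *: stD v + stD w.
Proof. by apply/rowP => j; rewrite !mxE. Qed.
Lemma str_lin a v w : str (fun k => a * v k + w k) = a * str v + str w. Proof. by []. Qed.
Lemma stk_lin a v w : stk (fun k => a * v k + w k) = a * stk v + stk w. Proof. by []. Qed.

(* The equation [Q'' = |QL|^2 (e - 3 Q) - Q L L], made quadratic by the
   additional unknowns [r = |QL|^2] and [k = 1]. *)
Definition field v w : St :=
  pack (stk v *: stD w)
       (str v *: (stk w *: e - 3 *: stQ w) - stk v *: (stQ w *m L *m L))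
       (2 * dot (stQ v *m L) (stD w *m L)) 0.

Lemma field_linl a v v' w i : field (fun k => a * v k + v' k) w i = a * field v w i + field v' w i.
Proof.
rewrite /field !(stQ_lin, str_lin, stk_lin) /pack; case: (enum_val i) => [[j|j]|[]].
- by rewrite !mxE; ring.
- by move: (stQ w *m L *m L) => A; rewrite !mxE; ring.
- by rewrite mulmxDl -scalemxAl dotDl dotZl; ring.
- by rewrite mulr0 addr0.
Qed.

Lemma field_linr a v w w' i : field v (fun k => a * w k + w' k) i = a * field v w i + field v w' i.
Proof.
rewrite /field !(stQ_lin, stD_lin, str_lin, stk_lin) /pack !mulmxDl -!scalemxAl.
case: (enum_val i) => [[j|j]|[]].
- by rewrite !mxE; ring.
- by move: (stQ w *m L *m L) (stQ w' *m L *m L) => A A'; rewrite !mxE; ring.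
- by rewrite dotDr dotZr; ring.
- by rewrite mulr0 addr0.
Qed.

Definition tensor i j k : R := field (unit_state R j) (unit_state R k) i.

Lemma tensorE v w i : qform tensor v w i = field v w i.
Proof. exact: qform_bilinear field_linl field_linr. Qed.

Lemma qsolP (x : R -> St) (I : set R) : qsol tensor x I <->
  forall y, I y ->
  [/\ is_vderive (fun s => stQ (x s)) y (stk (x y) *: stD (x y)),
      is_vderive (fun s => stD (x s)) y
        (str (x y) *: (stk (x y) *: e - 3 *: stQ (x y)) - stk (x y) *: (stQ (x y) *m L *m L)),
      is_derive y 1 (fun s => str (x s)) (2 * dot (stQ (x y) *m L) (stD (x y) *m L)) &
      is_derive y 1 (fun s => stk (x s)) 0].
Proof.
have E y i : qform tensor (x y) (x y) i = field (x y) (x y) i := tensorE _ _ _.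
split=> [H y Iy|H y Iy i]; last first.
  have [h1 h2 h3 h4] := H y Iy; rewrite E -(enum_valK i).
  rewrite /field {1}/pack enum_rankK; case: (enum_val i) => [[j|j]|[]].
  - by have := h1 j; under eq_fun do rewrite mxE.
  - by have := h2 j; under eq_fun do rewrite mxE.
  - exact: h3.
  - exact: h4.
have K i := H y Iy i; split.
- move=> j; under eq_fun do rewrite mxE.
  by have := K (enum_rank (inl (inl j))); rewrite E /field /pack enum_rankK.
- move=> j; under eq_fun do rewrite mxE.
  by have := K (enum_rank (inl (inr j))); rewrite E /field /pack enum_rankK.
- by have := K (enum_rank (inr true)); rewrite E /field /pack enum_rankK.
- by have := K (enum_rank (inr false)); rewrite E /field /pack enum_rankK.
Qed.

(** A sum of squares, so that the four conservation laws become one analytic equation. *)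
Definition constr v : R :=
  (dot (stQ v) (stQ v) - 1) * (dot (stQ v) (stQ v) - 1) +
  (dot (stD v) (stD v) - dot (stQ v *m L) (stQ v *m L)) *
    (dot (stD v) (stD v) - dot (stQ v *m L) (stQ v *m L)) +
  (str v - dot (stQ v *m L) (stQ v *m L)) * (str v - dot (stQ v *m L) (stQ v *m L)) +
  (stk v - 1) * (stk v - 1).

Lemma constrP v : constr v = 0 <->
  [/\ dot (stQ v) (stQ v) = 1, dot (stD v) (stD v) = dot (stQ v *m L) (stQ v *m L),
      str v = dot (stQ v *m L) (stQ v *m L) & stk v = 1].
Proof.
rewrite /constr -!expr2; split=> [/eqP|[-> -> -> ->]]; last by rewrite !subrr expr0n !addr0.
rewrite !paddr_eq0 ?addr_ge0 ?sqr_ge0// !sqrf_eq0 !subr_eq0 => /andP[/andP[/andP[]]].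
by do 4 move=> /eqP ?.
Qed.

Definition image_bound : R := \sum_j (\sum_k `|L k j|) ^+ 2.

Lemma image_bound_ge0 : 0 <= image_bound.
Proof. by rewrite sumr_ge0// => j _; rewrite sqr_ge0. Qed.

Lemma coord_le_dot (u : 'rV[R]_n) j : u 0 j ^+ 2 <= dot u u.
Proof.
rewrite /dot (bigD1 j)//= expr2 lerDl sumr_ge0// => k _.
by rewrite -expr2 sqr_ge0.
Qed.

Lemma norm_le_sqr (a M : R) : 0 <= M -> a ^+ 2 <= M ^+ 2 -> `|a| <= M.
Proof. by move=> M0; rewrite -[a ^+ 2]real_normK ?num_real// ler_sqr ?nnegrE. Qed.

Lemma dot_image_le (u : 'rV[R]_n) : dot u u = 1 -> dot (u *m L) (u *m L) <= image_bound.
Proof.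
move=> u1; apply: ler_sum => j _; rewrite mxE -expr2 -real_normK ?num_real// lerXn2r ?nnegrE ?sumr_ge0//.
apply: le_trans (ler_norm_sum _ _ _) _; apply: ler_sum => k _; rewrite normrM.
apply: ler_piMl => //; apply: norm_le_sqr => //; rewrite expr1n -u1; exact: coord_le_dot.
Qed.

(** The laws make |Q| and k equal to 1 and both |D|^2 and r equal to |Q L|^2, which is at most
    [image_bound] on unit vectors. *)
Lemma constr_bound v : constr v = 0 -> forall i, `|v i| <= 1 + image_bound.
Proof.
move=> /constrP[q1 d1 r1 k1] i; have b0 := image_bound_ge0.
have qb := dot_image_le q1.
have b1 : image_bound <= (1 + image_bound) ^+ 2 by nra.
rewrite -(enum_valK i); case: (enum_val i) => [[j|j]|[]].
- apply: norm_le_sqr; first lra.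
  have := coord_le_dot (stQ v) j; rewrite mxE q1; nra.
- apply: norm_le_sqr; first lra.
  have := coord_le_dot (stD v) j; rewrite mxE d1; nra.
- rewrite -/(str v) r1 ger0_norm; first lra.
  by rewrite sumr_ge0// => j _; rewrite -expr2 sqr_ge0.
- rewrite -/(stk v) k1 normr1; lra.
Qed.

Definition analytic_vec k (u : R -> 'rV[R]_k) y := forall j, analytic_at (fun s => u s 0 j) y.

Lemma analytic_dot k (u v : R -> 'rV[R]_k) y : analytic_vec u y -> analytic_vec v y ->
  analytic_at (fun s => dot (u s) (v s)) y.
Proof. by move=> hu hv; apply: analytic_at_sum => j; exact: analytic_atM. Qed.

Lemma analytic_mulmx k l (A : 'M[R]_(k, l)) (u : R -> 'rV[R]_k) y : analytic_vec u y ->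
  analytic_vec (fun s => u s *m A) y.
Proof.
move=> hu j; have -> : (fun s => (u s *m A) 0 j) = fun s => \sum_k u s 0 k * A k j.
  by apply/funext => s; rewrite mxE.
by apply: analytic_at_sum => i; apply: analytic_atM => //; exact: analytic_at_cst.
Qed.

Lemma analytic_constr (z : R -> St) y : (forall i, analytic_at (fun s => z s i) y) ->
  analytic_at (fun s => constr (z s)) y.
Proof.
move=> hz.
have hQ : analytic_vec (fun s => stQ (z s)) y by move=> j; under eq_fun do rewrite mxE; exact: hz.
have hD : analytic_vec (fun s => stD (z s)) y by move=> j; under eq_fun do rewrite mxE; exact: hz.
have hL := analytic_mulmx L hQ.
have sq (f : R -> R) : analytic_at f y -> analytic_at (fun s => f s * f s) y.
  by move=> h; exact: analytic_atM.
rewrite /constr; apply: analytic_atD; first (apply: analytic_atD; first apply: analytic_atD).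
- by apply: sq; apply: analytic_atB; [exact: analytic_dot|exact: analytic_at_cst].
- by apply: sq; apply: analytic_atB; exact: analytic_dot.
- by apply: sq; apply: analytic_atB; [exact: hz|exact: analytic_dot].
- by apply: sq; apply: analytic_atB; [exact: hz|exact: analytic_at_cst].
Qed.

Lemma analytic_zero_on (I : set R) y1 (h : R -> R) : open I -> I y1 ->
  (forall y, analytic_at h y) -> (forall y, I y -> h y = 0) -> forall y, h y = 0.
Proof.
move=> oI I1 ah hI y.
have itvT : is_interval [set: R] by [].
exact: (analytic_identity itvT (fun y _ => ah y) Logic.I (near_open_set oI I1 hI) (y := y) Logic.I).
Qed.

Theorem global_extension (I : set R) y1 (Q D : R -> 'rV[R]_n) :
  open I -> is_interval I -> I y1 ->
  (forall y, I y -> is_vderive Q y (D y)) ->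
  (forall y, I y -> is_vderive D y
     (dot (Q y *m L) (Q y *m L) *: (e - 3 *: Q y) - Q y *m L *m L)) ->
  (forall y, I y -> dot (Q y) (Q y) = 1) ->
  (forall y, I y -> dot (D y) (D y) = dot (Q y *m L) (Q y *m L)) ->
  exists Q' D' : R -> 'rV[R]_n,
  [/\ forall y, I y -> Q' y = Q y /\ D' y = D y,
      forall y, is_vderive Q' y (D' y),
      forall y, is_vderive D' y
         (dot (Q' y *m L) (Q' y *m L) *: (e - 3 *: Q' y) - Q' y *m L *m L),
      forall y, dot (D' y) (D' y) = dot (Q' y *m L) (Q' y *m L) &
      (forall y, analytic_vec Q' y /\ analytic_vec D' y) /\
      forall y0, dot (Q' y0 *m L) (Q' y0 *m L) = 0 ->
        forall y, dot (Q' y *m L) (Q' y *m L) = 0].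
Proof.
move=> oI itvI I1 dQ dD q1 d1.
pose x y := pack (Q y) (D y) (dot (Q y *m L) (Q y *m L)) 1.
have sx : qsol tensor x I.
  apply/qsolP => y Iy; rewrite /x !st_pack !scale1r; split.
  - by under [X in is_vderive X]eq_fun do rewrite st_pack; exact: dQ.
  - by under [X in is_vderive X]eq_fun do rewrite st_pack; exact: dD.
  - under eq_fun do rewrite st_pack.
    have h := is_vderive_mulmx L (dQ y Iy).
    apply: is_derive_eqv (is_derive_dot h h).
    by rewrite (dotC (D y *m L)); ring.
  - by under eq_fun do rewrite st_pack; exact: is_derive_const.
have cx y : I y -> constr (x y) = 0.
  by move=> Iy; apply/constrP; rewrite /x !st_pack; split => //; [exact: q1|exact: d1].
have [X [sX eX]] := qsol_global oI I1 sx (ltr_pwDl ltr01 image_bound_ge0)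
  analytic_constr cx constr_bound itvI.
have aX y i : analytic_at (fun s => X s i) y.
  exact: (qsol_analytic (openT : open [set: R]) (Logic.I : [set: R] y) sX).
have cX y : constr (X y) = 0.
  move: y; apply: (analytic_zero_on oI I1) => y; first exact: analytic_constr (aX y).
  by move=> Iy; rewrite eX// cx.
have HX y := (qsolP X setT).1 sX y Logic.I.
exists (fun y => stQ (X y)), (fun y => stD (X y)); split.
- by move=> y Iy; rewrite eX// /x !st_pack.
- by move=> y; have [h _ _ _] := HX y; have [_ _ _ k1] := (constrP _).1 (cX y); rewrite k1 scale1r in h.
- move=> y; have [_ h _ _] := HX y; have [_ _ r1 k1] := (constrP _).1 (cX y).
  by rewrite k1 !scale1r r1 in h.
- by move=> y; have [_ ] := (constrP _).1 (cX y).
- split=> [y|y0 z0 y].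
    by split=> j; under eq_fun do rewrite mxE; exact: aX.
  have [_ dd rr kk] := (constrP _).1 (cX y0).
  have QL0 : stQ (X y0) *m L = 0 by exact: dot_eq0.
  have D0 : stD (X y0) = 0 by apply: dot_eq0; rewrite dd z0.
  (* At a zero of |Q L|^2 also D = 0 and r = 0, so the state is a rest point; by uniqueness the
     solution is then constant and the factor vanishes everywhere. *)
  have sz : qsol tensor (fun=> X y0) setT.
    apply/qsolP => s _; rewrite D0 rr z0 QL0 !mul0mx !scaler0 scale0r subrr dot0l mulr0.
    by split; [exact: is_vderive_cst|exact: is_vderive_cst|exact: is_derive_const|exact: is_derive_const].
  have -> // : X y = X y0.
  apply: (qsol_unique (I := setT) (y1 := y0) (z := fun=> X y0) _ sX sz) => //.
Qed.

End GlobalExtension.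

(** * Extension to the plane *)

Section Extend.
Variables (R : realType) (m n : nat) (B : 'M[R]_(m, n)) (flow : R -> 'M[R]_n) (L : 'M[R]_n).
Variables (e : 'rV[R]_n) (Q D : R -> 'rV[R]_n).
Local Notation C := R[i].
Local Notation V := (R[i]^o).
Local Notation r y := (dot (Q y *m L) (Q y *m L)).
Hypotheses
  (flow_dot : forall (u v : 'rV[R]_n) x, (u <= B)%MS -> (v <= B)%MS ->
     dot (u *m flow x) (v *m flow x) = dot u v)
  (flow_derive : forall (u : 'rV[R]_n) x, (u <= B)%MS ->
     is_vderive (fun s => u *m flow s) x (u *m flow x *m L))
  (gen_sub : forall u : 'rV[R]_n, (u <= B)%MS -> (u *m L <= B)%MS)
  (gen_flow : forall (u : 'rV[R]_n) x, (u <= B)%MS -> u *m L *m flow x = u *m flow x *m L)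
  (e_flow : forall x, e *m flow x = e).
Hypotheses (QB : forall y, (Q y <= B)%MS) (DB : forall y, (D y <= B)%MS)
  (dQ : forall y, is_vderive Q y (D y))
  (dD : forall y, is_vderive D y (r y *: (e - 3 *: Q y) - Q y *m L *m L))
  (DD : forall y, dot (D y) (D y) = r y)
  (DQ : forall y, dot (D y) (Q y *m L) = 0).

Definition extension x y := Q y *m flow x.
Local Notation P := extension.

Lemma extension_dx x y : is_vderive (fun s => P s y) x (P x y *m L).
Proof. exact: flow_derive. Qed.

Lemma extension_dxx x y : is_vderive (fun s => P s y *m L) x (P x y *m L *m L).
Proof. exact/is_vderive_mulmx/extension_dx. Qed.

Lemma extension_dy x y : is_vderive (P x) y (D y *m flow x).
Proof. exact/is_vderive_mulmx/dQ. Qed.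

Lemma extension_dyy x y : is_vderive (fun s => D s *m flow x) y
  ((r y *: (e - 3 *: Q y) - Q y *m L *m L) *m flow x).
Proof. exact/is_vderive_mulmx/dD. Qed.

Lemma extension_xx x y : dot (P x y *m L) (P x y *m L) = r y.
Proof. by rewrite -!gen_flow// flow_dot// gen_sub. Qed.

Lemma extension_yy x y : dot (D y *m flow x) (D y *m flow x) = r y.
Proof. by rewrite flow_dot. Qed.

Lemma extension_xy x y : dot (P x y *m L) (D y *m flow x) = 0.
Proof. by rewrite -gen_flow// flow_dot// ?gen_sub// dotC. Qed.

Lemma extension_laplacian x y :
  P x y *m L *m L + (r y *: (e - 3 *: Q y) - Q y *m L *m L) *m flow x =
  r y *: (e - 3 *: P x y).
Proof.
rewrite mulmxBl gen_flow ?gen_sub// gen_flow// -scalemxAl mulmxBl e_flow -scalemxAl.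
by rewrite addrCA subrr addr0.
Qed.

Definition rCk k (f : V -> R) : Prop := Ck_on k setT (fun z => (f z)%:C).

Lemma rCk_cst k (c : R) : rCk k (fun=> c).
Proof. exact/Ck_on_cst/openT. Qed.

Lemma rCkD k (f g : V -> R) : rCk k f -> rCk k g -> rCk k (fun z => f z + g z).
Proof.
move=> hf hg; apply: (Ck_on_ext openT _ (Ck_onD openT hf hg)) => z _ /=.
by rewrite realcD.
Qed.

Lemma rCkM k (f g : V -> R) : rCk k f -> rCk k g -> rCk k (fun z => f z * g z).
Proof.
move=> hf hg; apply: (Ck_on_ext openT _ (Ck_onM openT hf hg)) => z _ /=.
by rewrite realcM.
Qed.

Lemma rCk_sum k l (f : 'I_l -> V -> R) : (forall i, rCk k (f i)) ->
  rCk k (fun z => \sum_i f i z).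
Proof.
elim: l f => [|l IH] f H.
  by rewrite /rCk; under eq_fun do rewrite big_ord0; exact: rCk_cst.
rewrite /rCk; under eq_fun do rewrite big_ord_recl; apply: rCkD; first exact: H.
by apply: IH => i; exact: H.
Qed.

Lemma rCk_ext k (f g : V -> R) : f =1 g -> rCk k f -> rCk k g.
Proof. by move=> /funext ->. Qed.

(** Bootstrapping: when the derivatives of a family are expressed smoothly through the family
    itself, one more order of differentiability is gained for all members at once. *)
Lemma smooth_family (T : Type) (h : T -> V -> C) (dh : T -> V -> V -> C) :
  (forall i z, {for z, continuous (h i : V -> V)}) ->
  (forall i v z, is_cderive (fun t => h i (z + t%:C *: v)) 0 (dh i v z)) ->
  (forall k, (forall i, Ck_on k setT (h i)) -> forall i v, Ck_on k setT (dh i v)) ->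
  forall k i, Ck_on k setT (h i).
Proof.
move=> ch dhP step; elim=> [|k IH] i; first by split => // z _; exact: ch.
apply: (Ck_onS_intro (dh := dh i)); first exact: openT.
- by move=> z _; exact: ch.
- by move=> v z _; exact: dhP.
- by move=> v; exact: step.
Qed.

Lemma is_cderive_im (g : R -> R) (v z : V) dg : is_derive (Im z) 1 g dg ->
  is_cderive (fun t : R => (g (Im (z + t%:C *: v)))%:C) 0 (Im v * dg)%:C.
Proof.
move=> hg; have [_ hi] := is_cderive_line z v.
have hg' : is_derive (Im (z + (0 : R)%:C *: v)) 1 g dg by rewrite line0.
by apply: is_cderive_eq (is_cderive_real (is_derive_comp1 hi hg')) _; rewrite mulrC.
Qed.

Lemma is_cderive_re (g : R -> R) (v z : V) dg : is_derive (Re z) 1 g dg ->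
  is_cderive (fun t : R => (g (Re (z + t%:C *: v)))%:C) 0 (Re v * dg)%:C.
Proof.
move=> hg; have [hr _] := is_cderive_line z v.
have hg' : is_derive (Re (z + (0 : R)%:C *: v)) 1 g dg by rewrite line0.
by apply: is_cderive_eq (is_cderive_real (is_derive_comp1 hr hg')) _; rewrite mulrC.
Qed.

Lemma rCk_mulmx k l l' (A : 'M[R]_(l, l')) (u : V -> 'rV[R]_l) :
  (forall j, rCk k (fun z => u z 0 j)) -> forall j, rCk k (fun z => (u z *m A) 0 j).
Proof.
move=> hu j; apply: (@rCk_ext k (fun z => \sum_i u z 0 i * A i j)).
  by move=> z; rewrite mxE.
by apply: rCk_sum => i; apply: rCkM => //; exact: rCk_cst.
Qed.

Lemma smooth_profile k (i : bool) j : rCk k (fun z => (if i then Q else D) (Im z) 0 j).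
Proof.
pose h (i : bool * 'I_n) (z : V) : C := ((if i.1 then Q else D) (Im z) 0 i.2)%:C.
pose D' y := r y *: (e - 3 *: Q y) - Q y *m L *m L.
pose dh (i : bool * 'I_n) (v z : V) : C := (Im v * (if i.1 then D else D') (Im z) 0 i.2)%:C.
have der (b : bool) y : is_vderive (if b then Q else D) y ((if b then D else D') y).
  by case: b; [exact: dQ|exact: dD].
suff H : forall k i, Ck_on k setT (h i) by exact: (H k (i, j)).
apply: (smooth_family (dh := dh)).
- move=> [b {}j] z; apply: (@continuous_lift_im _ (fun y => (if b then Q else D) y 0 j)).
  exact: is_derive_continuous (der b (Im z) j).
- by move=> [b {}j] v z; apply: is_cderive_im (der b (Im z) j).
- move=> {}k H [b {}j] v.
  have HQ l : rCk k (fun z => Q (Im z) 0 l) by exact: (H (true, l)).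
  have HD l : rCk k (fun z => D (Im z) 0 l) by exact: (H (false, l)).
  have HL l := rCk_mulmx L HQ l.
  apply: (@rCkM k (fun=> Im v) (fun z => (if b then D else D') (Im z) 0 j)); first exact: rCk_cst.
  case: b => //.
  apply: (@rCk_ext k (fun z => r (Im z) * (e 0 j + (- 3) * Q (Im z) 0 j) +
      (- 1) * (Q (Im z) *m L *m L) 0 j)).
    move=> z; rewrite /D'; move: (Q (Im z) *m L *m L) => A.
    by rewrite !mxE; ring.
  apply: rCkD; first apply: rCkM.
  + by apply: rCk_sum => l; apply: rCkM; exact: HL.
  + by apply: rCkD; [exact: rCk_cst|apply: rCkM => //; exact: rCk_cst].
  + by apply: rCkM; [exact: rCk_cst|exact: (rCk_mulmx L HL j)].
Qed.

(** The product with [B] is taken because the flow equation is available only on the row space of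
    [B]. *)
Lemma smooth_flow k i j : rCk k (fun z => (B *m flow (Re z)) i j).
Proof.
pose h (a : 'I_m * 'I_n) (z : V) : C := ((B *m flow (Re z)) a.1 a.2)%:C.
pose dh (a : 'I_m * 'I_n) (v z : V) : C := (Re v * (B *m flow (Re z) *m L) a.1 a.2)%:C.
have der (a : 'I_m * 'I_n) (x : R) : is_derive x 1 (fun x => (B *m flow x) a.1 a.2) ((B *m flow x *m L) a.1 a.2).
  have := flow_derive x (row_sub a.1 B) a.2.
  rewrite -!row_mul mxE.
  by have -> : (fun s => (row a.1 B *m flow s) 0 a.2) = fun s => (B *m flow s) a.1 a.2
    by apply/funext => s; rewrite -row_mul mxE.
suff H : forall k a, Ck_on k setT (h a) by exact: (H k (i, j)).
apply: (smooth_family (dh := dh)).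
- move=> a z; apply: (@continuous_lift_re _ (fun x => (B *m flow x) a.1 a.2)).
  exact: is_derive_continuous (der a (Re z)).
- by move=> a v z; apply: is_cderive_re (der a (Re z)).
- move=> {}k H a v.
  apply: (@rCkM k (fun=> Re v) (fun z => (B *m flow (Re z) *m L) a.1 a.2)); first exact: rCk_cst.
  apply: (@rCk_ext k (fun z => \sum_l (B *m flow (Re z)) a.1 l * L l a.2)).
    by move=> z; rewrite [RHS]mxE.
  by apply: rCk_sum => l; apply: rCkM; [exact: (H (a.1, l))|exact: rCk_cst].
Qed.

Lemma smooth_extension k j : rCk k (fun z => P (Re z) (Im z) 0 j).
Proof.
apply: (@rCk_ext k (fun z => \sum_i (Q (Im z) *m pinvmx B) 0 i * (B *m flow (Re z)) i j)).
  (* As [Q] lies in the span, Q Phi = (Q B^+) (B Phi), which separates the y-dependence from the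
     x-dependence. *)
  move=> z; rewrite /P -[in RHS](mulmxKpV (QB (Im z))) -(mulmxA _ B).
  by rewrite [RHS]mxE.
apply: rCk_sum => i; apply: rCkM; last exact: smooth_flow.
by apply: rCk_mulmx => l; exact: (smooth_profile k true l).
Qed.

End Extend.

(** * Strips, scalar products under isometries, and equations in real coordinates *)

Section Bridge.
Variable R : realType.
Local Notation C := R[i].
Local Notation V := (R[i]^o).
Implicit Types (w z v : V) (p : V -> 'M[C]_3).

Lemma norm_ew w : `|ew w : C| = (expR (- Im w))%:C.
Proof.
have := csq_ew w; rewrite /csq => h; move: h; case: (ew w) => a b /= h.
by rewrite normc_def /= h sqrtr_sqr ger0_norm// expR_ge0.
Qed.

Lemma open_im_preimage (I : set R) : open I -> open ([set w | I (Im w)] : set V).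
Proof.
move=> oI; rewrite openE => w Iw; have [d d0 hd] := open_cball_sub oI Iw.
apply/nbhs_ballP; exists d%:C; first by rewrite /= ltcR.
move=> z; rewrite -ball_normE /= => /normc_ltP[_ h]; apply: hd; rewrite /cball /=.
by move: h; rewrite distrC; case: (w) (z) => [a b] [c d'].
Qed.

Lemma open_re_itv (a b : R) : open ([set z | a < Re z < b] : set V).
Proof.
rewrite openE => z /andP[az zb].
pose d := Num.min (Re z - a) (b - Re z).
have d0 : 0 < d by rewrite lt_min !subr_gt0 az.
apply/nbhs_ballP; exists d%:C; first by rewrite /= ltcR.
move=> w; rewrite -ball_normE /= => /normc_ltP[h _].
have {h} : `|Re z - Re w| < d by move: h; case: (z) (w) => ? ? [? ?].
by rewrite lt_min !ltr_norml => /andP[/andP[_ h1] /andP[h2 _]]; apply/andP; split; lra.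
Qed.

Lemma open_csq_itv (a b : R) : open ([set z | a < csq z < b] : set V).
Proof.
have nE (u : V) : Re (u * (u)^*%C) = csq u by case: u => x y; rewrite /csq /=; ring.
pose W : set V := [set z | a < Re z < b].
pose U : set V := (fun z : V => z * (z)^*%C : V) @^-1` W.
have oW : open W by exact: open_re_itv.
have oU : open U.
  apply: open_comp oW => z _.
  apply: (Ck_on_continuous (U := setT) (k := 0) _ I).
  apply: Ck_onM; [exact: openT|exact/smooth_id/openT|].
  by apply: Ck_on_conj; [exact: openT|exact/smooth_id/openT].
suff -> : ([set z | a < csq z < b] : set V) = U by [].
by apply/funext => z; rewrite /U /W /preimage /mkset nE.
Qed.

Lemma norm_csq_lt (z : V) (a : R) : 0 <= a -> (`|z : C| < a%:C) = (csq z < a ^+ 2).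
Proof.
move=> a0; case: z => x y; rewrite normc_def /= ltcR /csq /=.
by rewrite -(@ltr_sqr _ (Num.sqrt _)) ?nnegrE ?sqrtr_ge0// sqr_sqrtr// addr_ge0 ?sqr_ge0.
Qed.

Lemma norm_csq_gt (z : V) (a : R) : 0 <= a -> (a%:C < `|z : C|) = (a ^+ 2 < csq z).
Proof.
move=> a0; case: z => x y; rewrite normc_def /= ltcR /csq /=.
by rewrite -(@ltr_sqr _ a) ?nnegrE ?sqrtr_ge0// sqr_sqrtr// addr_ge0 ?sqr_ge0.
Qed.

Lemma norm_csq_unit (z : V) : (0 < `|z : C| < 1) = (0 < csq z < 1).
Proof.
have := norm_csq_gt z (lexx 0); have := norm_csq_lt z ler01.
by rewrite expr1n expr0n /= => -> ->.
Qed.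

(* In the coordinate [w] with [z = exp (i w)], each of the three domains is a
   horizontal strip. *)
Lemma domain_strip (M : set V) : M = punctured_plane R \/ M = punctured_disk R \/
    (exists r : R, 0 < r < 1 /\ M = annulus r) ->
  exists (I : set R) (y1 : R), [/\ open M, open I, is_interval I, I y1 &
    (forall z, M z -> z != 0) /\ forall w, M (ew w) <-> I (Im w)].
Proof.
case=> [->|[->|[r [/andP[r0 r1] ->]]]].
- exists setT, 0; split => //; [exact: open_neq0C|exact: openT|].
  by split=> [z //|w]; split => // _; exact: ew_neq0.
(* The modulus of exp (i w) is exp (- Im w), so the unit disk corresponds to Im w > 0. *)
- exists [set y | 0 < y], 1; split.
  + have -> : punctured_disk R = [set z : V | 0 < csq z < 1].
      by apply/funext => z; rewrite /punctured_disk /mkset norm_csq_unit.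
    exact: open_csq_itv.
  + exact: open_gt.
  + by move=> a b /= a0 b0 c /andP[ac _]; exact: lt_le_trans ac.
  + exact: ltr01.
  + split=> [z|w]; first by rewrite /punctured_disk /= normr_gt0 => /andP[].
    rewrite /punctured_disk /= norm_ew -[1]/(1%:C) -[0]/(0%:C) !ltcR expR_gt0 /=.
    by rewrite -[X in _ < X]expR0 ltr_expR oppr_lt0.
- exists [set y | ln r < y < - ln r], 0.
  have lr : ln r < 0 by rewrite ln_lt0// r0.
  have ri0 : 0 < r^-1 by rewrite invr_gt0.
  split.
  + have -> : annulus r = [set z : V | r ^+ 2 < csq z < r^-1 ^+ 2].
      by apply/funext => z; rewrite /annulus /mkset norm_csq_gt ?(ltW r0)// norm_csq_lt// ltW.
    exact: open_csq_itv.
  + rewrite (_ : mkset _ = [set y | ln r < y] `&` [set y | y < - ln r]).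
      by apply: openI; [exact: open_gt|exact: open_lt].
    by apply/seteqP; split => y /= => [/andP[]|[-> ->]].
  + move=> a b /= /andP[a1 a2] /andP[b1 b2] c /andP[c1 c2].
    by rewrite (lt_le_trans a1 c1) (le_lt_trans c2 b2).
  + by rewrite /= lr oppr_gt0.
  + split=> [z|w].
      rewrite /annulus /= => /andP[h _]; rewrite -normr_gt0; apply: lt_trans h.
      by rewrite ltcR.
    rewrite /annulus /= norm_ew !ltcR -{1 2}[r]lnK ?posrE// -expRN !ltr_expR.
    by rewrite ltrN2 ltrNr andbC.
Qed.

(** The comparison for [Rt t] gives one inequality, and that for its inverse [Rt (- t)] the
    other. *)
Lemma mdot_isometry (Rt : R -> CP2 R -> CP2 R) t (L L' : CP2 R) : one_parameter_isometries Rt ->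
  mdot (pt (Rt t L)) (pt (Rt t L')) = mdot (pt L) (pt L').
Proof.
move=> [iso R0 RD _]; have pf u : preserves_fs (Rt u) by case: (iso u) => psi [].
apply: le_anti; rewrite mdot_isometry_le ?andbT//.
have := mdot_isometry_le (Rt t L) (Rt t L') (pf (- t)).
by rewrite -!RD addNr !R0.
Qed.

Lemma mdot_pt (L : CP2 R) : mdot (pt L) (pt L) = 1.
Proof.
have [F F0 ->] := CP2_line L; rewrite pt_line// mdot_proj// hdotE /csq /= expr0n addr0 expr2.
by rewrite divff// mulf_neq0// gt_eqF// nsq_gt0.
Qed.

(** Pairing with the identity computes the trace, which is 1 for a projector on a line. *)
Lemma mdot_id (L : CP2 R) : mdot 1%:M (pt L) = 1.
Proof.
have [F F0 ->] := CP2_line L; rewrite pt_line//; have [_ _ tr] := isproj_projm F0.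
have := congr1 (@complex.Re R) tr; rewrite raddf_sum /= => <-.
apply: eq_bigr => i _; rewrite (bigD1 i)//= big1 => [|j ji].
  by rewrite addr0 mxE eqxx mul1r; case: (projm F i i).
by rewrite mxE eq_sym (negbTE ji) mul0r.
Qed.

Lemma plane_eta (w : V) : (Re w +i* Im w) = w. Proof. by case: w. Qed.

Lemma plane_right (x y t : R) : (x +i* y : V) + t%:C *: (1 : V) = (x + t) +i* y.
Proof. by apply: complexP; rewrite /GRing.scale /= ?re_imE /=; ring. Qed.

Lemma plane_up (x y t : R) : (x +i* y : V) + t%:C *: ('i%C : V) = x +i* (y + t).
Proof. by apply: complexP; rewrite /GRing.scale /= ?re_imE /=; ring. Qed.

Lemma pmx_derive_x U p x y : (forall i j, Ck_on 1 U (fun z => p z i j)) -> U (x +i* y) ->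
  is_vderive (fun s => mvec (p (s +i* y))) x (mvec (pmx p (1 : V) (x +i* y))).
Proof.
move=> Cp Uw; apply/is_vderive_trans.
by apply: is_vderive_ext (is_vderive_pmx (1 : V) Cp Uw) => s; rewrite plane_right.
Qed.

Lemma pmx_derive_y U p x y : (forall i j, Ck_on 1 U (fun z => p z i j)) -> U (x +i* y) ->
  is_vderive (fun s => mvec (p (x +i* s))) y (mvec (pmx p ('i%C : V) (x +i* y))).
Proof.
move=> Cp Uw; apply/is_vderive_trans.
by apply: is_vderive_ext (is_vderive_pmx ('i%C : V) Cp Uw) => s; rewrite plane_up.
Qed.

Lemma pmx_of_x p x y du : is_vderive (fun s => mvec (p (s +i* y))) x du ->
  mvec (pmx p (1 : V) (x +i* y)) = du.
Proof.
move=> /is_vderive_trans h; apply: pmx_of_vderive.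
by apply: is_vderive_ext h => s; rewrite plane_right.
Qed.

Lemma pmx_of_y p x y du : is_vderive (fun s => mvec (p (x +i* s))) y du ->
  mvec (pmx p ('i%C : V) (x +i* y)) = du.
Proof.
move=> /is_vderive_trans h; apply: pmx_of_vderive.
by apply: is_vderive_ext h => s; rewrite plane_up.
Qed.

Lemma pmx2E p v z i j :
  rderive v (rderive v (fun y => p y i j)) z = pmx (pmx p v) v z i j.
Proof. by rewrite mxE; congr rderive; apply/funext => y; rewrite mxE. Qed.

Lemma Ck_on_pmx k U p v : (forall i j, Ck_on k.+1 U (fun z => p z i j)) ->
  forall i j, Ck_on k U (fun z => pmx p v z i j).
Proof.
move=> Cp i j; have -> : (fun z => pmx p v z i j) = rderive v (fun z => p z i j).
  by apply/funext => z; rewrite mxE.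
exact: Ck_on_rderive.
Qed.

Lemma laplacian_vec p z (lam s t : R) :
  (forall i j, pdx (pdx (fun y => p y i j)) z + pdy (pdy (fun y => p y i j)) z =
    (2 * lam)%:C * ((i == j)%:R - 3 * p z i j) +
    s%:C * pmx p (1 : V) z i j + t%:C * pmx p ('i%C : V) z i j) <->
  mvec (pmx (pmx p (1 : V)) (1 : V) z) + mvec (pmx (pmx p ('i%C : V)) ('i%C : V) z) =
  (2 * lam) *: (mvec 1%:M - 3 *: mvec (p z)) + s *: mvec (pmx p (1 : V) z) +
    t *: mvec (pmx p ('i%C : V) z).
Proof.
rewrite -scaleN1r scalerA -!mvecZ -!mvecD -!mvecZ -!mvecD.
have E i j : (2 * lam)%:C * ((i == j)%:R - 3 * p z i j) +
    s%:C * pmx p (1 : V) z i j + t%:C * pmx p ('i%C : V) z i j =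
    ((2 * lam)%:C *: (1%:M + (-1 * 3)%:C *: p z) + s%:C *: pmx p (1 : V) z +
      t%:C *: pmx p ('i%C : V) z) i j.
  move: (pmx p (1 : V) z) (pmx p ('i%C : V) z) (p z) => X Y P.
  have c3 : (-1 * 3 : R)%:C = - 3 :> C by apply: complexP; rewrite !re_imE /=; ring.
  by rewrite !mxE c3; ring.
have E2 i j : pdx (pdx (fun y => p y i j)) z + pdy (pdy (fun y => p y i j)) z =
    (pmx (pmx p (1 : V)) (1 : V) z + pmx (pmx p ('i%C : V)) ('i%C : V) z) i j.
  have h := congr2 +%R (pmx2E p (1 : V) z i j) (pmx2E p ('i%C : V) z i j).
  by rewrite [RHS]mxE; exact: h.
split=> [H|/(can_inj (@mvecK R)) H i j].
  by congr mvec; apply/matrixP => i j; exact: (etrans (esym (E2 i j)) (etrans (H i j) (E i j))).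
exact: (etrans (E2 i j) (etrans (congr1 (fun A : 'M[C]_3 => A i j) H) (esym (E i j)))).
Qed.

End Bridge.

(** * Analytic continuation of the projector equations *)

Section ComplexAnalytic.
Variable R : realType.
Local Notation C := R[i].
Implicit Types h g : R -> C.

Definition canalytic h y := analytic_at (fun s => Re (h s)) y /\ analytic_at (fun s => Im (h s)) y.

Lemma canalyticM h g y : canalytic h y -> canalytic g y -> canalytic (fun s => h s * g s) y.
Proof.
move=> [h1 h2] [g1 g2]; split.
  under eq_fun do rewrite re_mul.
  by apply: analytic_atB; exact: analytic_atM.
under eq_fun do rewrite im_mul.
by apply: analytic_atD; exact: analytic_atM.
Qed.

Lemma canalyticB h g y : canalytic h y -> canalytic g y -> canalytic (fun s => h s - g s) y.
Proof.
move=> [h1 h2] [g1 g2]; split.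
  by under eq_fun do rewrite !re_imE; exact: analytic_atB.
by under eq_fun do rewrite !re_imE; exact: analytic_atB.
Qed.

Lemma canalytic_conj h y : canalytic h y -> canalytic (fun s => (h s)^*%C) y.
Proof.
move=> [h1 h2]; split; first by under eq_fun do rewrite re_conj.
under eq_fun do rewrite im_conj.
apply: (analytic_at_ext (r := 1) ltr01 _ (analytic_atB (analytic_at_cst 0 y) h2)).
by move=> z _; rewrite sub0r.
Qed.

Lemma canalytic_cst (c : C) y : canalytic (fun=> c) y.
Proof. by split; exact: analytic_at_cst. Qed.

Lemma canalytic_sum n (h : 'I_n -> R -> C) y : (forall i, canalytic (h i) y) ->
  canalytic (fun s => \sum_i h i s) y.
Proof.
move=> H; split; under eq_fun do rewrite raddf_sum; apply: analytic_at_sum => i; by have [] := H i.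
Qed.

Lemma canalytic_zero_on (I : set R) y1 h : open I -> I y1 -> (forall y, canalytic h y) ->
  (forall y, I y -> h y = 0) -> forall y, h y = 0.
Proof.
move=> oI I1 ah hI y; apply: complexP.
  by apply: (analytic_zero_on oI I1 (h := fun s => Re (h s))) => [z|z /hI -> //]; case: (ah z).
by apply: (analytic_zero_on oI I1 (h := fun s => Im (h s))) => [z|z /hI -> //]; case: (ah z).
Qed.

Lemma canalytic_unvec (u : R -> 'rV[R]_pdim) y : analytic_vec u y ->
  forall i j, canalytic (fun s => unvec (u s) i j) y.
Proof. by move=> hu i j; split; under eq_fun do rewrite mxE /=; exact: hu. Qed.

Lemma isproj_zero_on (I : set R) y1 (u : R -> 'rV[R]_pdim) : open I -> I y1 ->
  (forall y, analytic_vec u y) -> (forall y, I y -> isproj (unvec (u y))) ->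
  forall y, isproj (unvec (u y)).
Proof.
move=> oI I1 au hI y; have c z i j := canalytic_unvec (au z) i j.
split=> [i j|i j k l|]; apply/eqP; rewrite -subr_eq0; apply/eqP; move: y;
  apply: (canalytic_zero_on oI I1) => y.
- by apply: canalyticB => //; exact: canalytic_conj.
- by move=> /hI[H _ _]; rewrite -H subrr.
- by apply: canalyticB; exact: canalyticM.
- by move=> /hI[_ H _]; rewrite (H i j k l) subrr.
- by apply: canalyticB; [exact: canalytic_sum|exact: canalytic_cst].
- by move=> /hI[_ _ ->]; rewrite subrr.
Qed.

End ComplexAnalytic.

Lemma projector_eqs_of_vec (R : realType) (p : R[i]^o -> 'M[R[i]]_3) (z : R[i]^o) (r : R)
    (X Y XX YY : 'rV[R]_pdim) :
  mvec (pmx p (1 : R[i]^o) z) = X -> mvec (pmx p ('i%C : R[i]^o) z) = Y ->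
  mvec (pmx (pmx p (1 : R[i]^o)) (1 : R[i]^o) z) = XX ->
  mvec (pmx (pmx p ('i%C : R[i]^o)) ('i%C : R[i]^o) z) = YY ->
  0 < r -> dot X X = r -> dot Y Y = r -> dot X Y = 0 ->
  XX + YY = r *: (mvec 1%:M - 3 *: mvec (p z)) ->
  projector_eqs p z (r / 2) 0 0.
Proof.
move=> hX hY hXX hYY r0 xx yy xy lap; have r2 : 2 * (r / 2) = r by field.
split; first by rewrite divr_gt0.
- by rewrite -dot_mvec hX r2.
- by rewrite -dot_mvec hY r2.
- by rewrite -dot_mvec hX hY.
- have E (A X' Y' : 'rV[R]_pdim) : r *: A = (2 * (r / 2)) *: A + 0 *: X' + 0 *: Y'.
    by rewrite r2 !scale0r !addr0.
  apply: (laplacian_vec p z (r / 2) 0 0).2.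
  exact: (etrans (congr2 +%R hXX hYY) (etrans lap (E _ _ _))).
Qed.

(** * The extended surface in the strip coordinate *)

Section Assembly.
Variables (R : realType) (M : set R[i]^o) (f : R[i]^o -> CP2 R) (I : set R) (y1 : R)
  (Rt : R -> CP2 R -> CP2 R).
Local Notation C := R[i].
Local Notation V := (R[i]^o).
Hypotheses (oM : open M) (oI : open I) (itvI : is_interval I) (I1 : I y1)
  (MI : forall w, M (ew w) <-> I (Im w))
  (mli : minimal_lagrangian_immersion M f) (RtP : one_parameter_isometries Rt)
  (fRt : forall z, M z -> forall t, f (rotation t z) = Rt t (f z)).

Let S : set V := [set w | I (Im w)].
Let p (w : V) : 'M[C]_3 := pt (f (ew w)).

Let oS : open S. Proof. exact: open_im_preimage. Qed.

Let SM w : S w -> M (ew w). Proof. by move=> Sw; apply/MI. Qed.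

Let p_smooth k i j : Ck_on k S (fun w => p w i j).
Proof.
have [sf _] := projector_of_mli mli.
by apply: (Ck_on_comp oS oM SM _ (sf k i j)) => k'; exact: Ck_on_sub (smooth_ew _ k').
Qed.

Let p_eqs : exists lst : V -> R * R * R,
  forall w, S w -> projector_eqs p w (lst w).1.1 (lst w).1.2 (lst w).2.
Proof.
have [sf ef] := projector_of_mli mli.
have H w : exists lst : R * R * R, S w -> projector_eqs p w lst.1.1 lst.1.2 lst.2.
  (* Outside the strip the coefficients are dummies. *)
  have [Sw|nS] := pselect (S w); last by exists (0, 0, 0).
  have [lam [s [t h]]] := ef _ (SM Sw).
  have [s' [t' h']] := projector_eqs_pullback oM oS SM (sf 2%N) Sw h.
  by exists (lam * csq (ew w), s', t') => _.
by have [lst hl] := choice H; exists lst.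
Qed.

Let q x y := mvec (p (x +i* y)).

Let q_translate x t y : I y -> q (x + t) y = mvec (pt (Rt t (f (ew (x +i* y))))).
Proof.
move=> Iy; rewrite /q /p -fRt; last exact: SM.
rewrite -ew_translation /translation; congr (mvec (pt (f (ew _)))).
by apply: complexP; rewrite !re_imE /= ?addr0.
Qed.

Let gram x x1 z1 x2 z2 : I z1 -> I z2 ->
  dot (q (x1 + x) z1) (q (x2 + x) z2) = dot (q x1 z1) (q x2 z2).
Proof.
by move=> i1 i2; rewrite !q_translate// !dot_mvec mdot_isometry.
Qed.

Let q_period x y : q (x + 2 * pi) y = q x y.
Proof.
rewrite /q /p; congr (mvec (pt (f _))); rewrite !ewE /=.
have E : 2 * pi = pi *+ 2 :> R by rewrite mulrC mulr_natr.
by rewrite E cosD2pi sinD2pi.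
Qed.

Let qx x y := mvec (pmx p (1 : V) (x +i* y)).
Let qy x y := mvec (pmx p ('i%C : V) (x +i* y)).
Let qxx x y := mvec (pmx (pmx p (1 : V)) (1 : V) (x +i* y)).
Let qyy x y := mvec (pmx (pmx p ('i%C : V)) ('i%C : V) (x +i* y)).

Let dx x y : I y -> is_vderive (fun s => q s y) x (qx x y).
Proof. by move=> Iy; exact: (pmx_derive_x (p_smooth 1)). Qed.
Let dy x y : I y -> is_vderive (q x) y (qy x y).
Proof. by move=> Iy; exact: (pmx_derive_y (p_smooth 1)). Qed.
Let dxx x y : I y -> is_vderive (fun s => qx s y) x (qxx x y).
Proof. by move=> Iy; exact: (pmx_derive_x (Ck_on_pmx (1 : V) (p_smooth 2))). Qed.
Let dyy x y : I y -> is_vderive (qy x) y (qyy x y).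
Proof. by move=> Iy; exact: (pmx_derive_y (Ck_on_pmx ('i%C : V) (p_smooth 2))). Qed.

Let e : 'rV[R]_pdim := mvec 1%:M.

Let qq x y : I y -> dot (q x y) (q x y) = 1.
Proof. by move=> _; rewrite dot_mvec mdot_pt. Qed.

Let eq1 x y : I y -> dot e (q x y) = 1.
Proof. by move=> _; rewrite dot_mvec mdot_id. Qed.

(** The isometries agree with the linear flow at every line whose projector lies in the span, not
    only on the given surface; this yields equivariance of the extension under the same group. *)
Lemma isometry_on_span m (pp : 'I_m -> R * R) t (A : CP2 R) : (forall i, I (pp i).2) ->
  (mvec (pt A) <= rows_at q pp 0)%MS ->
  mvec (pt (Rt t A)) = mvec (pt A) *m flow q pp t.
Proof.
move=> Ip sA; rewrite [RHS]mulmxA; have E := mulmxKpV sA.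
apply: (gram_rel (x := mvec (pt A)) (B := rows_at q pp 0)) (esym E).
- by rewrite !dot_mvec !mdot_pt.
- apply/rowP => i; rewrite !mul_tr_rows !rowK addr0 q_translate//.
  by rewrite !dot_mvec mdot_isometry.
- by rewrite (rows_gram gram Ip).
Qed.

(** The map sends w to the line whose projector is Q (Im w) Phi (Re w). Since a line is determined
    by its projector, each property reduces to an identity between vectors of the span. *)
Theorem extension_exists : exists F : V -> CP2 R,
  [/\ forall k i j, Ck_on k setT (fun w => pt (F w) i j),
      forall w, exists lam, projector_eqs (fun w => pt (F w)) w lam 0 0,
      forall w, S w -> F w = f (ew w),
      forall w t, F (translation t w) = Rt t (F w) &
      forall w, F (w + (2 * pi)%:C) = F w].
Proof.
have [lst eqs] := p_eqs.
pose lam x y := (lst (x +i* y)).1.1.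
pose s x y := (lst (x +i* y)).1.2.
pose t x y := (lst (x +i* y)).2.
have lam0 x y : I y -> 0 < lam x y by move=> Iy; have [] := eqs (x +i* y) Iy.
have exx x y : I y -> dot (qx x y) (qx x y) = 2 * lam x y.
  by move=> Iy; rewrite dot_mvec; have [_ h _ _ _] := eqs (x +i* y) Iy.
have eyy x y : I y -> dot (qy x y) (qy x y) = 2 * lam x y.
  by move=> Iy; rewrite dot_mvec; have [_ _ h _ _] := eqs (x +i* y) Iy.
have exy x y : I y -> dot (qx x y) (qy x y) = 0.
  by move=> Iy; rewrite dot_mvec; have [_ _ _ h _] := eqs (x +i* y) Iy.
have lapl x y : I y -> qxx x y + qyy x y =
    (2 * lam x y) *: (e - 3 *: q x y) + s x y *: qx x y + t x y *: qy x y.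
  by move=> Iy; have [_ _ _ _ h] := eqs (x +i* y) Iy; exact: ((laplacian_vec _ _ _ _ _).1 h).
have [m [pp [Ip span]]] := span_points I q.
set B := rows_at q pp 0 in span.
pose L := flow_gen q qx pp; pose Phi := flow q pp.
have fdot := flow_dot gram Ip span; have fder := flow_derive gram Ip span dx.
have gsub := gen_sub gram Ip span dx; have gflow := gen_flow gram Ip span dx.
have ODE y : I y -> is_vderive (qy 0) y
    (dot (q 0 y *m L) (q 0 y *m L) *: (e - 3 *: q 0 y) - q 0 y *m L *m L).
  move=> Iy; apply: is_vderive_eq (dyy 0 Iy).
  rewrite (qyyE oI gram Ip span dx dxx dy dyy qq eq1 lam0 exx eyy exy lapl 0 Iy).
  by rewrite (lamE gram Ip span dx exx 0 Iy).
have DD0 y : I y -> dot (qy 0 y) (qy 0 y) = dot (q 0 y *m L) (q 0 y *m L).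
  by move=> Iy; rewrite eyy// (lamE gram Ip span dx exx 0 Iy).
have [Q [D [QDI dQ dD DD [an pos]]]] :=
  global_extension oI itvI I1 (fun y => @dy 0 y) ODE (@qq 0) DD0.
have QB y : (Q y <= B)%MS.
  rewrite submxE; apply/eqP/rowP => j; rewrite [RHS]mxE; move: y.
  apply: (analytic_zero_on oI I1) => y; first by apply: analytic_mulmx; have [] := an y.
  by move=> Iy; have [-> _] := QDI y Iy; have := span 0 y Iy; rewrite submxE => /eqP ->; rewrite mxE.
have DB y : (D y <= B)%MS.
  by apply: is_vderive_sub (dQ y) _; near=> z; exact: QB.
have DQ y : dot (D y) (Q y *m L) = 0.
  move: y; apply: (analytic_zero_on oI I1) => y.
    by have [aQ aD] := an y; apply: analytic_dot => //; exact: analytic_mulmx.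
  move=> Iy; have [-> ->] := QDI y Iy.
  by rewrite dotC -(q_gen gram Ip span dx)// exy.
have eF x : e *m Phi x = e.
  exact: (e_flow oI gram Ip span dx dxx dy dyy qq eq1 lam0 exx eyy exy lapl x I1).
pose P := extension Phi Q.
have PI x y : I y -> P x y = q x y.
  by move=> Iy; rewrite /P /extension; have [-> _] := QDI y Iy; rewrite -(q_flow gram Ip span)// add0r.
(* A zero anywhere would force a zero at [y1], where the conformal factor of the given immersion is
   positive. *)
have rpos y : 0 < dot (Q y *m L) (Q y *m L).
  rewrite lt_neqAle eq_sym sumr_ge0 ?andbT => [|j _]; last by rewrite -expr2 sqr_ge0.
  apply/eqP => /pos/(_ y1); have [-> _] := QDI y1 I1.
  rewrite -(lamE gram Ip span dx exx 0 I1) => /eqP; rewrite mulf_eq0 pnatr_eq0 /=.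
  by rewrite (gt_eqF (lam0 0 y1 I1)).
have prj x y : isproj (unvec (P x y)).
  move: y; apply: (isproj_zero_on oI I1) => y.
    by apply: analytic_mulmx; have [] := an y.
  move=> Iy; rewrite PI// mvecK /p.
  by have [G G0 ->] := CP2_line (f (ew (x +i* y))); rewrite pt_line//; exact: isproj_projm.
(* The projector equations hold on the whole plane, so each value is the projector of some line. *)
have HF (w : V) : exists A : CP2 R, mvec (pt A) = P (Re w) (Im w).
  have [G G0 e1] := isprojP (prj (Re w) (Im w)).
  by exists (line G); rewrite pt_line// -e1 unvecK.
have [F hF] := choice HF.
have pt_eq (A A' : CP2 R) : mvec (pt A) = mvec (pt A') -> A = A'.
  by move/(can_inj (@mvecK R))/pt_inj.
exists F; split.
- move=> k i j.
  have -> : (fun w => pt (F w) i j) = fun w => (P (Re w) (Im w) 0 (enum_rank (i, j, false)))%:C +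
      'i%C * (P (Re w) (Im w) 0 (enum_rank (i, j, true)))%:C.
    apply/funext => w; rewrite -[pt (F w)]mvecK hF mxE.
    by apply: complexP; rewrite !re_imE /=; ring.
  have sm := smooth_extension fder QB dQ dD k.
  apply: Ck_onD; [exact: openT|exact: sm|].
  by apply: Ck_onM; [exact: openT|exact/Ck_on_cst/openT|exact: sm].
- pose pv (w : V) := pt (F w); move=> w; pose r := dot (Q (Im w) *m L) (Q (Im w) *m L).
  have hx (z : V) : mvec (pmx pv (1 : V) z) = P (Re z) (Im z) *m L.
    rewrite -[z in pmx _ _ z]plane_eta; apply: pmx_of_x.
    by apply: is_vderive_ext (extension_dx fder QB (Re z) (Im z)) => u; rewrite hF.
  have hy (z : V) : mvec (pmx pv ('i%C : V) z) = D (Im z) *m Phi (Re z).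
    rewrite -[z in pmx _ _ z]plane_eta; apply: pmx_of_y.
    by apply: is_vderive_ext (extension_dy Phi dQ (Re z) (Im z)) => u; rewrite hF.
  have hxx : mvec (pmx (pmx pv (1 : V)) (1 : V) w) = P (Re w) (Im w) *m L *m L.
    rewrite -[w in pmx _ _ w]plane_eta; apply: pmx_of_x.
    by apply: is_vderive_ext (extension_dxx fder QB (Re w) (Im w)) => u; rewrite hx.
  have hyy : mvec (pmx (pmx pv ('i%C : V)) ('i%C : V) w) =
      (r *: (e - 3 *: Q (Im w)) - Q (Im w) *m L *m L) *m Phi (Re w).
    rewrite -[w in pmx _ _ w]plane_eta; apply: pmx_of_y.
    by apply: is_vderive_ext (extension_dyy Phi dD (Re w) (Im w)) => u; rewrite hy.
  exists (r / 2); apply: (projector_eqs_of_vec (hx w) (hy w) hxx hyy (rpos _)).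
  + exact: (extension_xx fdot gsub gflow QB).
  + exact: (extension_yy fdot DB DD).
  + exact: (extension_xy fdot gsub gflow QB DB DQ).
  + rewrite (hF w); exact: (extension_laplacian gsub gflow eF QB).
- move=> w Sw; apply: pt_eq; rewrite hF PI// /q plane_eta//.
- move=> w u; apply: pt_eq; rewrite (isometry_on_span _ Ip); last first.
    by rewrite hF; exact: (flow_sub Ip span _ (QB _)).
  rewrite !hF /P /extension (flow_add gram Ip span)//.
  by rewrite /translation; case: (w) => a b /=; rewrite addr0.
- move=> w; apply: pt_eq; rewrite !hF /P /extension.
  have -> : Re (w + (2 * pi)%:C) = 2 * pi + Re w by case: (w) => a b /=; rewrite addrC.
  have -> : Im (w + (2 * pi)%:C) = Im w by case: (w) => a b /=; rewrite addr0.
  have per : Q (Im w) *m Phi (2 * pi) = Q (Im w).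
    exact: (flow_period Ip (fun x y _ => q_period x y) (QB _)).
  by rewrite -(flow_add gram Ip span _ _ (QB _)) per.
Unshelve. all: by end_near. Qed.

End Assembly.

Theorem theorem4p3 (R : realType) (M : set R[i]^o)
    (hM : M = punctured_plane R \/ M = punctured_disk R \/
          exists r : R, 0 < r < 1 /\ M = annulus r)
    (f : R[i]^o -> CP2 R)
    (f_mli : minimal_lagrangian_immersion M f)
    (f_rot : rotationally_equivariant M f) :
  exists fhat : R[i]^o -> CP2 R,
    [/\ minimal_lagrangian_immersion (punctured_plane R) fhat,
        rotationally_equivariant (punctured_plane R) fhat,
        forall z, M z -> fhat z = f z &
        exists ftilde : R[i]^o -> CP2 R,
          [/\ minimal_lagrangian_immersion [set: R[i]^o] ftilde,
              translationally_equivariant [set: R[i]^o] ftilde,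
              forall w : R[i]^o, ftilde (w + (2 * pi)%:C) = ftilde w &
              forall w : R[i]^o, fhat (cexp ('i%C * w)) = ftilde w]].
Proof.
have [I [y1 [oM oI itvI I1 [M0 MI]]]] := domain_strip hM.
have [Rt [RtP fRt]] := f_rot.
have [F [smF eqF FI FR Fper]] := extension_exists oM oI itvI I1 MI f_mli RtP fRt.
(* An arbitrary branch of the inverse of exp (i w), with dummy value 0 at the origin; no continuity
   is asked of it. *)
have ex (z : R[i]^o) : exists w : R[i]^o, z != 0 -> ew w = z.
  have [z0|z0] := pselect (z != 0); last by exists 0.
  by have [w e] := ew_surj z0; exists w.
have [lg lgK] := choice ex.
pose fhat z := F (lg z).
(* Periodicity makes the descended map independent of the branch. *)
have F_ew w w' : ew w = ew w' -> F w = F w'.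
  move=> /ew_eq[eI ec es]; rewrite -[w]plane_eta -[w']plane_eta eI.
  apply: (cos_sin_periodic (g := fun x => F (x +i* Im w'))) ec es => x.
  rewrite -(Fper (x +i* _)); congr F; apply: complexP; rewrite !re_imE /= ?addr0//.
have fhatE w : fhat (ew w) = F w by apply: F_ew; rewrite lgK// ew_neq0.
have pull : (fun w => pt (fhat (ew w))) = fun w => pt (F w) by apply/funext => w; rewrite fhatE.
have sm k i j : Ck_on k (punctured_plane R) (fun z => pt (fhat z) i j).
  (* Smoothness is tested after pulling back, where the choice of branch has disappeared. *)
  apply: smooth_of_pullback.
  have -> : (fun w : R[i]^o => pt (fhat (ew w)) i j) = fun w => pt (F w) i j.
    by apply/funext => w; rewrite fhatE.
  exact: smF.
exists fhat; split.
- apply: (mli_of_projector (@open_neq0C R) sm) => z z0.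
  have [w <-] := ew_surj z0; have [lam h] := eqF w.
  exists (lam / csq (ew w)).
  apply: (projector_eqs_pushforward (@open_neq0C R) openT (fun w _ => ew_neq0 w) (sm 2%N) Logic.I).
  by rewrite pull.
- exists Rt; split=> // z z0 t; have [w <-] := ew_surj z0.
  by rewrite -ew_translation !fhatE FR.
- move=> z Mz; have [w e] := ew_surj (M0 z Mz).
  by rewrite -e fhatE FI//; apply/MI; rewrite e.
- exists F; split => //.
  + by apply: mli_of_projector; [exact: openT|exact: smF|move=> w _; exact: eqF].
  + by exists Rt; split => // w _ t; rewrite FR.
Qed.
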